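(* Let $L$ be a first-order language, $K$ a field, and $T$ a model-complete $L$-theory together with $L$-formulas defining, in every model $\mathcal{M}\models T$, an infinite $K$-vector space $(\mathbb{V},0,+,(q\cdot)_{q\in K})$. Let $L_\theta=L\cup\{\theta\}$ and let $T_\theta$ say that $\theta$ restricted to $\mathbb{V}$ is a $K$-linear endomorphism and $\theta(x)=0_{\mathbb{V}}$ for $x\notin\mathbb{V}$. For a polynomial $\rho=\sum_i(\rho)_iX^i\in K[X]$ put $\rho[\theta]=\sum_i(\rho)_i\theta^i$. Let $C$ be a kernel configuration, i.e. a pair $(c,d)$ with $c:K[X]_{\mathrm{irr}}\to\mathbb{N}\cup\{\infty\}$ ($K[X]_{\mathrm{irr}}$ = monic irreducible polynomials) and $d\in\mathbb{N}_{>0}\cup\{\infty\}$ with either $d=\infty$ (transcendental) or $d=\sum_f\deg(f)c(f)$ (algebraic, with $\mathrm{MiPo}(C)=\prod_f f^{c(f)}$); write $C(f)=c(f)$ and $f^C=f^{C(f)}$. $T_\theta^C$ is $T_\theta$ plus: $\mathrm{MiPo}(C)[\theta]=0$ if $C$ is algebraic, resp. $\mathrm{Ker}(f^{C}[\theta])=\mathrm{Ker}(f^{C+1}[\theta])$ for all $f$ with $C(f)<\infty$ if $C$ is transcendental. $\theta$ is $C$-image-complete if $\mathrm{Im}(f^{C+1}[\theta])=\mathrm{Im}(f^C[\theta])$ for all $f$ with $C(f)<\infty$. Assume $T$ satisfies (H4): for every $L$-formula $\psi(\underline x;\underline z)$ there is an $L$-formula $\sigma_\psi(\underline z)$ such that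 for all $\mathcal M\models T$ and $\underline d\in M$, $\mathcal M\models\sigma_\psi(\underline d)$ iff there are $\mathcal M'\succ\mathcal M$ and a tuple $\underline w\in\mathbb V'$ linearly independent over $\mathbb V$ with $\mathcal M'\models\psi(\underline w;\underline d)$. Suppose $\mathcal{D}$ is a suitable set of $L$-formulas that has a splitting strategy. Then any existential $L_\theta$-formula $\phi(\underline{z};\underline{w})$ is, modulo $T_\theta^C\cup\{\text{“}\theta\text{ is }C\text{-image-complete”}\}$, equivalent to a finite disjunction of formulas of the form $$\exists \underline{y}\in Y_{\underline{w}}:\exists \underline{x}\in\mathbb{V}:\ \psi_\theta(\underline{x};\underline{z};\underline{y}\underline{w})\wedge S(\underline{x};\pi(\underline{y})),$$ where (i) $S(\underline{x};\underline{y}')$ is a parametrized $C$-sequence-system; (ii) $\psi(\bar{\underline{x}};\underline{z};\underline{y}\underline{w})\in\mathcal{D}$ is bounded by $S$; (iii) $Y$ is an algebraic pattern in $\underline{w}$, $\pi$ is a coordinate projection, and $(Y,\pi)$ is compatible with $S$.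
   Context: Definitions used. Placeholder notation: for a tuple of variables $\underline x=(x_k)_k$, $\bar{\underline x}=(x_k^i:k,\ i\in\omega)$ is a new tuple of variables, and for a formula $\psi(\bar{\underline x};\dots)$, $\psi_\theta(\underline x;\dots)$ is obtained by replacing each $x_k^i$ by $\theta^i(x_k)$. $R_C$: the commutative ring (under $+,\circ$) of endomorphisms of $\mathbb V$, definable in the theory of $K$-vector spaces with a $C$-image-complete endomorphism $\theta$, generated by all $\rho[\theta]$ ($\rho\in K[X]$), the projections $\pi_{\mathrm{Im}(F^C)}$ onto $\mathrm{Im}(F^C[\theta])$ along $\mathrm{Ker}(F^C[\theta])$ (for finite $F\subseteq\{f:0<C(f)<\infty\}$, $F^C=\prod_{f\in F}f^{C(f)}$; note $\mathbb V=\mathrm{Im}(F^C[\theta])\oplus\mathrm{Ker}(F^C[\theta])$ under $C$-image-completeness), and the maps $\eta[\theta]^{-1}$ for monic $\eta$ all of whose irreducible factors $f$ satisfy $C(f)<\infty$ ($\eta[\theta]^{-1}(x)$ = the unique $u\in\mathrm{Im}(F^C[\theta])$, $F$ the set of irreducible factors of $\eta$, with $\eta[\theta](u)=\pi_{\mathrm{Im}(F^C)}(x)$). A parametrized $C$-sequence-system is a formula $S(\underline x;\underline y)=\bigwedge_{k=1}^n f_k^{q_k}[\theta](x_{\mathrm{ld},k})=y_k$ with $\underline x=\underline x_{\mathrm{li}}\underline x_{\mathrm{ld}}$, $\underline x_{\mathrm{li}}=(x_{\mathrm{li},1},\dots,x_{\mathrm{li},m})$, $\underline x_{\mathrm{ld}}=(x_{\mathrm{ld},1},\dots,x_{\mathrm{ld},n})$,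 where $m=0$ if $C$ is algebraic, $f_k\in K[X]_{\mathrm{irr}}$ with $C(f_k)>0$, and $1\le q_k\le C(f_k)$. A tuple $\underline u\in\mathbb V$ is compatible with $S$ if $u_k\in\mathrm{Ker}(f_k^{C(f_k)-q_k}[\theta])$ for every $k$ with $C(f_k)<\infty$. A formula $\psi(\bar{\underline x};\dots)$ is bounded by $S$ if for each $k$ the variable $x_{\mathrm{ld},k}^i$ does not occur in it whenever $i\ge\deg(f_k^{q_k})$. A set $\mathcal D$ of $L$-formulas $\psi(\bar{\underline x};\underline z;\underline w)$ is suitable if for every $\psi\in\mathcal D$, $\mathcal M\models T$ and $\underline d\in M$, the formula $\psi(\bar{\underline x};\underline z;\underline d)$ is either inconsistent or implies no finite disjunction of non-trivial linear dependencies in $\bar{\underline x}$ over $\mathbb V$. It has a splitting strategy if for every $L$-formula $\psi(\bar{\underline x};\underline z;\underline w)$ there are $L$-formulas $\psi_1,\dots,\psi_N$, each using only variables occurring in $\psi$, with $T\models\forall\underline z\underline w\,\forall\bar{\underline x}\in\mathbb V:\psi\leftrightarrow\bigvee_j\psi_j$, such that each $\psi_j$ either lies in $\mathcal D$ or there are an $L$-formula $\varphi(y;\underline w)$ defining finite subsets of $\mathbb V$ in $y$ and a nonzero tuple $(\lambda_1,\dots,\lambda_{|\underline x|})\in K[X]^{|\underline x|}$ with $T\models\forall\underline z\underline w\,\forall\bar{\underline x}\in\mathbb V:\psi_j\to\varphi(\sum_l\sum_i(\lambda_l)_ix_l^i;\underline w)$. An algebraic pattern $Y$ in $\underline w$ is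 the set defined by an $L_\theta$-formula $\bigwedge_{i=1}^n\exists x\in\mathbb V:y_i=r_i(x)\wedge\varphi_i(x;y_1,\dots,y_{i-1};\underline w)$ with $r_i\in R_C$ and each $\varphi_i$ an $L$-formula algebraic in $x$; $Y_{\underline d}$ is its instance at $\underline d$. $(Y,\pi)$ is compatible with $S$ if $T_\theta^C\cup\{\theta\text{ is }C\text{-image-complete}\}\models\forall\underline w\,\forall\underline y\in Y_{\underline w}$: “$\pi(\underline y)$ is compatible with $S$”. *)

(* Defs.v *)
From HB Require Import structures.
From mathcomp Require Import all_boot all_algebra.
From mathcomp Require Import boolp classical_sets functions cardinality fsbigop.

Set Implicit Arguments.
Unset Strict Implicit.
Unset Printing Implicit Defensive.

Import GRing.Theory.

Local Open Scope classical_set_scope.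
Local Open Scope ring_scope.

Record language := Language {
  fsym : Type;
  far : fsym -> nat;
  rsym : Type;
  rar : rsym -> nat }.

Inductive term (L : language) (X : Type) : Type :=
| Var (x : X)
| App (f : fsym L) (a : 'I_(far f) -> term L X).

Arguments Var {L X} x.
Arguments App {L X} f a.

(* [formula L X]: the L-formulas with free variables in X.  Under a quantifier the
   bound variable is [None] and the outer variables are the [Some x]. *)
Inductive formula (L : language) (X : Type) : Type :=
| Bot
| Eq (t u : term L X)
| Rel (s : rsym L) (a : 'I_(rar s) -> term L X)
| Imp (p q : formula L X)
| And (p q : formula L X)
| Or (p q : formula L X)
| All (p : formula L (option X))
| Ex (p : formula L (option X)).

Arguments Bot {L X}.
Arguments Rel {L X} s a.

Record structure (L : language) := Structure {
  carrier :> Type;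
  carrier_inh : inhabited carrier;
  fint : forall f : fsym L, ('I_(far f) -> carrier) -> carrier;
  rint : forall s : rsym L, ('I_(rar s) -> carrier) -> Prop }.

Arguments fint {L} s f a : rename.
Arguments rint {L} s s0 a : rename.

Fixpoint eval (L : language) (M : structure L) (X : Type) (v : X -> M)
    (t : term L X) : M :=
  match t with
  | Var x => v x
  | App f a => fint M f (fun i => eval v (a i))
  end.

Fixpoint sat (L : language) (M : structure L) (X : Type) (v : X -> M)
    (p : formula L X) {struct p} : Prop :=
  match p with
  | Bot => False
  | Eq t u => eval v t = eval v u
  | Rel s a => rint M s (fun i => eval v (a i))
  | Imp p q => sat v p -> sat v q
  | And p q => sat v p /\ sat v q
  | Or p q => sat v p \/ sat v q
  | All p => forall c : M, sat (oapp v c) p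
  | Ex p => exists c : M, sat (oapp v c) p
  end.

Fixpoint occurs_term (L : language) (X : Type) (x : X) (t : term L X) : Prop :=
  match t with
  | Var y => x = y
  | App _ a => exists i, occurs_term x (a i)
  end.

Fixpoint occurs (L : language) (X : Type) (x : X) (p : formula L X) {struct p} :
    Prop :=
  match p with
  | Bot => False
  | Eq t u => occurs_term x t \/ occurs_term x u
  | Rel s a => exists i, occurs_term x (a i)
  | Imp p q | And p q | Or p q => occurs x p \/ occurs x q
  | All p | Ex p => occurs (Some x) p
  end.

Fixpoint quantifier_free (L : language) (X : Type) (p : formula L X) : Prop :=
  match p with
  | Bot | Eq _ _ | Rel _ _ => True
  | Imp p q | And p q | Or p q => quantifier_free p /\ quantifier_free q
  | All _ | Ex _ => False
  end.

Fixpoint existential (L : language) (X : Type) (p : formula L X) : Prop :=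
  match p with
  | Ex p => existential p
  | p => quantifier_free p
  end.

Definition theory (L : language) := formula L void -> Prop.

Definition models (L : language) (M : structure L) (T : theory L) : Prop :=
  forall p, T p -> sat (of_void M) p.

Definition embedding (L : language) (M N : structure L) (h : M -> N) : Prop :=
  [/\ injective h,
      forall (f : fsym L) (a : 'I_(far f) -> M),
        h (fint M f a) = fint N f (h \o a)
    & forall (s : rsym L) (a : 'I_(rar s) -> M),
        rint M s a <-> rint N s (h \o a)].

Definition elementary (L : language) (M N : structure L) (h : M -> N) : Prop :=
  forall n (p : formula L 'I_n) (v : 'I_n -> M), sat v p <-> sat (h \o v) p.

Definition model_complete (L : language) (T : theory L) : Prop :=
  forall (M N : structure L) (h : M -> N),
    models M T -> models N T -> embedding h -> elementary h.

Definition join (X Y A : Type) (f : X -> A) (g : Y -> A) (s : X + Y) : A :=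
  match s with inl x => f x | inr y => g y end.

Definition cat_tuple (A : Type) m n (f : 'I_m -> A) (g : 'I_n -> A)
    (i : 'I_(m + n)) : A :=
  join f g (fintype.split i).

Definition args1 (A : Type) (a : A) : 'I_1 -> A := fun _ => a.
Definition args2 (A : Type) (a b : A) : 'I_2 -> A := cat_tuple (args1 a) (args1 b).
Definition args3 (A : Type) (a b c : A) : 'I_3 -> A :=
  cat_tuple (args1 a) (args2 b c).

(* [None] is the new unary function symbol. *)
Definition Ltheta (L : language) : language :=
  {| fsym := option (fsym L); far := oapp (@far L) 1%N;
     rsym := rsym L; rar := @rar L |}.

Definition reduct (L : language) (N : structure (Ltheta L)) : structure L :=
  {| carrier := N; carrier_inh := carrier_inh N;
     fint := fun f => fint N (Some f : fsym (Ltheta L));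
     rint := fun s => rint N (s : rsym (Ltheta L)) |}.

Definition theta_of (L : language) (N : structure (Ltheta L)) (x : N) : N :=
  fint N (None : fsym (Ltheta L)) (fun _ => x).

Definition theta_term (L : language) (X : Type) (t : term (Ltheta L) X) :
    term (Ltheta L) X :=
  App (None : fsym (Ltheta L)) (fun _ => t).

Fixpoint rename_term (L : language) (X Y : Type) (s : X -> Y) (t : term L X) :
    term L Y :=
  match t with
  | Var x => Var (s x)
  | App f a => App f (fun i => rename_term s (a i))
  end.

Fixpoint subst_term (L : language) (X Y : Type) (s : X -> term (Ltheta L) Y)
    (t : term L X) : term (Ltheta L) Y :=
  match t with
  | Var x => s x
  | App f a => App (Some f : fsym (Ltheta L)) (fun i => subst_term s (a i))
  end.

Definition lift_subst (L : language) (X Y : Type)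
    (s : X -> term (Ltheta L) Y) (o : option X) : term (Ltheta L) (option Y) :=
  if o is Some x then rename_term Some (s x) else Var None.

Fixpoint subst (L : language) (X Y : Type) (s : X -> term (Ltheta L) Y)
    (p : formula L X) {struct p} : formula (Ltheta L) Y :=
  match p with
  | Bot => Bot
  | Eq t u => Eq (subst_term s t) (subst_term s u)
  | Rel r a => Rel (r : rsym (Ltheta L)) (fun i => subst_term s (a i))
  | Imp p q => Imp (subst s p) (subst s q)
  | And p q => And (subst s p) (subst s q)
  | Or p q => Or (subst s p) (subst s q)
  | All p => All (subst (lift_subst s) p)
  | Ex p => Ex (subst (lift_subst s) p)
  end.

(* Formulas psi(xbar; z; w) with x, z, w of lengths n, p, r; the placeholder
   variable x_k^i is [inl (inl (k, i))]. *)
Definition pform (L : language) (n p r : nat) : Type :=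
  formula L ('I_n * nat + 'I_p + 'I_r).

Definition passign (A : Type) n p r (x : 'I_n -> nat -> A) (z : 'I_p -> A)
    (w : 'I_r -> A) : 'I_n * nat + 'I_p + 'I_r -> A :=
  join (join (fun ki => x ki.1 ki.2) z) w.

Definition psi_theta (L : language) n p r (psi : pform L n p r) :
    formula (Ltheta L) ('I_n + 'I_p + 'I_r) :=
  subst (join (join (fun ki => iter ki.2 (@theta_term L _) (Var (inl (inl ki.1))))
                    (fun j => Var (inl (inr j))))
              (fun j => Var (inr j))) psi.

(* [fadd] and [fscale q] define the graphs x0 + x1 = x2 and q . x0 = x1. *)
Record vs_formulas (L : language) (K : fieldType) := VsFormulas {
  fV : formula L 'I_1;
  f0 : formula L 'I_1;
  fadd : formula L 'I_3;
  fscale : K -> formula L 'I_2 }.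

Section VectorSpace.
Variables (L : language) (K : fieldType) (F : vs_formulas L K).

Definition inV (M : structure L) (x : M) : Prop := sat (args1 x) (fV F).

(* A K-vector space structure on V(M) whose operations are the ones defined by
   the formulas; these determine the operations. *)
Record vspace_in (M : structure L) := VspaceIn {
  vs_class : GRing.Lmodule K {x : M | inV x};
  vs :> lmodType K := GRing.Lmodule.Pack vs_class;
  vval : vs -> M := fun v => proj1_sig (v : {x : M | inV x});
  vval0 : forall x, sat (args1 x) (f0 F) <-> x = vval 0;
  vvalD : forall (u v : vs) x,
    sat (args3 (vval u) (vval v) x) (fadd F) <-> x = vval (u + v);
  vvalZ : forall q (u : vs) x,
    sat (args2 (vval u) x) (fscale F q) <-> x = vval (q *: u) }.

End VectorSpace.

Record model (L : language) (K : fieldType) (T : theory L)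
    (F : vs_formulas L K) := Model {
  md_str :> structure L;
  md_T : models md_str T;
  md_vs : vspace_in F md_str }.

Definition VS (L : language) (K : fieldType) (T : theory L)
  (F : vs_formulas L K) (M : model T F) : lmodType K := md_vs M.

Definition toM (L : language) (K : fieldType) (T : theory L)
  (F : vs_formulas L K) (M : model T F) (v : VS M) : M := vval v.

(* Models of T_theta: the L_theta-structures whose reduct is a model of T and
   whose function theta restricts to a K-linear map [mt_theta] of V and is 0
   outside V; [mt_vs] and [mt_theta] are determined by [mt_str]. *)
Record model_theta (L : language) (K : fieldType) (T : theory L)
    (F : vs_formulas L K) := ModelTheta {
  mt_str :> structure (Ltheta L);
  mt_T : models (reduct mt_str) T;
  mt_vs : vspace_in F (reduct mt_str);
  mt_theta : {linear mt_vs -> mt_vs};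
  mt_thetaV : forall v : mt_vs, theta_of (vval v : mt_str) = vval (mt_theta v);
  mt_theta0 : forall x : reduct mt_str, ~ inV F x ->
    theta_of (x : mt_str) = vval (0 : mt_vs) }.

Definition VST (L : language) (K : fieldType) (T : theory L)
  (F : vs_formulas L K) (N : model_theta T F) : lmodType K := mt_vs N.

Definition toN (L : language) (K : fieldType) (T : theory L)
  (F : vs_formulas L K) (N : model_theta T F) (v : VST N) : N := vval v.

Section Endomorphism.
Variables (K : fieldType) (V : lmodType K).
Implicit Types (rho : {poly K}) (theta : V -> V).

Definition pev rho theta (v : V) : V :=
  \sum_(i < size rho) rho`_i *: iter i theta v.

Definition Ker rho theta : set V := [set v | pev rho theta v = 0].

Definition Im rho theta : set V := range (pev rho theta).

End Endomorphism.

Definition Kirr (K : fieldType) : set {poly K} :=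
  [set f | f \is monic /\ irreducible_poly f].

(* [None] stands for infinity; the values of [kc] outside [Kirr] are irrelevant. *)
Record kernel_config (K : fieldType) := KernelConfig {
  kc :> {poly K} -> option nat;
  kd : option nat;
  kd_gt0 : kd <> Some 0%N;
  kd_alg : forall d, kd = Some d ->
    [/\ forall f, Kirr f -> isSome (kc f),
        finite_set [set f | Kirr f /\ kc f <> Some 0%N]
      & d = \big[addn/0%N]_(f \in @Kirr K) ((size f).-1 * odflt 0 (kc f))%N] }.

Definition le_inf (n : nat) (c : option nat) : bool :=
  if c is Some k then (n <= k)%N else true.

Section KernelConfig.
Variables (K : fieldType) (C : kernel_config K).

Definition algebraic_kc : Prop := isSome (kd C).

(* Only used when C(f) is finite. *)
Definition cfin (f : {poly K}) : nat := odflt 0%N (C f).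

(* F^C = prod_(f in F) f^C(f), for a set F with finitely many f such that
   C(f) <> 0. *)
Definition prodC (F : set {poly K}) : {poly K} :=
  \big[*%R/1]_(f \in F) f ^+ cfin f.

Definition MiPo : {poly K} := prodC (@Kirr K).

Definition kernel_condition (V : lmodType K) (theta : V -> V) : Prop :=
  if kd C is Some _ then forall v, pev MiPo theta v = 0
  else forall f, Kirr f -> isSome (C f) ->
         Ker (f ^+ cfin f) theta = Ker (f ^+ (cfin f).+1) theta.

Definition image_complete (V : lmodType K) (theta : V -> V) : Prop :=
  forall f, Kirr f -> isSome (C f) ->
    Im (f ^+ (cfin f).+1) theta = Im (f ^+ cfin f) theta.

Definition irr_factors (eta : {poly K}) : set {poly K} :=
  [set f | Kirr f /\ f %| eta].

(* The elements of R_C, as ring expressions in the generators, so that they can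
   be interpreted uniformly in all models.  Opposites are obtained by composing
   with [rc_poly (-1)]. *)
Inductive RC : Type :=
| rc_poly (rho : {poly K})
| rc_proj (F : set {poly K}) of finite_set F
    & (forall f, F f -> [/\ Kirr f, isSome (C f) & C f <> Some 0%N])
| rc_inv (eta : {poly K}) of eta \is monic
    & (forall f, irr_factors eta f -> isSome (C f))
| rc_add of RC & RC
| rc_comp of RC & RC.

Section Interpretation.
Variables (V : lmodType K) (theta : V -> V).

(* The [xget]s below pick an element that is unique when theta is
   C-image-complete and satisfies the kernel condition. *)
Definition projIm (F : set {poly K}) (x : V) : V :=
  xget 0 [set u | Im (prodC F) theta u /\ Ker (prodC F) theta (x - u)].

Definition pinv (eta : {poly K}) (x : V) : V :=
  xget 0 [set u | Im (prodC (irr_factors eta)) theta u /\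
                  pev eta theta u = projIm (irr_factors eta) x].

Fixpoint rc_eval (a : RC) : V -> V :=
  match a with
  | rc_poly rho => pev rho theta
  | rc_proj F _ _ => projIm F
  | rc_inv eta _ _ => pinv eta
  | rc_add a b => fun x => rc_eval a x + rc_eval b x
  | rc_comp a b => rc_eval a \o rc_eval b
  end.

End Interpretation.

(* x = x_li x_ld is indexed by 'I_(m + n), and x_(ld,k) is x (rshift m k). *)
Record seqsys := SeqSys {
  ss_m : nat;
  ss_n : nat;
  ss_f : 'I_ss_n -> {poly K};
  ss_q : 'I_ss_n -> nat;
  ss_m0 : algebraic_kc -> ss_m = 0%N;
  ss_irr : forall k, Kirr (ss_f k);
  ss_C0 : forall k, C (ss_f k) <> Some 0%N;
  ss_q_gt0 : forall k, (1 <= ss_q k)%N;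
  ss_q_le : forall k, le_inf (ss_q k) (C (ss_f k)) }.

Definition ss_holds (S : seqsys) (V : lmodType K) (theta : V -> V)
    (x : 'I_(ss_m S + ss_n S) -> V) (y : 'I_(ss_n S) -> V) : Prop :=
  forall k, pev (ss_f k ^+ ss_q k) theta (x (rshift (ss_m S) k)) = y k.

Definition ss_compatible (S : seqsys) (V : lmodType K) (theta : V -> V)
    (u : 'I_(ss_n S) -> V) : Prop :=
  forall k, isSome (C (ss_f k)) ->
    Ker (ss_f k ^+ (cfin (ss_f k) - ss_q k)) theta (u k).

Definition bounded_by (L : language) p r (S : seqsys)
    (psi : pform L (ss_m S + ss_n S) p r) : Prop :=
  forall (k : 'I_(ss_n S)) (i : nat), ((size (ss_f k ^+ ss_q k)).-1 <= i)%N ->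
    ~ occurs (inl (inl (rshift (ss_m S) k, i))) psi.

End KernelConfig.

(* w in V(M') is linearly independent over the image of V(M) under h. *)
Definition lin_indep_over (L : language) (K : fieldType) (T : theory L)
    (F : vs_formulas L K) (M M' : model T F) (h : M -> M') n
    (w : 'I_n -> VS M') : Prop :=
  forall (lam : 'I_n -> K) (v : VS M),
    toM (\sum_(i < n) lam i *: w i) = h (toM v) -> forall i, lam i = 0.

Definition hypH4 (L : language) (K : fieldType) (T : theory L)
    (F : vs_formulas L K) : Prop :=
  forall n p (psi : formula L ('I_n + 'I_p)), exists sigma : formula L 'I_p,
  forall (M : model T F) (d : 'I_p -> M),
    sat d sigma <->
    exists (M' : model T F) (h : M -> M') (w : 'I_n -> VS M'),
      [/\ elementary h, lin_indep_over h w
        & sat (join (fun i => toM (w i)) (h \o d)) psi].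

Definition formula_set (L : language) : Type :=
  forall n p r, pform L n p r -> Prop.

(* sum_l sum_i (lam_l)_i x_l^i *)
Definition lin_form (K : fieldType) (V : lmodType K) n (lam : 'rV[{poly K}]_n)
    (x : 'I_n -> nat -> V) : V :=
  \sum_(l < n) \sum_(i < size (lam 0 l)) (lam 0 l)`_i *: x l i.

Section Suitable.
Variables (L : language) (K : fieldType) (T : theory L) (F : vs_formulas L K).

Definition psat (M : model T F) n p r (psi : pform L n p r)
    (x : 'I_n -> nat -> VS M) (z : 'I_p -> M) (w : 'I_r -> M) : Prop :=
  sat (passign (fun l i => toM (x l i)) z w) psi.

(* A pair (lam, v) of [deps] stands for the dependency [lin_form lam x = v]. *)
Definition suitable (D : formula_set L) : Prop :=
  forall n p r (psi : pform L n p r), D n p r psi ->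
  forall (M : model T F) (d : 'I_r -> M),
    (forall x z, ~ psat psi x z d) \/
    ~ exists deps : seq ('rV[{poly K}]_n * VS M),
        (forall e, e \in deps -> e.1 != 0) /\
        (forall x z, psat psi x z d ->
           exists2 e, e \in deps & lin_form e.1 x = e.2).

Definition splitting_strategy (D : formula_set L) : Prop :=
  forall n p r (psi : pform L n p r),
  exists (N : nat) (psis : 'I_N -> pform L n p r),
  [/\ forall j v, occurs v (psis j) -> occurs v psi,
      forall (M : model T F) x (z : 'I_p -> M) w,
        psat psi x z w <-> exists j, psat (psis j) x z w
    & forall j, D n p r (psis j) \/
        exists (phi : formula L ('I_1 + 'I_r)) (lam : 'rV[{poly K}]_n),
        [/\ forall (M : model T F) (d : 'I_r -> M),
              let A := [set y : M | sat (join (args1 y) d) phi] in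
              finite_set A /\ A `<=` [set y | inV F y],
            lam != 0
          & forall (M : model T F) x (z : 'I_p -> M) w,
              psat (psis j) x z w ->
              sat (join (args1 (toM (lin_form lam x))) w) phi]].

Variable C : kernel_config K.

(* The instance at w of the pattern is
   { y | for all i, exists x in V, y_i = r_i(x) /\ phi_i(x; y_0..y_(i-1); w) }. *)
Record pattern (s r : nat) := Pattern {
  pt_r : 'I_s -> RC C;
  pt_phi : forall i : 'I_s, formula L ('I_1 + 'I_i + 'I_r) }.

Definition below (A : Type) s (y : 'I_s -> A) (i : 'I_s) (j : 'I_i) : A :=
  y (widen_ord (ltnW (ltn_ord i)) j).

Definition algebraic_pattern s r (Y : pattern s r) : Prop :=
  forall (i : 'I_s) (M : model T F) (y : 'I_i -> M) (w : 'I_r -> M),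
    finite_set [set x : M | sat (join (join (args1 x) y) w) (pt_phi Y i)].

Definition in_pattern s r (Y : pattern s r) (N : model_theta T F)
    (w : 'I_r -> N) (y : 'I_s -> VST N) : Prop :=
  forall i, exists x : VST N,
    y i = rc_eval (@mt_theta _ _ _ _ N) (pt_r Y i) x /\
    sat (M := reduct N)
        (join (join (args1 (toN x)) (below (fun j => toN (y j)) (i := i))) w)
        (pt_phi Y i).

(* Models of T_theta^C in which theta is C-image-complete. *)
Definition TC_image_complete (N : model_theta T F) : Prop :=
  kernel_condition C (@mt_theta _ _ _ _ N) /\
  image_complete C (@mt_theta _ _ _ _ N).

Definition pattern_compatible s r (Y : pattern s r) (S : seqsys C)
    (pi : 'I_(ss_n S) -> 'I_s) : Prop :=
  forall N : model_theta T F, TC_image_complete N ->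
  forall (w : 'I_r -> N) (y : 'I_s -> VST N), in_pattern Y w y ->
    ss_compatible (S := S) (@mt_theta _ _ _ _ N) (y \o pi).

(* The data of one disjunct; [dj_pi] lists the coordinates kept by the
   projection. *)
Record disjunct (p r : nat) := Disjunct {
  dj_S : seqsys C;
  dj_s : nat;
  dj_Y : pattern dj_s r;
  dj_pi : 'I_(ss_n dj_S) -> 'I_dj_s;
  dj_psi : pform L (ss_m dj_S + ss_n dj_S) p (dj_s + r) }.

Definition admissible (D : formula_set L) p r (E : disjunct p r) : Prop :=
  [/\ D _ _ _ (dj_psi E), bounded_by (S := dj_S E) (dj_psi E),
      algebraic_pattern (dj_Y E), injective (@dj_pi _ _ E)
    & pattern_compatible (dj_Y E) (@dj_pi _ _ E)].

(* exists y in Y_w, exists x in V, psi_theta(x; z; y w) /\ S(x; pi(y)) *)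
Definition disjunct_holds p r (E : disjunct p r) (N : model_theta T F)
    (z : 'I_p -> N) (w : 'I_r -> N) : Prop :=
  exists2 y : 'I_(dj_s E) -> VST N, in_pattern (dj_Y E) w y &
  exists x : 'I_(ss_m (dj_S E) + ss_n (dj_S E)) -> VST N,
    sat (join (join (fun k => toN (x k)) z) (cat_tuple (fun j => toN (y j)) w))
        (psi_theta (dj_psi E)) /\
    ss_holds (S := dj_S E) (@mt_theta _ _ _ _ N) x (y \o @dj_pi _ _ E).

End Suitable.

(* Main.v *)
(* Replacing every application of theta to a term by a new vector variable turns
   an existential L_theta-formula into "exists x in V, psi_theta(x; z; w)" for an
   L-formula psi; when C is algebraic, each x also satisfies MiPo(C)[theta](x) = 0.
   In general one works with systems "psi_theta(x) and g_b[theta](x_b) = y_b for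
   some of the variables", with parameters y from an algebraic pattern.

   The primary decomposition of the g_b, together with the splitting of V into the
   image and the kernel of f^C[theta] when C(f) is finite, rewrites such a system as a
   compatible sequence system; reduction modulo the f^q makes psi bounded.  The
   splitting strategy then yields formulas in D, inconsistent ones (a dependency
   involving a variable on which psi_j does not depend would force V to be finite),
   and formulas implying a dependency sum_l lambda_l[theta](x_l) = a with a algebraic.

   In the last case the system gets simpler.  If a free variable is involved, clear
   the constrained ones by multiplying with the product of the g_b; a unimodular
   substitution makes a single free variable occur, which becomes constrained.
   Otherwise a multiple of the relation and a substitution lower the exponent of one
   constraint f^q.  So the pair (number of free variables, sum of the degrees of the
   g_b) decreases lexicographically. *)
Require Import Defs.
From HB Require Import structures.
From mathcomp Require Import all_boot all_algebra.
From mathcomp Require Import boolp classical_sets functions cardinality fsbigop.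

Set Implicit Arguments.
Unset Strict Implicit.
Unset Printing Implicit Defensive.

Import GRing.Theory.

Local Open Scope classical_set_scope.
Local Open Scope ring_scope.

(** * Formulas: renaming, occurrences, quantifier blocks *)

(** The obstacle is that the value of an element of [RC] at a parameter y cannot be expressed in L.
    Every such value that enters a formula has to be stored as a coordinate of the pattern, and a
    pattern has only finitely many. This is why a bound on the exponents i of the variables x_k^i of
    a formula is carried along.

    In each change of variables the old constraints stay inside the L-relation on the orbits
    theta^i(x). So it suffices that every old solution comes from new unknowns: an old tuple
    computed from new unknowns is tested by the relation that was kept.

    Boundedness is what makes the measure drop. If only x_k^i with i below the degree of f_k^q_k are
    involved, a nonzero coefficient lambda_k has smaller degree than f_k^q_k. It is then not
    divisible by it, so the relation is nonzero in the torsion module formed by the K[X]/(f_k^q_k).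
    Returning to a sequence system keeps the number of free variables and does not raise the sum of
    the degrees.

    Formulas are treated as uniformly definable families of relations ([vdef]); syntax returns only
    where occurrences of variables matter. *)

Fixpoint rename_form (L : language) (X Y : Type) (s : X -> Y)
    (p : formula L X) {struct p} : formula L Y :=
  match p with
  | Bot => Bot
  | Eq t u => Eq (rename_term s t) (rename_term s u)
  | Rel r a => Rel r (fun i => rename_term s (a i))
  | Imp p q => Imp (rename_form s p) (rename_form s q)
  | And p q => And (rename_form s p) (rename_form s q)
  | Or p q => Or (rename_form s p) (rename_form s q)
  | All p => All (rename_form (omap s) p)
  | Ex p => Ex (rename_form (omap s) p)
  end.

Lemma eval_rename (L : language) (M : structure L) (X Y : Type) (s : X -> Y)
    (v : Y -> M) (t : term L X) :
  eval v (rename_term s t) = eval (v \o s) t.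
Proof. by elim: t => [//|f a IH] /=; congr fint; apply/funext. Qed.

Lemma oapp_omap (X Y A : Type) (s : X -> Y) (v : Y -> A) (c : A) :
  oapp v c \o omap s = oapp (v \o s) c.
Proof. by apply/funext => -[]. Qed.

Lemma sat_rename (L : language) (M : structure L) (X Y : Type) (s : X -> Y)
    (v : Y -> M) (p : formula L X) :
  sat v (rename_form s p) <-> sat (v \o s) p.
Proof.
elim: X / p Y s v => [X|X t u|X r a|X p IHp q IHq|X p IHp q IHq|X p IHp q IHq
                     |X p IHp|X p IHp] Y s v /=.
- by [].
- by rewrite !eval_rename.
- by under eq_fun do rewrite eval_rename.
- by rewrite IHp IHq.
- by rewrite IHp IHq.
- by rewrite IHp IHq.
- by split=> H c; move: (H c); rewrite IHp oapp_omap.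
- by split=> -[c H]; exists c; move: H; rewrite IHp oapp_omap.
Qed.

Lemma occurs_rename_term (L : language) (X Y : Type) (s : X -> Y)
    (t : term L X) y :
  occurs_term y (rename_term s t) -> exists2 x, y = s x & occurs_term x t.
Proof.
elim: t => [x|f a IH] /=; first by move=> ->; exists x.
by move=> [i /IH[x ? ?]]; exists x => //; exists i.
Qed.

Lemma occurs_rename (L : language) (X Y : Type) (s : X -> Y)
    (p : formula L X) y :
  occurs y (rename_form s p) -> exists2 x, y = s x & occurs x p.
Proof.
elim: X / p Y s y => [X|X t u|X r a|X p IHp q IHq|X p IHp q IHq|X p IHp q IHq
                     |X p IHp|X p IHp] Y s y //=.
- by case=> Ho; have [x ? ?] := occurs_rename_term Ho; exists x => //; [left|right].
- by case=> i Ho; have [x ? ?] := occurs_rename_term Ho; exists x => //; exists i.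
- by case=> Ho; [have [x ? ?] := IHp _ _ _ Ho|have [x ? ?] := IHq _ _ _ Ho];
    exists x => //; [left|right].
- by case=> Ho; [have [x ? ?] := IHp _ _ _ Ho|have [x ? ?] := IHq _ _ _ Ho];
    exists x => //; [left|right].
- by case=> Ho; [have [x ? ?] := IHp _ _ _ Ho|have [x ? ?] := IHq _ _ _ Ho];
    exists x => //; [left|right].
- by move=> Ho; have [[x|] //= [->] ?] := IHp _ _ _ Ho; exists x.
- by move=> Ho; have [[x|] //= [->] ?] := IHp _ _ _ Ho; exists x.
Qed.

Lemma eval_occurs (L : language) (M : structure L) (X : Type) (v v' : X -> M)
    (t : term L X) :
  (forall x, occurs_term x t -> v x = v' x) -> eval v t = eval v' t.
Proof.
elim: t => [x|f a IH] /= H; first exact: H.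
by congr fint; apply/funext => i; apply: IH => x Hx; apply: H; exists i.
Qed.

Lemma sat_occurs (L : language) (M : structure L) (X : Type) (v v' : X -> M)
    (p : formula L X) :
  (forall x, occurs x p -> v x = v' x) -> sat v p <-> sat v' p.
Proof.
elim: X / p v v' => [X|X t u|X r a|X p IHp q IHq|X p IHp q IHq|X p IHp q IHq
                     |X p IHp|X p IHp] v v' //= H.
- have E : eval v t = eval v' t by apply: eval_occurs => x ?; apply: H; left.
  have E' : eval v u = eval v' u by apply: eval_occurs => x ?; apply: H; right.
  by rewrite E E'.
- have -> // : (fun i => eval v (a i)) = (fun i => eval v' (a i)).
  by apply/funext => i; apply: eval_occurs => x ?; apply: H; exists i.
- by rewrite (IHp v v') ?(IHq v v') // => x ?; apply: H; [right|left].
- by rewrite (IHp v v') ?(IHq v v') // => x ?; apply: H; [right|left].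
- by rewrite (IHp v v') ?(IHq v v') // => x ?; apply: H; [right|left].
- have E c : sat (oapp v c) p <-> sat (oapp v' c) p.
    by apply: IHp => -[x|] //=; apply: H.
  by split=> Hs c; apply/E.
- have E c : sat (oapp v c) p <-> sat (oapp v' c) p.
    by apply: IHp => -[x|] //=; apply: H.
  by split=> -[c Hs]; exists c; apply/E.
Qed.

Lemma fin_bound k (P : 'I_k -> nat -> Prop) :
  (forall i, exists N, forall x, P i x -> (x < N)%N) ->
  exists N, forall i x, P i x -> (x < N)%N.
Proof.
move=> /choice[g Hg]; exists (\max_i g i) => i x /Hg Hx.
exact: leq_trans Hx (leq_bigmax i).
Qed.

Lemma occurs_term_bound (L : language) (X : Type) (h : X -> nat)
    (t : term L X) : exists N, forall x, occurs_term x t -> (h x < N)%N.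
Proof.
elim: t => [x|f a IH] /=; first by exists (h x).+1 => _ ->.
have [|N HN] := @fin_bound _ (fun i m => exists2 x, m = h x & occurs_term x (a i)).
  by move=> i; have [N HN] := IH i; exists N => _ [x -> /HN].
by exists N => x [i Hi]; apply: (HN i); exists x.
Qed.

(** Arities are finite, so only finitely many variables occur even when the variable type is
    infinite. The weight [h] will be the exponent i of x_k^i; bound variables get weight 0. *)
Lemma occurs_bound (L : language) (X : Type) (h : X -> nat) (p : formula L X) :
  exists N, forall x, occurs x p -> (h x < N)%N.
Proof.
have max2 (Y : Type) (h' : Y -> nat) (P Q : Y -> Prop) :
    (exists N, forall x, P x -> (h' x < N)%N) ->
    (exists N, forall x, Q x -> (h' x < N)%N) ->
    exists N, forall x, P x \/ Q x -> (h' x < N)%N.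
  move=> [N1 H1] [N2 H2]; exists (maxn N1 N2) => x.
  by case=> [/H1|/H2]; rewrite leq_max => ->; rewrite ?orbT.
elim: X / p h => [X|X t u|X r a|X p IHp q IHq|X p IHp q IHq|X p IHp q IHq
                     |X p IHp|X p IHp] h /=.
- by exists 0%N.
- by apply: max2; apply: occurs_term_bound.
- have [|N HN] := @fin_bound _ (fun i m => exists2 x, m = h x & occurs_term x (a i)).
    move=> i; have [N HN] := occurs_term_bound h (a i).
    by exists N => _ [x -> /HN].
  by exists N => x [i Hi]; apply: (HN i); exists x.
- exact: max2.
- exact: max2.
- exact: max2.
- by have [N HN] := IHp (oapp h 0%N); exists N => x /HN.
- by have [N HN] := IHp (oapp h 0%N); exists N => x /HN.
Qed.

Lemma eval_subst (L : language) (N : structure (Ltheta L)) (X Y : Type)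
    (s : X -> term (Ltheta L) Y) (v : Y -> N) (t : term L X) :
  eval v (subst_term s t) = eval (M := reduct N) (fun x => eval v (s x)) t.
Proof. by elim: t => [//|f a IH] /=; congr fint; apply/funext. Qed.

Lemma sat_subst (L : language) (N : structure (Ltheta L)) (X Y : Type)
    (s : X -> term (Ltheta L) Y) (v : Y -> N) (p : formula L X) :
  sat v (subst s p) <-> sat (M := reduct N) (fun x => eval v (s x)) p.
Proof.
have lift (Z W : Type) (s' : Z -> term (Ltheta L) W) (v' : W -> N) (c : N) :
    (fun x => eval (oapp v' c) (lift_subst s' x)) =
    oapp (fun x => eval v' (s' x)) c.
  by apply/funext => -[x|] //=; rewrite eval_rename.
elim: X / p Y s v => [X|X t u|X r a|X p IHp q IHq|X p IHp q IHq|X p IHp q IHq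
                     |X p IHp|X p IHp] Y s v /=.
- by [].
- by rewrite !eval_subst.
- by under eq_fun do rewrite eval_subst.
- by rewrite IHp IHq.
- by rewrite IHp IHq.
- by rewrite IHp IHq.
- by split=> H c; move: (H c); rewrite IHp lift.
- by split=> -[c H]; exists c; move: H; rewrite IHp lift.
Qed.

Lemma form_ex_ord (L : language) k (X : Type) (p : formula L ('I_k + X)) :
  exists p' : formula L X, forall (M : structure L) (v : X -> M),
    sat v p' <-> exists c : 'I_k -> M, sat (join c v) p.
Proof.
elim: k X p => [|k IH] X p.
  pose s (x : 'I_0 + X) : X :=
    match x with inl i => False_rect _ (notF (ltn_ord i)) | inr x => x end.
  exists (rename_form s p) => M v; rewrite sat_rename.
  have E c : v \o s = join c v by apply/funext => -[[]|].
  split=> [H|[c H]]; last by rewrite (E c).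
  by exists (fun i : 'I_0 => False_rect _ (notF (ltn_ord i))); rewrite -E.
pose s (x : 'I_k.+1 + X) : 'I_k + option X :=
  match x with
  | inl i => if unlift ord0 i is Some j then inl j else inr None
  | inr x => inr (Some x) end.
have [p' Hp'] := IH _ (rename_form s p).
exists (Ex p') => M v /=; split=> [[c /Hp'[d]]|[c H]].
  rewrite sat_rename => H; exists (fun i => oapp d c (unlift ord0 i)).
  by move: H; congr (sat _ p); apply/funext => -[i|x] //=; case: (unlift _ i).
exists (c ord0); apply/Hp'; exists (fun j => c (lift ord0 j)).
rewrite sat_rename; move: H; congr (sat _ p); apply/funext => -[i|x] //=.
by case: unliftP => [j|] ->.
Qed.

Lemma form_ex_fin (L : language) (I : finType) (X : Type)
    (p : formula L (I + X)) :
  exists p' : formula L X, forall (M : structure L) (v : X -> M),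
    sat v p' <-> exists c : I -> M, sat (join c v) p.
Proof.
pose s (x : I + X) : 'I_#|I| + X :=
  match x with inl i => inl (enum_rank i) | inr x => inr x end.
have [p' Hp'] := form_ex_ord (rename_form s p).
exists p' => M v; rewrite Hp'; split=> -[c]; rewrite ?sat_rename => H.
  exists (c \o enum_rank); move: H; congr (sat _ p).
  by apply/funext => -[].
exists (c \o enum_val); rewrite sat_rename; move: H; congr (sat _ p).
by apply/funext => -[i|x] //=; rewrite enum_rankK.
Qed.

(** * Definable relations between vectors and elements *)

(** A formal combination is kept as a list, so that its variables can be renamed before it is
    evaluated. *)
Definition leval (K : fieldType) (V : lmodType K) (X : Type) (v : X -> V)
    (e : seq (K * X)) : V :=
  \sum_(ca <- e) ca.1 *: v ca.2.

Section Definability.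
Variables (L : language) (K : fieldType) (T : theory L) (F : vs_formulas L K).

Lemma toM_inj (M : model T F) : injective (@toM _ _ _ _ M).
Proof. by move=> u v; apply: eq_sig_hprop => x p q; exact: Prop_irrelevance. Qed.

Lemma toM_inV (M : model T F) (v : VS M) : inV F (toM v).
Proof. exact: (proj2_sig (v : {x : M | inV F x})). Qed.

Lemma inV_toM (M : model T F) (x : M) : inV F x -> exists v : VS M, toM v = x.
Proof. by move=> Hx; exists (exist _ x Hx : {x : M | inV F x}). Qed.

Definition vpred Xv Xm : Type :=
  forall M : model T F, (Xv -> VS M) -> (Xm -> M) -> Prop.

(** One formula serves all models, so closure properties of [vdef] replace the explicit construction
    of formulas. Vector variables are separated from element variables because linear operations
    make sense only on the former. *)
Definition vdef Xv Xm (P : vpred Xv Xm) : Prop :=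
  exists p : formula L (Xv + Xm), forall (M : model T F) v u,
    sat (join (fun x => toM (v x)) u) p <-> P M v u.

Section Closure.
Variables (Xv Xm : Type).
Implicit Types (P Q : vpred Xv Xm).

Lemma vd_ext P Q : (forall M v u, P M v u <-> Q M v u) -> vdef P -> vdef Q.
Proof. by move=> H [p Hp]; exists p => M v u; rewrite Hp H. Qed.

Lemma vd_and P Q : vdef P -> vdef Q -> vdef (fun M v u => P M v u /\ Q M v u).
Proof. by move=> [p Hp] [q Hq]; exists (And p q) => M v u /=; rewrite Hp Hq. Qed.

Lemma vd_or P Q : vdef P -> vdef Q -> vdef (fun M v u => P M v u \/ Q M v u).
Proof. by move=> [p Hp] [q Hq]; exists (Or p q) => M v u /=; rewrite Hp Hq. Qed.

Lemma vd_imp P Q : vdef P -> vdef Q -> vdef (fun M v u => P M v u -> Q M v u).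
Proof. by move=> [p Hp] [q Hq]; exists (Imp p q) => M v u /=; rewrite Hp Hq. Qed.

Lemma vd_false : vdef (fun (M : model T F) (v : Xv -> VS M) (u : Xm -> M) => False).
Proof. by exists Bot. Qed.

Lemma vd_true : vdef (fun (M : model T F) (v : Xv -> VS M) (u : Xm -> M) => True).
Proof. by exists (Imp Bot Bot) => M v u /=; split. Qed.

Lemma vd_all_fin (I : finType) (P : I -> vpred Xv Xm) :
  (forall i, vdef (P i)) -> vdef (fun M v u => forall i, P i M v u).
Proof.
move=> HP.
apply: (@vd_ext (fun M v u => forall i, i \in enum I -> P i M v u)).
  move=> M v u; split=> H i; last by move=> _; apply: H.
  by apply: H; rewrite mem_enum.
elim: (enum I) => [|i s IH].
  by apply: (@vd_ext (fun M v u => True)) => //; exact: vd_true.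
apply: (@vd_ext (fun M v u => P i M v u /\ forall i, i \in s -> P i M v u)).
  move=> M v u; split=> [[H1 H2] j|H].
    by rewrite inE => /predU1P[->|/H2].
  by split=> [|j js]; apply: H; rewrite inE ?eqxx // js orbT.
exact: vd_and.
Qed.

Lemma vd_ren (Yv Ym : Type) (P : vpred Yv Ym) (s : Yv -> Xv) (t : Ym -> Xv + Xm) :
  vdef P ->
  vdef (fun M v u => P M (v \o s) (join (fun x => toM (v x)) u \o t)).
Proof.
move=> [p Hp].
pose st (x : Yv + Ym) := match x with inl x => inl (s x) | inr x => t x end.
exists (rename_form st p) => M v u; rewrite sat_rename -Hp.
by rewrite (_ : _ \o _ = join (fun x => toM ((v \o s) x)) (join (fun x => toM (v x)) u \o t)) //;
   apply/funext => -[].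
Qed.

Lemma vd_sub (Yv Ym : Type) (P : vpred Yv Ym) (s : Yv -> Xv) (t : Ym -> Xm) :
  vdef P -> vdef (fun M v u => P M (v \o s) (u \o t)).
Proof. exact: (@vd_ren _ _ P s (inr \o t)). Qed.

Lemma vd_exfinM (I : finType) (P : vpred Xv (I + Xm)) :
  vdef P -> vdef (fun M v u => exists c : I -> M, P M v (join c u)).
Proof.
move=> [p Hp].
pose s (x : Xv + (I + Xm)) : I + (Xv + Xm) := match x with
  | inl x => inr (inl x) | inr (inl i) => inl i | inr (inr x) => inr (inr x) end.
have [p' Hp'] := form_ex_fin (rename_form s p).
exists p' => M v u; rewrite Hp'.
suff E c : sat (join c (join (fun x => toM (v x)) u)) (rename_form s p) <->
    P M v (join c u) by split=> -[c /E]; exists c.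
rewrite sat_rename -Hp (_ : _ \o _ = join (fun x => toM (v x)) (join c u)) //.
by apply/funext => -[x|[]].
Qed.

Lemma vd_exM (P : vpred Xv (option Xm)) :
  vdef P -> vdef (fun M v u => exists c : M, P M v (oapp u c)).
Proof.
move=> [p Hp].
pose s (x : Xv + option Xm) : option (Xv + Xm) := match x with
  | inl x => Some (inl x) | inr (Some x) => Some (inr x) | inr None => None end.
exists (Ex (rename_form s p)) => M v u /=.
suff E c : sat (oapp (join (fun x => toM (v x)) u) c) (rename_form s p) <->
    P M v (oapp u c) by split=> -[c /E]; exists c.
rewrite sat_rename -Hp (_ : _ \o _ = join (fun x => toM (v x)) (oapp u c)) //.
by apply/funext => -[x|[]].
Qed.

Lemma vd_inV (x : Xm) : vdef (fun M (v : Xv -> VS M) (u : Xm -> M) => inV F (u x)).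
Proof.
exists (rename_form (fun _ : 'I_1 => inr x) (fV F)) => M v u.
by rewrite sat_rename (_ : _ \o _ = args1 (u x)).
Qed.

Lemma vd_eqM (x y : Xv + Xm) :
  vdef (fun M (v : Xv -> VS M) (u : Xm -> M) =>
    join (fun x => toM (v x)) u x = join (fun x => toM (v x)) u y).
Proof. by exists (Eq (Var x) (Var y)). Qed.

End Closure.

Lemma choice_inV (M : model T F) (I : Type) (c : I -> M) :
  (forall i, inV F (c i)) -> exists c' : I -> VS M, c = fun i => toM (c' i).
Proof.
move=> H; have [c' Hc'] := choice (fun i => inV_toM (H i)).
by exists c'; apply/funext => i; rewrite Hc'.
Qed.

Lemma vd_exfinV (I : finType) (Xv Xm : Type) (P : vpred (I + Xv) Xm) :
  vdef P -> vdef (fun M (v : Xv -> VS M) (u : Xm -> M) =>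
                    exists c : I -> VS M, P M (join c v) u).
Proof.
move=> [p Hp].
pose s (x : (I + Xv) + Xm) : Xv + (I + Xm) := match x with
  | inl (inl i) => inr (inl i) | inl (inr x) => inl x | inr x => inr (inr x) end.
pose P' : vpred Xv (I + Xm) := fun M v u =>
  (forall i, inV F (u (inl i))) /\ sat (join (fun x => toM (v x)) u) (rename_form s p).
have dP' : vdef P'.
  apply: vd_and; last by exists (rename_form s p).
  by apply: vd_all_fin => i; exact: vd_inV.
apply: vd_ext (vd_exfinM dP') => M v u; rewrite /P'.
have E (c : I -> VS M) : sat (join (fun x => toM (v x)) (join (fun i => toM (c i)) u))
    (rename_form s p) <-> P M (join c v) u.
  rewrite sat_rename -Hp.
  rewrite (_ : _ \o _ = join (fun x => toM (join c v x)) u) //.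
  by apply/funext => -[[]|].
split=> [[d /= [/choice_inV[c ->] /E]]|[c /E H]]; first by exists c.
by exists (fun i => toM (c i)); split=> // i; apply: toM_inV.
Qed.

Lemma comp_cat_tuple (A B : Type) (h : A -> B) m n (a : 'I_m -> A) (b : 'I_n -> A) :
  h \o Defs.cat_tuple a b = Defs.cat_tuple (h \o a) (h \o b).
Proof.
by apply/funext => i; rewrite /Defs.cat_tuple /=; case: (fintype.split i).
Qed.

Lemma comp_args2 (A B : Type) (h : A -> B) (a b : A) :
  h \o args2 a b = args2 (h a) (h b).
Proof. exact: (@comp_cat_tuple _ _ h 1 1). Qed.

Lemma comp_args3 (A B : Type) (h : A -> B) (a b c : A) :
  h \o args3 a b c = args3 (h a) (h b) (h c).
Proof.
have := @comp_cat_tuple _ _ h 1 2 (args1 a) (args2 b c).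
by rewrite comp_args2.
Qed.

Section Linear.
Variables (Xm : Type).

Lemma vd_zero (Y : Type) (y : Y) :
  vdef (fun M (v : Y -> VS M) (u : Xm -> M) => v y = 0).
Proof.
exists (rename_form (fun _ : 'I_1 => inl y) (f0 F)) => M v u.
rewrite sat_rename (_ : _ \o _ = args1 (toM (v y))) // (vval0 (md_vs M)).
by split=> [/toM_inj|->].
Qed.

Lemma vd_add (Y : Type) (a b c : Y) :
  vdef (fun M (v : Y -> VS M) (u : Xm -> M) => v a + v b = v c).
Proof.
exists (rename_form (args3 (inl a) (inl b) (inl c)) (fadd F)) => M v u.
rewrite sat_rename (_ : _ \o _ = args3 (toM (v a)) (toM (v b)) (toM (v c))).
  by rewrite (vvalD (v a) (v b)); split=> [/toM_inj|<-].
exact: comp_args3.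
Qed.

Lemma vd_scale (Y : Type) (q : K) (a b : Y) :
  vdef (fun M (v : Y -> VS M) (u : Xm -> M) => q *: v a = v b).
Proof.
exists (rename_form (args2 (inl a) (inl b)) (fscale F q)) => M v u.
rewrite sat_rename (_ : _ \o _ = args2 (toM (v a)) (toM (v b))).
  by rewrite (vvalZ q (v a)); split=> [/toM_inj|<-].
exact: comp_args2.
Qed.

Lemma vd_lin (Y : Type) (e : seq (K * Y)) (y : Y) :
  vdef (fun M (v : Y -> VS M) (u : Xm -> M) => leval v e = v y).
Proof.
(* The statement is generalized over renamings because each summand adds two quantified vectors: the
   scaled summand ([false]) and the sum of the remaining terms ([true]). *)
suff H : forall (Z : Type) (s : Y -> Z) (z : Z),
    vdef (fun M (v : Z -> VS M) (u : Xm -> M) => leval (v \o s) e = v z).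
  exact: (H Y id y).
elim: e {y} => [|[q a] e IH] Z s z.
  apply: vd_ext (vd_zero z) => M v u.
  by rewrite /leval big_nil; split=> ->.
have := @vd_exfinV bool Z Xm _ (vd_and (IH _ (inr \o s) (inl true))
  (vd_and (vd_scale q (inr (s a)) (inl false)) (vd_add (inl false) (inl true) (inr z)))).
apply: vd_ext => M v u /=; rewrite /leval big_cons /=; split=> [[c [<- [<- <-]]]|E] //.
exists (fun b => if b then \sum_(ca <- e) ca.1 *: (v \o s) ca.2 else q *: v (s a)).
by do !split.
Qed.

End Linear.

Lemma vd_bound (I Z Xm : Type) (P : vpred (I * nat + Z) Xm) :
  vdef P -> exists N, forall (M : model T F) v v' u,
    (forall l i, (i < N)%N -> v (inl (l, i)) = v' (inl (l, i))) ->
    (forall z, v (inr z) = v' (inr z)) -> P M v u <-> P M v' u.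
Proof.
move=> [p Hp].
pose h (x : I * nat + Z + Xm) := if x is inl (inl li) then li.2 else 0%N.
have [N HN] := occurs_bound h p.
exists N => M v v' u E E'; rewrite -!Hp; apply: sat_occurs => -[[[l i]|z]|x] //=.
  by move=> /HN Hi; rewrite E.
by rewrite E'.
Qed.

(** The vector operations are given by formulas and not by terms, so a linear combination cannot be
    substituted directly. It is named by a quantified vector instead; the bound on the exponents
    makes finitely many such names enough. *)
Lemma vd_subst (I : finType) (Z Xv Xm : Type) (P : vpred (I * nat + Z) Xm)
    (e : I * nat -> seq (K * Xv)) (f : Z -> Xv) :
  vdef P ->
  vdef (fun M v u => P M (join (fun li => leval v (e li)) (v \o f)) u).
Proof.
move=> dP; have [N HN] := vd_bound dP.
(* The successor in ['I_N.+1] is there for [inord], also when N = 0. *)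
pose s (x : I * nat + Z) : (I * 'I_N.+1) + Xv := match x with
  | inl li => inl (li.1, inord li.2) | inr z => inr (f z) end.
pose J : finType := (I * 'I_N.+1)%type.
have d1 : vdef (fun M (v : (J + Xv) -> VS M) (u : Xm -> M) =>
    forall j : J, leval (v \o inr) (e (j.1, val j.2)) = v (inl j)).
  apply: vd_all_fin => j.
  apply: vd_ext (vd_lin _ [seq (ca.1, inr ca.2) | ca <- e (j.1, val j.2)] (inl j)).
  by move=> M v u; rewrite {1}/leval big_map.
have := @vd_exfinV J Xv Xm _ (vd_and d1 (vd_sub s id dP)).
apply: vd_ext => M v u /=.
split=> [[c [E H]]|H].
  apply: (HN _ _ _ _ _ _).1 H => //= l i Hi.
  by rewrite -E /= inordK // ltnW.
exists (fun j => leval v (e (j.1, val j.2))); split=> //.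
apply: (HN _ _ _ _ _ _).2 H => //= l i Hi.
by rewrite inordK // ltnW.
Qed.

End Definability.

(** * Polynomials acting through an endomorphism *)

Section PolynomialAction.
Variables (K : fieldType) (V : lmodType K) (theta : {linear V -> V}).
Implicit Types (p q : {poly K}) (v : V).

Lemma iter_linear n : linear (iter n theta).
Proof. by elim: n => [//|n IH] a u v /=; rewrite IH linearP. Qed.

Lemma pev_widen n p v :
  (size p <= n)%N -> pev p theta v = \sum_(i < n) p`_i *: iter i theta v.
Proof.
move=> le_p_n; rewrite /pev.
rewrite -(big_mkord xpredT (fun i => p`_i *: iter i theta v)).
rewrite -(big_mkord xpredT (fun i => p`_i *: iter i theta v)).
rewrite [RHS](big_cat_nat (n := size p)) //=.
rewrite [X in _ + X]big_nat_cond [X in _ + X]big1 ?addr0 //.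
by move=> i /andP[/andP[le_i _] _]; rewrite nth_default // scale0r.
Qed.

Lemma pev_is_linear p : linear (pev p theta).
Proof.
move=> a u v; rewrite /pev scaler_sumr -big_split /=; apply: eq_bigr => i _.
by rewrite iter_linear scalerDr !scalerA mulrC.
Qed.

HB.instance Definition _ p :=
  GRing.isLinear.Build K V V *:%R (pev p theta) (pev_is_linear p).

Lemma pevD p q v : pev (p + q) theta v = pev p theta v + pev q theta v.
Proof.
rewrite !(@pev_widen (maxn (size p) (size q))) ?size_polyD ?leq_maxl ?leq_maxr //.
by rewrite -big_split; apply: eq_bigr => i _; rewrite coefD scalerDl.
Qed.

Lemma pevC c v : pev c%:P theta v = c *: v.
Proof.
by rewrite (@pev_widen 1) ?size_polyC_leq1 // big_ord1 coefC eqxx.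
Qed.

Lemma pevZ c p v : pev (c *: p) theta v = c *: pev p theta v.
Proof.
rewrite (pev_widen _ (size_scale_leq c p)) /pev scaler_sumr.
by apply: eq_bigr => i _; rewrite coefZ scalerA.
Qed.

Lemma pev0 v : pev 0 theta v = 0.
Proof. by rewrite -polyC0 pevC scale0r. Qed.

Lemma pev1 v : pev 1 theta v = v.
Proof. by rewrite -polyC1 pevC scale1r. Qed.

Lemma pevMX p v : pev (p * 'X) theta v = pev p theta (theta v).
Proof.
rewrite (@pev_widen (size p).+1); last first.
  by rewrite (leq_trans (size_polyMleq _ _)) // size_polyX addn2.
rewrite big_ord_recl coefMX eqxx scale0r add0r /pev.
by apply: eq_bigr => i _; rewrite coefMX /= -iterSr.
Qed.

Lemma pev_theta p v : pev p theta (theta v) = theta (pev p theta v).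
Proof.
rewrite /pev linear_sum; apply: eq_bigr => i _.
by rewrite linearZ /= -iterSr.
Qed.

Lemma pevM p q v : pev (p * q) theta v = pev p theta (pev q theta v).
Proof.
elim/poly_ind: p v => [|p c IH] v; first by rewrite mul0r !pev0.
rewrite mulrDl mulrAC !pevD !pevMX IH pev_theta.
by rewrite mul_polyC pevZ pevC.
Qed.

Lemma pevMC p q v : pev (p * q) theta v = pev q theta (pev p theta v).
Proof. by rewrite mulrC pevM. Qed.

Lemma pevN p v : pev (- p) theta v = - pev p theta v.
Proof. by rewrite -mulN1r pevM -polyC1 -polyCN pevC scaleN1r. Qed.

Lemma pevB p q v : pev (p - q) theta v = pev p theta v - pev q theta v.
Proof. by rewrite pevD pevN. Qed.

Lemma pev_sum (I : Type) (s : seq I) (p : I -> {poly K}) v :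
  pev (\sum_(i <- s) p i) theta v = \sum_(i <- s) pev (p i) theta v.
Proof.
by apply: (big_morph (fun p => pev p theta v)) => [q r|]; rewrite ?pevD ?pev0.
Qed.

Lemma pevXn n v : pev 'X^n theta v = iter n theta v.
Proof.
elim: n v => [|n IH] v; first by rewrite expr0 pev1.
by rewrite exprSr pevMX IH -iterSr.
Qed.

End PolynomialAction.

(** * Monic irreducible polynomials *)

Section Irreducible.
Variable K : fieldType.
Implicit Types (f g h : {poly K}).

Lemma Kirr_ndvd_coprime f g : Kirr f -> ~~ (f %| g) -> coprimep f g.
Proof.
move=> [_ fi] ndvd; apply/coprimepP => d df dg.
have [//|dEf] := irredp_XsubCP fi df.
by move: ndvd; rewrite -(eqp_dvdl _ dEf) dg.
Qed.

Lemma Kirr_neq_coprime f g : Kirr f -> Kirr g -> f != g -> coprimep f g.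
Proof.
move=> Kf Kg; apply: contraNT => nco.
have fg : f %| g by apply: contraNT nco; exact: Kirr_ndvd_coprime.
case: Kf Kg => [fm fi] [gm gi].
by rewrite -eqp_monic // gi // neq_ltn fi orbT.
Qed.

Lemma Kirr_neq0 f : Kirr f -> f != 0.
Proof. by case=> /monic_neq0. Qed.

Lemma Kirr_exp_neq0 f n : Kirr f -> f ^+ n != 0.
Proof. by move=> Kf; rewrite expf_neq0 // Kirr_neq0. Qed.

Lemma Kirr_exp_monic f n : Kirr f -> f ^+ n \is monic.
Proof. by case=> fm _; exact: monic_exp. Qed.

Lemma exists_Kirr_dvd g : (1 < size g)%N -> exists2 f, Kirr f & f %| g.
Proof.
have [n] := ubnP (size g); elim: n g => // n IH g; rewrite ltnS => gn g1.
have g0 : g != 0 by rewrite -size_poly_gt0 ltnW.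
have [gi|] := pselect (irreducible_poly g).
  have l0 : (lead_coef g)^-1 != 0 by rewrite invr_neq0 // lead_coef_eq0.
  exists ((lead_coef g)^-1 *: g); last by rewrite dvdpZl.
  split; first by rewrite monicE lead_coefZ mulVf // lead_coef_eq0.
  split; first by rewrite size_scale.
  by move=> q q1; rewrite dvdpZr // => /(gi.2 q q1)/eqp_trans; apply; rewrite eqp_sym eqp_scale.
move=> nirr; have [q [q1 qg qNg]] : exists q : {poly K}, [/\ size q != 1%N, q %| g & ~~ (q %= g)].
  apply: contrapT => H; apply: nirr; split=> // q q1 qg.
  by apply: contrapT => /negP nq; apply: H; exists q.
have q0 : q != 0 by apply: contraNneq g0 => q0; rewrite -dvd0p -q0.
have sq : (size q < size g)%N.
  by rewrite ltn_neqAle dvdp_leq // andbT dvdp_size_eqp.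
have [||f Kf fq] := IH q; [exact: leq_trans sq gn| |].
  by rewrite ltn_neqAle eq_sym q1 size_poly_gt0.
by exists f => //; apply: dvdp_trans fq qg.
Qed.

Lemma Kirr_factor f g : Kirr f -> g != 0 -> f %| g ->
  exists q h, [/\ (0 < q)%N, g = f ^+ q * h, coprimep f h & (size h < size g)%N].
Proof.
move=> Kf; have [n] := ubnP (size g); elim: n g => // n IH g; rewrite ltnS => gn g0 fg.
have Eg := esym (divpK fg); set h := g %/ f in Eg.
have h0 : h != 0 by apply: contraNneq g0 => E; rewrite Eg E mul0r.
have hg : (size h < size g)%N.
  rewrite Eg size_mul // ?Kirr_neq0 //.
  case: Kf => _ [f1 _]; case: (size f) f1 => [|[|m]] // _.
  by rewrite addnS /= -[X in (X < _)%N]addn0 ltn_add2l.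
have [fh|nfh] := boolP (f %| h); last first.
  exists 1%N, h; split=> //; first by rewrite expr1 mulrC.
  exact: Kirr_ndvd_coprime.
have [|q [h' [q0 Eh co sh]]] := IH h _ h0 fh; first exact: leq_trans hg gn.
exists q.+1, h'; split=> //; last exact: ltn_trans sh hg.
by rewrite exprS -mulrA -Eh mulrC.
Qed.

End Irreducible.

(** * Primary decomposition of a polynomial equation *)

Section KernelConfiguration.
Variables (K : fieldType) (C : kernel_config K).
Implicit Types (f g h : {poly K}).

(** If the support is infinite, the product takes its default value 1. *)
Lemma MiPo_neq0 : MiPo C != 0.
Proof.
rewrite /MiPo /prodC; case: finite_supportP => [|X XP _ _]; first by rewrite big_nil oner_neq0.
rewrite big_seq; elim/big_rec: _ => [|f p /XP Kf p0]; first exact: oner_neq0.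
by rewrite mulf_neq0 // Kirr_exp_neq0.
Qed.

(** Algebraicity makes the support finite, so the product is the genuine one. If C(f) = 0, then f is
    outside the support and contributes the factor 1. *)
Lemma MiPo_split f : algebraic_kc C -> Kirr f ->
  exists2 h, MiPo C = f ^+ cfin C f * h & coprimep f h.
Proof.
rewrite /algebraic_kc; case Ed: (kd C) => [d|//] _ Kf.
have [_ finC _] := kd_alg Ed.
pose G g := g ^+ cfin C g.
have finG : finite_set (@Kirr K `&` G @^-1` [set~ 1]).
  apply: sub_finite_set finC => g /= [Kg Gg]; split=> // Cg.
  by apply: Gg; rewrite /G /cfin Cg expr0.
have inG g : (g \in finite_support 1 (@Kirr K) G) <-> Kirr g /\ G g <> 1.
  by rewrite in_finite_support // inE.
rewrite /MiPo /prodC -/G; set r := finite_support _ _ _ in inG *.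
have -> : \prod_(g <- r) G g = G f * \prod_(g <- r | g != f) G g.
  have [fr|nfr] := boolP (f \in r); first by rewrite (bigD1_seq f) // finite_support_uniq.
  have -> : G f = 1 by apply: contrapT => Gf; move: nfr; rewrite (inG f).2.
  rewrite mul1r big_seq [RHS]big_seq_cond; apply: eq_bigl => g.
  by case: eqVneq => [->|]; rewrite ?andbT // andbF (negPf nfr).
exists (\prod_(g <- r | g != f) G g) => //.
rewrite big_seq_cond; elim/big_rec: _ => [|g p /andP[/inG[Kg _] gf] co].
  exact: coprimep1.
by rewrite coprimepMr co andbT /G coprimep_expr // Kirr_neq_coprime // eq_sym.
Qed.

Lemma irr_factors_exp f q : Kirr f -> (0 < q)%N -> irr_factors (f ^+ q) = [set f].
Proof.
move=> Kf q0; apply/seteqP; split=> [g [Kg gf]|_ ->]; last first.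
  by split=> //; rewrite -(prednK q0) exprS dvdp_mulIl.
apply/eqP; apply: contraTT gf => gf.
have [_ [g1 _]] := Kg.
have co : coprimep g (f ^+ q) by rewrite coprimep_expr // Kirr_neq_coprime.
apply: contraTN g1 => gd; rewrite -leqNgt.
by move/coprimepP: co => /(_ g (dvdpp g) gd); rewrite -size_poly_eq1 => /eqP ->.
Qed.

Lemma prodC_irr_exp f q : Kirr f -> (0 < q)%N ->
  prodC C (irr_factors (f ^+ q)) = f ^+ cfin C f.
Proof. by move=> Kf q0; rewrite irr_factors_exp // /prodC fsbig_set1. Qed.

(** * Splitting V into image and kernel of f^C[theta] *)

Section Stability.
Variables (V : lmodType K) (theta : {linear V -> V}).
Hypotheses (ker_theta : kernel_condition C theta) (im_theta : image_complete C theta).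
Variable f : {poly K}.
Hypotheses (Kf : Kirr f) (Cf : isSome (C f)).

(** In the transcendental case this is an axiom. In the algebraic case MiPo = f^C h with f and h
    coprime, and f^C[theta](v) is killed by both, hence zero by Bezout. *)
Lemma ker_step v : pev (f ^+ (cfin C f).+1) theta v = 0 ->
  pev (f ^+ cfin C f) theta v = 0.
Proof.
move: ker_theta; rewrite /kernel_condition.
case Ed: (kd C) => [d|] kerC Hv; last first.
  by have : Ker (f ^+ (cfin C f).+1) theta v by []; rewrite -kerC.
have [|h Eh /Bezout_eq1_coprimepP[[a b] /= ab]] := MiPo_split _ Kf.
  by rewrite /algebraic_kc Ed.
have fv : pev f theta (pev (f ^+ cfin C f) theta v) = 0 by rewrite -pevM -exprS.
have hv : pev h theta (pev (f ^+ cfin C f) theta v) = 0.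
  by rewrite -pevM mulrC -Eh kerC.
by rewrite -[LHS](pev1 theta) -ab pevD !pevM fv hv !linear0 addr0.
Qed.

Lemma ker_stable j v : pev (f ^+ (cfin C f + j)) theta v = 0 ->
  pev (f ^+ cfin C f) theta v = 0.
Proof.
elim: j v => [|j IH] v; first by rewrite addn0.
rewrite addnS -addSn exprD pevM => /ker_step Hv.
by apply: IH; rewrite exprD pevM.
Qed.

Lemma im_stable j x :
  exists t, pev (f ^+ cfin C f) theta x = pev (f ^+ (cfin C f + j)) theta t.
Proof.
elim: j => [|j [t ->]]; first by exists x; rewrite addn0.
have : Im (f ^+ cfin C f) theta (pev (f ^+ cfin C f) theta t) by exists t.
rewrite -im_theta // => -[s _ Hs]; exists s.
by rewrite exprD pevMC addnS -addSn -Hs exprD pevMC.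
Qed.

(** Both values chosen by [xget] exist: the projection by the splitting of V, the preimage because
    f^q[theta] maps Im(f^C[theta]) onto itself. The defining properties of the chosen values then
    give the claim. *)
Lemma pinv_spec q x : (0 < q)%N ->
  pev (f ^+ cfin C f) theta (x - pev (f ^+ q) theta (Defs.pinv C theta (f ^+ q) x)) = 0.
Proof.
move=> q0; rewrite /Defs.pinv; set P := projIm _ _ _ _.
have [imP kerP] : Im (f ^+ cfin C f) theta P /\ Ker (f ^+ cfin C f) theta (x - P).
  rewrite /P /projIm prodC_irr_exp //.
  apply: (@xgetPex _ 0 [set u | Im (f ^+ cfin C f) theta u /\
                                Ker (f ^+ cfin C f) theta (x - u)]).
  (* Since f^C(x) = f^(2C)(t), the component of x in the image is f^C(t), and f^C kills the
     difference. *)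
  have [t Et] := im_stable (cfin C f) x.
  exists (pev (f ^+ cfin C f) theta t); split; first by exists t.
  by rewrite /Ker /= linearB /= Et exprD pevM subrr.
rewrite prodC_irr_exp //.
set A := [set u | _]; have [_ ->] : A (xget 0 A); last exact: kerP.
apply: xgetPex; case: imP => s _ Es.
have [t Et] := im_stable q s.
by exists (pev (f ^+ cfin C f) theta t); split; [exists t|rewrite -Es Et exprD pevMC].
Qed.

End Stability.

(** With y = g[theta](x), the equation for x splits into the prime power equations f_j^q_j(x'_j) =
    c_j(y), and x is recovered as b(y) plus the u_j(x'_j). The operators b and c_j are the same in
    all models. The degree bound protects the induction measure. The last clause is compatibility,
    and it is asserted only for y in the image of g[theta]. *)
Definition resolvable g : Prop :=
  exists (J : finType) (f : J -> {poly K}) (q : J -> nat) (u : J -> {poly K})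
    (b : RC C) (c : J -> RC C),
  [/\ forall j, [/\ Kirr (f j), C (f j) <> Some 0%N, (1 <= q j)%N
                  & le_inf (q j) (C (f j))],
      (\sum_j (size (f j ^+ q j)).-1 <= (size g).-1)%N
    & forall (V : lmodType K) (theta : {linear V -> V}),
      kernel_condition C theta -> image_complete C theta ->
      forall x, exists x' : J -> V,
        x = rc_eval theta b (pev g theta x) + \sum_j pev (u j) theta (x' j) /\
        forall j, pev (f j ^+ q j) theta (x' j) = rc_eval theta (c j) (pev g theta x) /\
          (isSome (C (f j)) ->
           Ker (f j ^+ (cfin C (f j) - q j)) theta (rc_eval theta (c j) (pev g theta x)))].

Lemma rc_inv_cond f q : Kirr f -> (0 < q)%N -> isSome (C f) ->
  forall g, irr_factors (f ^+ q) g -> isSome (C g).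
Proof. by move=> Kf q0 Cf g; rewrite irr_factors_exp // => ->. Qed.

Lemma resolvable_const g : size g = 1%N -> resolvable g.
Proof.
move=> g1; exists void, (fun _ => 0), (fun _ => 0%N), (fun _ => 0).
exists (rc_poly C (g`_0)^-1%:P), (fun _ => rc_poly C 0); split=> [[]||V theta _ _ x].
  by rewrite big_pred0_eq || (rewrite big1 // => -[]).
exists (fun=> 0); split=> [|[]]; rewrite big1 ?addr0 => [|[]] //=.
have /size_poly1P[c c0 ->] : size g == 1%N by apply/eqP.
by rewrite !pevC coefC eqxx scalerA mulVf // scale1r.
Qed.

(** If C(f) is infinite, the equation is already of the right kind. Otherwise x is split as
    inv(f^q(x)) + x', where [key] puts x' into Ker(f^C): f^(C+q) kills x' and the kernels are
    stable. For C(f) = 0 this forces x' = 0 and no unknown remains. *)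
Lemma resolvable_exp f q : Kirr f -> (0 < q)%N -> resolvable (f ^+ q).
Proof.
move=> Kf q0; have [Cf|] := boolP (isSome (C f)); last first.
  case Cf: (C f) => [//|] _.
  exists unit, (fun _ => f), (fun _ => q), (fun _ => 1), (rc_poly C 0), (fun _ => rc_poly C 1).
  split=> [_||V theta _ _ x]; first by rewrite Cf.
    by rewrite (big_pred1 tt) // => -[].
  exists (fun _ => x); rewrite (big_pred1 tt) => [|[]] //=; rewrite pev0 add0r !pev1.
  by split=> // _; rewrite Cf.
pose inv := rc_inv (Kirr_exp_monic q Kf) (rc_inv_cond Kf q0 Cf).
have key (V : lmodType K) (theta : {linear V -> V}) :
    kernel_condition C theta -> image_complete C theta -> forall x,
    pev (f ^+ cfin C f) theta (x - rc_eval theta inv (pev (f ^+ q) theta x)) = 0.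
  move=> kerC imC x; apply: (ker_stable kerC Kf Cf (j := q)).
  by rewrite exprD pevM linearB /= pinv_spec.
have [Cf0|Cf0] := eqVneq (cfin C f) 0%N.
  exists void, (fun _ => 0), (fun _ => 0%N), (fun _ => 0), inv, (fun _ => inv).
  split=> [[]||V theta kerC imC x]; first by rewrite big1 // => -[].
  exists (fun=> 0); split=> [|[]]; rewrite big1 ?addr0 => [|[]] //.
  have /eqP := key V theta kerC imC x.
  by rewrite Cf0 expr0 pev1 subr_eq0 => /eqP.
have Cfs : C f = Some (cfin C f) by move: (Cf); rewrite /cfin; case: (C f).
(* [resid] maps y to y - f^q(inv(y)), which is f^q(x') when y = f^q(x). *)
pose resid := rc_add (rc_poly C 1)
  (rc_comp (rc_poly C (- 1)) (rc_comp (rc_poly C (f ^+ q)) inv)).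
(* As f^C(x') = 0, an exponent q above C(f) can be lowered to C(f), with right-hand side 0. *)
exists unit, (fun _ => f), (fun _ => minn q (cfin C f)), (fun _ => 1), inv.
exists (fun _ => if (q <= cfin C f)%N then resid else rc_poly C 0).
split=> [_||V theta kerC imC x].
- split=> //; first by rewrite Cfs => -[]; apply/eqP.
    by rewrite leq_min q0 lt0n.
  by rewrite Cfs /= geq_minr.
- rewrite (big_pred1 tt) => [|[]] //; rewrite !size_exp leq_mul2l geq_minl orbT //.
set x' := x - rc_eval theta inv (pev (f ^+ q) theta x).
have Hx' : pev (f ^+ cfin C f) theta x' = 0 by exact: key.
exists (fun _ => x'); rewrite (big_pred1 tt) => [|[]] //; rewrite pev1.
split=> [|_]; first by rewrite addrC subrK.
case: leqP => [le_q|lt_q]; last first.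
  by rewrite [rc_eval _ _ _]pev0; split=> // _; apply: linear0.
have -> : rc_eval theta resid (pev (f ^+ q) theta x) = pev (f ^+ q) theta x'.
  by rewrite /= pevN !pev1 linearB.
by split=> // _; rewrite /Ker /= -pevM -exprD subnK.
Qed.

(** From a g + b h = 1 one gets x = b(h(x)) + a(g(x)). Here h(x) solves the equation for g, and g(x)
    the one for h, both with right-hand side (g h)(x). *)
Lemma resolvable_mul g h : g != 0 -> h != 0 -> coprimep g h ->
  resolvable g -> resolvable h -> resolvable (g * h).
Proof.
move=> g0 h0 /Bezout_eq1_coprimepP[[a b] /= ab].
move=> [I [f [q [u [d [c [Hf Hs Hr]]]]]]] [J [f' [q' [u' [d' [c' [Hf' Hs' Hr']]]]]]].
exists (I + J)%type, (join f f'), (join q q').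
exists (join (fun i => b * u i) (fun j => a * u' j)).
exists (rc_add (rc_comp (rc_poly C b) d) (rc_comp (rc_poly C a) d')).
exists (join c c'); split=> [[]|| V theta kerC imC x] //.
  rewrite big_sumType /= (leq_trans (leq_add Hs Hs')) //.
  rewrite size_mul //; move: g0 h0; rewrite -!size_poly_gt0.
  by case: (size g) (size h) => [|m] [|n] // _ _; rewrite addSn addnS.
have [x1 [E1 H1]] := Hr V theta kerC imC (pev h theta x).
have [x2 [E2 H2]] := Hr' V theta kerC imC (pev g theta x).
rewrite -!pevM in E1 H1 E2 H2; rewrite (mulrC h g) in E2 H2.
exists (join x1 x2); split=> [|[]] //.
rewrite big_sumType /= addrACA.
under eq_bigr do rewrite pevM.
under [X in _ + (_ + X)]eq_bigr do rewrite pevM.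
rewrite -!linear_sum /= -!linearD /= -E1 -E2.
by rewrite -!pevM -pevD addrC ab pev1.
Qed.

Lemma resolvable_neq0 g : g != 0 -> resolvable g.
Proof.
have [n] := ubnP (size g); elim: n g => // n IH g; rewrite ltnS => gn g0.
have [g1|g1] := leqP (size g) 1.
  by apply: resolvable_const; apply/eqP; rewrite eqn_leq g1 size_poly_gt0.
have [f Kf fg] := exists_Kirr_dvd g1.
have [q [h [q0 Eg co sh]]] := Kirr_factor Kf g0 fg.
have h0 : h != 0 by apply: contraNneq g0 => E; rewrite Eg E mulr0.
rewrite Eg; apply: resolvable_mul => //; first exact: Kirr_exp_neq0.
- by rewrite coprimep_expl.
- exact: resolvable_exp.
- by apply: IH => //; apply: leq_trans sh gn.
Qed.

End KernelConfiguration.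

(** * Two lemmas on relations over K[X] *)

Section Relations.
Variable K : fieldType.

(** The Euclidean algorithm by elementary column operations: as long as two entries are nonzero,
    reducing the larger one modulo the other lowers the sum of the sizes. *)
Lemma unimodular_reduction n (lam : 'rV[{poly K}]_n) : lam != 0 ->
  exists (U V : 'M[{poly K}]_n) (i : 'I_n),
    [/\ U *m V = 1%:M, forall j, j != i -> (lam *m U) 0 j = 0
      & (lam *m U) 0 i != 0].
Proof.
have [N] := ubnP (\sum_j size (lam 0%R j)).
elim: N lam => // N IH lam; rewrite ltnS => szN lam0.
have [i li] : exists i, lam 0 i != 0.
  apply: contrapT => H; move/eqP: lam0; apply; apply/rowP => j; rewrite mxE.
  by apply: contrapT => /eqP lj; apply: H; exists j.
have [others|] := pselect (forall j, j != i -> lam 0 j = 0).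
  by exists 1%:M, 1%:M, i; split; rewrite ?mulmx1.
move=> /existsNP[j /not_implyP[ji /eqP lj]].
have [a [b [ab la lb sz]]] : exists a b,
    [/\ a != b, lam 0 a != 0, lam 0 b != 0 & (size (lam 0%R b) <= size (lam 0%R a))%N].
  by have [?|/ltnW ?] := leqP (size (lam 0 j)) (size (lam 0 i));
    [exists i, j; rewrite eq_sym|exists j, i].
pose q := lam 0 a %/ lam 0 b.
pose E := 1%:M - q *: delta_mx b a : 'M[{poly K}]_n.
pose E' := 1%:M + q *: delta_mx b a : 'M[{poly K}]_n.
have EE' : E *m E' = 1%:M.
  rewrite /E /E' mulmxDr mulmx1 mulmxBl mul1mx -scalemxAl -scalemxAr.
  by rewrite mul_delta_mx_0 // !scaler0 subr0 subrK.
have lamE k : (lam *m E) 0 k = lam 0 k - (k == a)%:R * (q * lam 0 b).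
  rewrite /E mulmxBr mulmx1 mxE; congr (_ + _); rewrite mxE; congr (- _).
  rewrite -scalemxAr mxE mxE (bigD1 b) //= big1 ?addr0.
    by rewrite mxE eqxx /= (mulrC (lam 0 b)) mulrCA.
  by move=> c cb; rewrite mxE (negPf cb) mulr0.
have lamEa : (lam *m E) 0 a = lam 0 a %% lam 0 b.
  by rewrite lamE eqxx mul1r {1}(divp_eq (lam 0 a) (lam 0 b)) addrC addKr.
have lamEk k : k != a -> (lam *m E) 0 k = lam 0 k.
  by move=> ka; rewrite lamE (negPf ka) mul0r subr0.
have [||U [V [k [UV H1 H2]]]] := IH (lam *m E).
- apply: leq_trans szN; rewrite (bigD1 a) //= [X in (_ < X)%N](bigD1 a) //= -addSn.
  apply: leq_add; first by rewrite lamEa (leq_trans _ sz) // ltn_modp.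
  by apply: leq_sum => k ka; rewrite lamEk.
- apply: contraNneq lb => H; have := lamEk b.
  by rewrite eq_sym ab H mxE => <-.
exists (E *m U), (V *m E'), k; split=> [|l lk|].
- by rewrite mulmxA -(mulmxA E) UV mulmx1.
- by rewrite mulmxA H1.
- by rewrite mulmxA.
Qed.

Section Torsion.
Variables (n : nat) (f : 'I_n -> {poly K}) (q : 'I_n -> nat).
Hypotheses (Kf : forall k, Kirr (f k)) (q0 : forall k, (0 < q k)%N).
Implicit Type lam : 'I_n -> {poly K}.

(** The product of the f_k, each repeated q_k times, kills the class of [lam] in the sum of the
    K[X]/(f_k^q_k). Multiplying by these primes one at a time and stopping just before the class
    vanishes gives a nonzero multiple killed by a single prime. *)
Lemma socle_multiple lam : (exists k, ~~ (f k ^+ q k %| lam k)) ->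
  exists mu k1, (exists k, ~~ (f k ^+ q k %| mu * lam k)) /\
    forall k, f k ^+ q k %| f k1 * (mu * lam k).
Proof.
pose s := flatten [seq nseq (q k) k | k <- enum 'I_n].
have : forall k, f k ^+ q k %| (\prod_(i <- s) f i) * lam k.
  move=> k; rewrite big_flatten big_map big_enum (bigD1 k) //= -!mulrA dvdp_mulr //.
  by rewrite big_nseq iter_mulr_1.
elim: s lam => [|i s IH] lam Hs [k Hk].
  by move: Hk (Hs k); rewrite big_nil mul1r => /negPf ->.
have [H|] := pselect (forall k, f k ^+ q k %| f i * lam k).
  by exists 1, i; split=> [|l]; [exists k|]; rewrite mul1r.
move=> /existsNP[l /negP Hl].
have [||mu [k1 [H1 H2]]] := IH (fun k => f i * lam k).
- by move=> m; move: (Hs m); rewrite big_cons mulrCA mulrA.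
- by exists l.
exists (mu * f i), k1; split=> [|m]; last by rewrite -(mulrA mu).
by case: H1 => m Hm; exists m; rewrite -mulrA.
Qed.

(* A nonzero relation has a multiple supported on the components
   [K[X]/(f ^+ q k)] of a single prime [f], where it lies in the socle; dividing
   it by the least [f ^+ (q k).-1] involved makes one coefficient a unit. *)
Lemma torsion_relation lam : (exists k, ~~ (f k ^+ q k %| lam k)) ->
  exists k0 mu (e d : 'I_n -> {poly K}), e k0 = 1 /\
    forall k, mu * lam k = f k0 ^+ (q k0).-1 * e k + d k * f k ^+ q k.
Proof.
move=> /socle_multiple[mu [k1 [[k2 Hk2] Hdvd]]].
pose bad k := ~~ (f k ^+ q k %| mu * lam k).
have [k0 bad0 min0] := arg_minnP (P := bad) q Hk2.
have fE k : bad k -> f k = f k1.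
  move=> bk; apply/eqP; apply: contraNT bk => fk.
  move: (Hdvd k); rewrite Gauss_dvdpr //.
  by rewrite coprimep_expl // Kirr_neq_coprime.
have socle k : bad k -> exists s, mu * lam k = f k0 ^+ (q k).-1 * s.
  move=> bk; move: (_ %/ _) (divpK (Hdvd k)) => s Es; exists s.
  apply: (mulfI (Kirr_neq0 (Kf k1))).
  by rewrite -Es (fE _ bk) (fE _ bad0) mulrA -exprS prednK // mulrC.
have [s0 Es0] := socle k0 bad0.
(* [nu] inverts [s0] modulo f_k0, so that e_k0 becomes exactly 1; the error term is a multiple of
   f_k0^q_k0 and goes into [d]. *)
have /Bezout_eq1_coprimepP[[t nu] /= Enu] : coprimep (f k0) s0.
  apply: Kirr_ndvd_coprime => //; apply: contra bad0 => fs0.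
  by rewrite Es0 -{1}(prednK (q0 k0)) exprSr dvdp_mul2l // Kirr_exp_neq0.
have pointwise k : exists ed : {poly K} * {poly K}, (k = k0 -> ed.1 = 1) /\
    nu * mu * lam k = f k0 ^+ (q k0).-1 * ed.1 + ed.2 * f k ^+ q k.
  have [->|kk0] := eqVneq k k0.
    exists (1, - t); split=> //=; rewrite -mulrA Es0.
    have Es : nu * s0 = 1 - t * f k0 by rewrite -Enu addrC addKr.
    rewrite -{3}(prednK (q0 k0)) exprSr mulr1 mulrCA Es mulrBr mulr1 mulNr.
    by rewrite mulrCA.
  have [bk|] := boolP (bad k); last first.
    rewrite negbK => /divpK E.
    exists (0, nu * (mu * lam k %/ f k ^+ q k)); split=> [E'|/=].
      by rewrite E' eqxx in kk0.
    by rewrite mulr0 add0r -!mulrA E.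
  have [s Es] := socle k bk.
  exists (nu * f k0 ^+ ((q k).-1 - (q k0).-1) * s, 0); split=> [E'|/=].
    by rewrite E' eqxx in kk0.
  have le_q : ((q k0).-1 <= (q k).-1)%N by move: (min0 k bk); case: (q k0) (q k) => [|?] [].
  by rewrite mul0r addr0 -mulrA Es -{1}(subnKC le_q) exprD !mulrA (mulrC nu).
have [ed Hed] := choice pointwise.
exists k0, (nu * mu), (fst \o ed), (snd \o ed); split=> [|k] /=.
  exact: (Hed k0).1.
exact: (Hed k).2.
Qed.

End Torsion.
End Relations.

(** * Extending algebraic patterns *)

Lemma cat_tuple_lshift (A : Type) m n (f : 'I_m -> A) (g : 'I_n -> A) :
  Defs.cat_tuple f g \o lshift n = f.
Proof.
by apply/funext => i; rewrite /Defs.cat_tuple /= (unsplitK (inl i)).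
Qed.

Lemma cat_tuple_rshift (A : Type) m n (f : 'I_m -> A) (g : 'I_n -> A) :
  Defs.cat_tuple f g \o @rshift m n = g.
Proof.
by apply/funext => i; rewrite /Defs.cat_tuple /= (unsplitK (inr i)).
Qed.

Section Patterns.
Variables (L : language) (K : fieldType) (T : theory L) (F : vs_formulas L K).
Variable C : kernel_config K.

Definition reduct_model (N : model_theta T F) : model T F :=
  Model (mt_T N) (mt_vs N).

Definition alg_formula s r (Phi : formula L ('I_1 + 'I_s + 'I_r)) : Prop :=
  forall (M : model T F) (y : 'I_s -> M) (w : 'I_r -> M),
    finite_set [set x : M | sat (join (join (args1 x) y) w) Phi].

Lemma widen_formula s s' r (h : (s <= s')%N) (Phi : formula L ('I_1 + 'I_s + 'I_r)) :
  exists Phi' : formula L ('I_1 + 'I_s' + 'I_r),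
  forall (M : structure L) x (y : 'I_s' -> M) w,
    sat (join (join (args1 x) y) w) Phi' <->
    sat (join (join (args1 x) (y \o widen_ord h)) w) Phi.
Proof.
pose t (v : 'I_1 + 'I_s + 'I_r) : 'I_1 + 'I_s' + 'I_r := match v with
  | inl (inl i) => inl (inl i) | inl (inr i) => inl (inr (widen_ord h i))
  | inr i => inr i end.
exists (rename_form t Phi) => M x y w; rewrite sat_rename.
by rewrite (_ : _ \o t = join (join (args1 x) (y \o widen_ord h)) w) //;
   apply/funext => -[[]|].
Qed.

(** The formula of coordinate i has its variables in a type depending on i. To avoid casts, [spec]
    fixes its meaning through assignments that agree below i. The new coordinates refer only to the
    old ones, not to each other. *)
Lemma pattern_ext s t r (Y : pattern L C s r) (R : 'I_t -> RC C)
    (Phi : 'I_t -> formula L ('I_1 + 'I_s + 'I_r)) :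
  algebraic_pattern T F Y -> (forall k, alg_formula (Phi k)) ->
  exists Y' : pattern L C (s + t) r, algebraic_pattern T F Y' /\
  forall (N : model_theta T F) (w : 'I_r -> N) (y : 'I_(s + t) -> mt_vs N),
    in_pattern Y' w y <-> in_pattern Y w (y \o lshift t) /\
    forall k, exists x : mt_vs N,
      y (rshift s k) = rc_eval (@mt_theta _ _ _ _ N) (R k) x /\
      sat (M := reduct N) (join (join (args1 (toN x))
            (fun j => toN (y (lshift t j)))) w) (Phi k).
Proof.
move=> algY algPhi.
pose spec i (phi : formula L ('I_1 + 'I_i + 'I_r)) (o : 'I_s + 'I_t) : Prop :=
  forall (M : structure L) (x : M) (y : 'I_(s + t) -> M) (y' : 'I_i -> M) w,
    (forall j (hj : (val j < i)%N), y j = y' (Ordinal hj)) ->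
    sat (join (join (args1 x) y') w) phi <->
    match o with
    | inl j => sat (join (join (args1 x) (below (y \o lshift t) (i := j))) w) (pt_phi Y j)
    | inr k => sat (join (join (args1 x) (y \o lshift t)) w) (Phi k)
    end.
have ex_phi (i : 'I_(s + t)) : {phi | @spec i phi (fintype.split i)}.
  apply: cid; case: (split_ordP i) => j Ei; subst i.
    have [phi Hphi] := widen_formula (leqnn j) (pt_phi Y j).
    exists phi => M x y y' w Hy; rewrite Hphi.
    rewrite (_ : _ \o _ = below (y \o lshift t) (i := j)) //.
    apply/funext => k.
    have hk : (val (lshift t (widen_ord (ltnW (ltn_ord j)) k)) < lshift t j)%N.
      exact: (ltn_ord k).
    by rewrite /below /= (Hy _ hk); congr y'; apply: val_inj.
  have [phi Hphi] := widen_formula (leq_addr j s) (Phi j).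
  exists phi => M x y y' w Hy; rewrite Hphi.
  rewrite (_ : _ \o _ = y \o lshift t) //.
  apply/funext => k.
  have hk : (val (lshift t k) < rshift s j)%N by rewrite /= ltn_addr.
  by rewrite /= (Hy _ hk); congr y'; apply: val_inj.
have [phi HY'] : exists phi : forall i : 'I_(s + t), formula L ('I_1 + 'I_i + 'I_r),
    forall i : 'I_(s + t), @spec i (phi i) (fintype.split i).
  by exists (fun i => proj1_sig (ex_phi i)) => i; exact: proj2_sig (ex_phi i).
pose Y' : pattern L C (s + t) r :=
  Pattern (fun i => join (pt_r Y) R (fintype.split i)) phi.
exists Y'; split=> [i M y' w|N w y].
  have [x0] := carrier_inh M.
  (* The tuple is given only below i; the padding by [x0] is never read. *)
  pose y (j : 'I_(s + t)) := if insub (val j) is Some k then y' k else x0.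
  have Hy j (hj : (val j < i)%N) : y j = y' (Ordinal hj).
    by rewrite /y insubT.
  case Ei : (fintype.split i) (HY' i) => [j|k] Hi.
    apply: sub_finite_set (algY j M (below (y \o lshift t) (i := j)) w) => x /=.
    by rewrite (Hi M x y y' w Hy).
  apply: sub_finite_set (algPhi k M (y \o lshift t) w) => x /=.
  by rewrite (Hi M x y y' w Hy).
have Hb (i : 'I_(s + t)) j (hj : (val j < i)%N) :
    toN (y j) = below (fun j => toN (y j)) (i := i) (Ordinal hj).
  by rewrite /below; congr (toN (y _)); apply: val_inj.
split=> [H|[H1 H2] i]; last first.
  rewrite /Y' /=; case Ei : (fintype.split i) (HY' i) => [j|k] Hi /=.
    have Eij : i = lshift t j by rewrite -(splitK i) Ei.
    have [x [Ex Hx]] := H1 j; exists x; split; first by rewrite -Ex Eij.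
    exact/(Hi (reduct N) _ _ _ w (Hb i)).
  have Eik : i = rshift s k by rewrite -(splitK i) Ei.
  have [x [Ex Hx]] := H2 k; exists x; split; first by rewrite -Ex Eik.
  exact/(Hi (reduct N) _ _ _ w (Hb i)).
split=> [j|k].
  have [x [Ex Hx]] := H (lshift t j); exists x.
  move: Ex Hx (HY' (lshift t j)); rewrite /Y' /= (unsplitK (inl j)) => Ex Hx Hi; split=> //.
  exact/(Hi (reduct N) _ _ _ w (Hb (lshift t j))).
have [x [Ex Hx]] := H (rshift s k); exists x.
move: Ex Hx (HY' (rshift s k)); rewrite /Y' /= (unsplitK (inr k)) => Ex Hx Hi; split=> //.
exact/(Hi (reduct N) _ _ _ w (Hb (rshift s k))).
Qed.

(** A functional relation has at most one solution, hence is algebraic. Algebraicity is demanded for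
    all tuples of elements, also outside V, so the formula asserts in addition that its arguments
    are vectors. *)
Lemma function_formula s r (P : vpred T F (option 'I_s) 'I_r) :
  vdef P ->
  (forall M v v' u, P M v u -> P M v' u -> v \o Some = v' \o Some -> v None = v' None) ->
  exists Phi : formula L ('I_1 + 'I_s + 'I_r), alg_formula Phi /\
  forall (M : model T F) (x : VS M) (c : 'I_s -> VS M) (w : 'I_r -> M),
    sat (join (join (args1 (toM x)) (fun j => toM (c j))) w) Phi <->
    P M (oapp c x) w.
Proof.
move=> dP Pfun.
pose idx (o : option 'I_s) : 'I_1 + 'I_s + 'I_r :=
  if o is Some j then inl (inr j) else inl (inl ord0).
pose Q : vpred T F void ('I_1 + 'I_s + 'I_r) := fun M v u =>
  exists c : option 'I_s -> VS M,
    (forall o, toM (c o) = u (idx o)) /\ P M c (u \o inr).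
have [q Hq] : vdef Q.
  pose P1 : vpred T F (option 'I_s + void) ('I_1 + 'I_s + 'I_r) := fun M v u =>
    (forall o, toM (v (inl o)) = u (idx o)) /\ P M (v \o inl) (u \o inr).
  have dP1 : vdef P1.
    apply: vd_and; last exact: vd_sub.
    by apply: vd_all_fin => o; exact: (vd_eqM T F (inl (inl o)) (inr (idx o))).
  apply: vd_ext (vd_exfinV dP1) => M v u.
  have E (c : option 'I_s -> VS M) : join c v \o inl = c by [].
  by split=> -[c [H1 H2]]; exists c.
pose t (x : void + ('I_1 + 'I_s + 'I_r)) := match x with
  | inl x => of_void _ x | inr x => x end.
have Hs (M : model T F) (u : 'I_1 + 'I_s + 'I_r -> M) :
    sat u (rename_form t q) <-> Q M (of_void _) u.
  rewrite sat_rename -Hq (_ : _ \o t = join (fun x => toM (of_void (VS M) x)) u) //.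
  by apply/funext => -[[]|].
exists (rename_form t q); split=> [M y w|M x c w]; last first.
  rewrite Hs; split=> [[c' [E]]|H].
    rewrite (_ : c' = oapp c x) //.
    by apply/funext => -[j|]; apply: toM_inj; rewrite E.
  by exists (oapp c x); split=> // -[].
set A := [set x | _].
have A1 a b : A a -> A b -> a = b.
  move=> /Hs[c [Ec Pc]] /Hs[d [Ed Pd]].
  have -> : a = toM (c None) by rewrite Ec.
  have -> : b = toM (d None) by rewrite Ed.
  congr toM; apply: (Pfun M _ _ w) => //; apply/funext => j.
  by apply: toM_inj; rewrite /= Ec Ed.
have [[a Aa]|A0] := pselect (exists a, A a).
  by apply: (sub_finite_set (B := [set a])) (finite_set1 a) => b Ab; exact: A1.
by apply: (sub_finite_set (B := set0)) => // b Ab; apply: A0; exists b.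
Qed.

Lemma pattern_fun s t r (Y : pattern L C s r) (R : 'I_t -> RC C)
    (P : 'I_t -> vpred T F (option 'I_s) 'I_r) :
  algebraic_pattern T F Y -> (forall k, vdef (P k)) ->
  (forall k M v v' u, P k M v u -> P k M v' u -> v \o Some = v' \o Some ->
     v None = v' None) ->
  exists Y' : pattern L C (s + t) r, algebraic_pattern T F Y' /\
  forall (N : model_theta T F) (w : 'I_r -> N) (y : 'I_(s + t) -> mt_vs N),
    in_pattern Y' w y <-> in_pattern Y w (y \o lshift t) /\
    forall k, exists x : mt_vs N,
      y (rshift s k) = rc_eval (@mt_theta _ _ _ _ N) (R k) x /\
      P k (reduct_model N) (oapp (y \o lshift t) x) w.
Proof.
move=> algY dP Pfun.
have [Phi HPhi] := choice (fun k => function_formula (dP k) (Pfun k)).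
have [|Y' [algY' HY']] := pattern_ext (Y := Y) R (Phi := Phi) algY.
  by move=> k; case: (HPhi k).
exists Y'; split=> // N w y; rewrite HY'.
by split=> -[H1 H2]; split=> // k; have [x [Ex Hx]] := H2 k; exists x; split=> //;
   apply/((HPhi k).2 (reduct_model N)).
Qed.

(** A coordinate applies a single element of [RC] to a single algebraic vector. So two rounds are
    made: the values rf_ji(y_i) are stored as coordinates, then their sums are formed by L-formulas.
    The last clause says that no point of the old pattern is lost. *)
Lemma pattern_linear s r (Y : pattern L C s r) (J : finType) (rf : J -> 'I_s -> RC C) :
  algebraic_pattern T F Y ->
  exists s' (Y' : pattern L C s' r) (emb : 'I_s -> 'I_s') (out : J -> 'I_s'),
  [/\ algebraic_pattern T F Y',
      forall (N : model_theta T F) (w : 'I_r -> N) (y : 'I_s' -> mt_vs N),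
        in_pattern Y' w y -> in_pattern Y w (y \o emb) /\
        forall j, y (out j) =
          \sum_i rc_eval (@mt_theta _ _ _ _ N) (rf j i) (y (emb i))
    & forall (N : model_theta T F) (w : 'I_r -> N) (y : 'I_s -> mt_vs N),
        in_pattern Y w y -> exists2 y', in_pattern Y' w y' & y' \o emb = y].
Proof.
move=> algY.
pose JI : finType := (J * 'I_s)%type.
pose P1 (k : 'I_#|JI|) : vpred T F (option 'I_s) 'I_r :=
  fun M v u => v None = v (Some (enum_val k).2).
have [||Y1 [algY1 HY1]] := pattern_fun (fun k => rf (enum_val k).1 (enum_val k).2)
  (P := P1) algY.
- move=> k; have [p Hp] := vd_eqM T F (Xm := 'I_r) (inl None)
    (inl (Some (enum_val k).2) : option 'I_s + 'I_r).
  by exists p => M v u; rewrite Hp /P1 /=; split=> [/toM_inj|->].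
- move=> k M v v' u Ev Ev' E; rewrite Ev Ev'.
  exact: (congr1 (fun h => h (enum_val k).2) E).
pose e (k : 'I_#|J|) : seq (K * 'I_(s + #|JI|)) :=
  [seq (1, rshift s (enum_rank (enum_val k, i))) | i <- enum 'I_s].
pose P2 (k : 'I_#|J|) : vpred T F (option 'I_(s + #|JI|)) 'I_r :=
  fun M v u => leval (v \o Some) (e k) = v None.
have [||Y2 [algY2 HY2]] := pattern_fun (fun k => rc_poly C 1) (P := P2) algY1.
- move=> k; apply: vd_ext (vd_lin _ _ _ [seq (ca.1, Some ca.2) | ca <- e k] None).
  by move=> M v u; rewrite /P2 {1}/leval big_map.
- by move=> k M v v' u Ev Ev' E; rewrite -Ev -Ev' E.
exists _, Y2, (lshift _ \o lshift _), (fun j => rshift _ (enum_rank j)); split=> //.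
  move=> N w y /HY2[/HY1[H0 H1] H2]; split=> // j.
  have [x [-> ]] := H2 (enum_rank j).
  rewrite /P2 /= pev1 => <-; rewrite /leval /e big_map big_enum /=.
  apply: eq_bigr => i _; rewrite scale1r enum_rankK.
  have [x' []] := H1 (enum_rank (j, i)).
  by rewrite /P1 /= enum_rankK /= => -> ->.
move=> N w y Hy.
pose th := @mt_theta _ _ _ _ N.
pose y1 := Defs.cat_tuple y
  (fun k : 'I_#|JI| => rc_eval th (rf (enum_val k).1 (enum_val k).2) (y (enum_val k).2)).
have y1r k : y1 (rshift s k) = rc_eval th (rf (enum_val k).1 (enum_val k).2) (y (enum_val k).2).
  by rewrite -[LHS]/((y1 \o @rshift s _) k) cat_tuple_rshift.
have y1l : y1 \o lshift _ = y by exact: cat_tuple_lshift.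
pose y2 := Defs.cat_tuple y1 (fun k => leval y1 (e k)).
have y2l : y2 \o lshift _ = y1 by exact: cat_tuple_lshift.
exists y2; last by rewrite compA y2l.
apply/HY2; rewrite y2l; split=> [|k].
  apply/HY1; rewrite y1l; split=> // k.
  by exists (y (enum_val k).2); rewrite y1r.
exists (leval y1 (e k)); rewrite /= pev1; split=> //.
by rewrite -[LHS]/((y2 \o @rshift _ _) k) cat_tuple_rshift.
Qed.

End Patterns.

(** * Existential systems and changes of variables *)

Section Orbits.
Variables (K : fieldType) (V : lmodType K) (theta : {linear V -> V}).

Definition orbits (I : Type) (x : I -> V) (li : I * nat) : V := iter li.2 theta (x li.1).

Definition poly_lexp (I Z : Type) (g : {poly K}) (l : I) : seq (K * (I * nat + Z)) :=
  [seq (g`_i, inl (l, i)) | i <- iota 0 (size g)].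

Lemma leval_poly (I Z : Type) (g : {poly K}) (l : I) (x : I -> V) (y : Z -> V) :
  leval (join (orbits x) y) (poly_lexp Z g l) = pev g theta (x l).
Proof.
rewrite /leval big_map /pev.
by rewrite -(big_mkord xpredT (fun i => g`_i *: iter i theta (x l))) /index_iota subn0.
Qed.

Lemma leval_cat (X : Type) (v : X -> V) e e' :
  leval v (e ++ e') = leval v e + leval v e'.
Proof. by rewrite /leval big_cat. Qed.

Lemma leval_flatten (X I : Type) (v : X -> V) (s : seq I) (e : I -> seq (K * X)) :
  leval v (flatten [seq e i | i <- s]) = \sum_(i <- s) leval v (e i).
Proof. by rewrite /leval big_flatten big_map. Qed.

Section Substitution.
Variables (I0 I1 : finType) (s1 : nat).
Variables (coef : I0 -> nat -> I1 -> {poly K}) (off : I0 -> nat -> seq 'I_s1).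

Definition subst_lexp (li : I0 * nat) : seq (K * (I1 * nat + 'I_s1)) :=
  flatten [seq poly_lexp 'I_s1 (coef li.1 li.2 l') l' | l' <- enum I1] ++
  [seq (1, inr j) | j <- off li.1 li.2].

(** Coefficients may depend on i, because they will be reduced modulo prime powers separately for
    each i. The offsets are sums of stored pattern coordinates, whence the restriction to i < n0. *)
Definition solves n0 (x : I0 -> V) (x1 : I1 -> V) (y1 : 'I_s1 -> V) : Prop :=
  forall l i, (i < n0)%N -> iter i theta (x l) =
    \sum_l' pev (coef l i l') theta (x1 l') + \sum_(j <- off l i) y1 j.

Lemma leval_subst_lexp (x1 : I1 -> V) (y1 : 'I_s1 -> V) li :
  leval (join (orbits x1) y1) (subst_lexp li) =
    \sum_l' pev (coef li.1 li.2 l') theta (x1 l') + \sum_(j <- off li.1 li.2) y1 j.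
Proof.
rewrite /subst_lexp leval_cat leval_flatten big_enum /=; congr (_ + _).
  by apply: eq_bigr => l' _; rewrite leval_poly.
by rewrite /leval big_map; apply: eq_bigr => j _; rewrite scale1r.
Qed.

Lemma leval_subst_lexp_indep (v v' : I1 * nat + 'I_s1 -> V) li :
  (forall l' i', (i' < size (coef li.1 li.2 l'))%N ->
     v (inl (l', i')) = v' (inl (l', i'))) ->
  (forall j, v (inr j) = v' (inr j)) ->
  leval v (subst_lexp li) = leval v' (subst_lexp li).
Proof.
move=> E E'; rewrite /subst_lexp !leval_cat !leval_flatten; congr (_ + _).
  apply: eq_bigr => l' _; rewrite /leval !big_map !big_seq; apply: eq_bigr => i'.
  by rewrite mem_iota => /andP[_ Hi]; rewrite E.
by rewrite /leval !big_map; apply: eq_bigr => j _; rewrite E'.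
Qed.

End Substitution.

Lemma solves_linear (I0 I1 : finType) s1 (U : I0 -> I1 -> {poly K}) n0
    (x : I0 -> V) (x1 : I1 -> V) (y1 : 'I_s1 -> V) :
  (forall l, x l = \sum_l' pev (U l l') theta (x1 l')) ->
  solves (fun l i l' => 'X^i * U l l') (fun _ _ => [::]) n0 x x1 y1.
Proof.
move=> Ex l i _; rewrite big_nil addr0 -pevXn Ex linear_sum /=.
by apply: eq_bigr => l' _; rewrite -pevM.
Qed.
End Orbits.

(** * Systems with parameters from an algebraic pattern *)

Section Systems.
Variables (L : language) (K : fieldType) (T : theory L) (F : vs_formulas L K).
Variables (C : kernel_config K) (D : formula_set L) (p r : nat).

Notation th N := (@mt_theta L K T F N).

Definition zw_pred : Type :=
  forall N : model_theta T F, ('I_p -> N) -> ('I_r -> N) -> Prop.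

Definition Good (Q : zw_pred) : Prop :=
  exists (n : nat) (E : 'I_n -> disjunct L C p r),
    (forall j, admissible T F D (E j)) /\
    (forall N : model_theta T F, TC_image_complete C N -> forall z w,
       Q N z w <-> exists j, disjunct_holds (E j) z w).

Lemma good_ext (Q Q' : zw_pred) :
  (forall N : model_theta T F, TC_image_complete C N -> forall z w, Q N z w <-> Q' N z w) ->
  Good Q -> Good Q'.
Proof.
by move=> H [n [E [HE HQ]]]; exists n, E; split=> // N tcN z w; rewrite -H // HQ.
Qed.

Lemma good_false : Good (fun N z w => False).
Proof.
exists 0%N, (fun i : 'I_0 => False_rect _ (notF (ltn_ord i))).
by split=> [[]|N _ z w] //; split=> // -[[]].
Qed.

Lemma good_disjunct (E : disjunct L C p r) : admissible T F D E ->
  Good (fun N z w => disjunct_holds E z w).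
Proof.
move=> HE; exists 1%N, (fun _ => E); split=> // N _ z w.
by split=> [H|[_ H]] //; exists ord0.
Qed.

Lemma good_or (Q Q' : zw_pred) : Good Q -> Good Q' ->
  Good (fun N z w => Q N z w \/ Q' N z w).
Proof.
move=> [n [E [HE HQ]]] [n' [E' [HE' HQ']]].
exists (n + n')%N, (Defs.cat_tuple E E'); split=> [j|N tcN z w].
  by rewrite /Defs.cat_tuple; case: (fintype.split j).
rewrite HQ // HQ' //; split.
  case=> -[j Hj]; [exists (lshift _ j)|exists (rshift _ j)];
  by rewrite /Defs.cat_tuple ?(unsplitK (inl j)) ?(unsplitK (inr j)).
move=> [j]; rewrite /Defs.cat_tuple; case: (fintype.split j) => k Hk.
  by left; exists k.
by right; exists k.
Qed.

Lemma good_exists n (Q : 'I_n -> zw_pred) : (forall j, Good (Q j)) ->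
  Good (fun N z w => exists j, Q j N z w).
Proof.
elim: n Q => [|n IH] Q HQ.
  by apply: good_ext good_false => N _ z w; split=> // -[[]].
apply: good_ext (good_or (HQ ord0) (IH _ (fun j => HQ (lift ord0 j)))).
move=> N _ z w; split=> [[H|[j Hj]]|[j Hj]]; [by exists ord0|by exists (lift ord0 j)|].
by case: (unliftP ord0 j) Hj => [k|] ->; [right; exists k|left].
Qed.

Definition system (I : finType) s (Y : pattern L C s r)
    (Psi : vpred T F (I * nat + 'I_s) ('I_p + 'I_r)) : zw_pred := fun N z w =>
  exists2 y, in_pattern Y w y & exists x : I -> mt_vs N,
    Psi (reduct_model N) (join (orbits (th N) x) y) (join z w).

Definition constraints (A B : finType) s (g : B -> {poly K}) (pi : B -> 'I_s)
    (N : model_theta T F) (x : A + B -> mt_vs N) (y : 'I_s -> mt_vs N) : Prop :=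
  forall b, pev (g b) (th N) (x (inr b)) = y (pi b).

Definition csystem (A B : finType) s (Y : pattern L C s r)
    (Psi : vpred T F ((A + B) * nat + 'I_s) ('I_p + 'I_r))
    (g : B -> {poly K}) (pi : B -> 'I_s) : zw_pred := fun N z w =>
  exists2 y, in_pattern Y w y & exists x : A + B -> mt_vs N,
    Psi (reduct_model N) (join (orbits (th N) x) y) (join z w) /\ constraints g pi x y.

(** Once g_b[theta](x_b) = y_b is part of the L-relation on orbits, a change of variables transports
    it automatically. *)
Definition fold_constraints (A B : finType) s
    (Psi : vpred T F ((A + B) * nat + 'I_s) ('I_p + 'I_r))
    (g : B -> {poly K}) (pi : B -> 'I_s) :
    vpred T F ((A + B) * nat + 'I_s) ('I_p + 'I_r) := fun M v u =>
  Psi M v u /\ forall b, leval v (poly_lexp 'I_s (g b) (inr b)) = v (inr (pi b)).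

Lemma vd_fold_constraints (A B : finType) s
    (Psi : vpred T F ((A + B) * nat + 'I_s) ('I_p + 'I_r))
    (g : B -> {poly K}) (pi : B -> 'I_s) :
  vdef Psi -> vdef (fold_constraints Psi g pi).
Proof.
by move=> dPsi; apply: vd_and => //; apply: vd_all_fin => b; exact: vd_lin.
Qed.

Lemma fold_constraintsE (A B : finType) s
    (Psi : vpred T F ((A + B) * nat + 'I_s) ('I_p + 'I_r))
    (g : B -> {poly K}) (pi : B -> 'I_s) (N : model_theta T F)
    (x : A + B -> mt_vs N) (y : 'I_s -> mt_vs N) u :
  fold_constraints Psi g pi (M := reduct_model N) (join (orbits (th N) x) y) u <->
  Psi (reduct_model N) (join (orbits (th N) x) y) u /\ constraints g pi x y.
Proof.
by split=> -[H1 H2]; split=> // b; move: (H2 b); rewrite leval_poly.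
Qed.

Definition change_vars (I0 I1 : finType) s0 s1
    (Psi : vpred T F (I0 * nat + 'I_s0) ('I_p + 'I_r)) (emb : 'I_s0 -> 'I_s1)
    (coef : I0 -> nat -> I1 -> {poly K}) (off : I0 -> nat -> seq 'I_s1) :
    vpred T F (I1 * nat + 'I_s1) ('I_p + 'I_r) := fun M v u =>
  Psi M (join (fun li => leval v (subst_lexp coef off li)) (v \o (inr \o emb))) u.

Section ChangeVars.
Variables (I0 A B : finType) (s0 s1 : nat) (Y0 : pattern L C s0 r).
Variable Psi : vpred T F (I0 * nat + 'I_s0) ('I_p + 'I_r).
Variables (Y1 : pattern L C s1 r) (emb : 'I_s0 -> 'I_s1).
Variables (coef : I0 -> nat -> A + B -> {poly K}) (off : I0 -> nat -> seq 'I_s1).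
Variables (g : B -> {poly K}) (pi : B -> 'I_s1) (n0 : nat).

Let I1 : finType := (A + B)%type.

Lemma vd_change_vars : vdef Psi -> vdef (change_vars (I1 := I1) Psi emb coef off).
Proof. exact: vd_subst. Qed.

Lemma change_vars_indep (M : model T F) v v' u :
  (forall l i l' i', (i' < size (coef l i l'))%N -> v (inl (l', i')) = v' (inl (l', i'))) ->
  (forall j, v (inr j) = v' (inr j)) ->
  change_vars (I1 := I1) Psi emb coef off (M := M) v u <->
  change_vars (I1 := I1) Psi emb coef off (M := M) v' u.
Proof.
move=> E E'; rewrite /change_vars.
rewrite (_ : join _ _ = join (fun li => leval v' (subst_lexp (I1 := I1) coef off li))
  (v' \o (inr \o emb))) //.
apply/funext => -[li|j] /=; last exact: E'.
apply: (@leval_subst_lexp_indep _ (VS M) _ I1 _ coef off v v' li) => // l' i'.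
exact: E.
Qed.

(** The two conditions are asymmetric: old solutions must yield new unknowns satisfying the new
    constraints, whereas new unknowns only have to determine some old tuple, on which [Psi] is then
    evaluated. *)
Lemma change_vars_system :
  (forall (M : model T F) v v' u,
    (forall l i, (i < n0)%N -> v (inl (l, i)) = v' (inl (l, i))) ->
    (forall z, v (inr z) = v' (inr z)) -> @Psi M v u <-> @Psi M v' u) ->
  (forall N : model_theta T F, TC_image_complete C N -> forall z w y x,
     in_pattern Y0 w y -> @Psi (reduct_model N) (join (orbits (th N) x) y) (join z w) ->
     exists y1 x1, [/\ in_pattern Y1 w y1, y1 \o emb = y, constraints g pi x1 y1
                     & solves (th N) coef off n0 x x1 y1]) ->
  (forall N : model_theta T F, TC_image_complete C N -> forall w y1 x1,
     in_pattern (N := N) Y1 w y1 -> constraints g pi x1 y1 ->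
     in_pattern Y0 w (y1 \o emb) /\ exists x, solves (th N) coef off n0 x x1 y1) ->
  forall N : model_theta T F, TC_image_complete C N -> forall z w,
    system Y0 Psi z w <->
    csystem Y1 (change_vars (I1 := I1) Psi emb coef off) g pi (N := N) z w.
Proof.
move=> Pbound fwd bwd N tcN z w.
have E x x1 y1 : solves (th N) coef off n0 x x1 y1 ->
    change_vars (I1 := I1) Psi emb coef off (M := reduct_model N) (join (orbits (th N) x1) y1) (join z w)
    <-> @Psi (reduct_model N) (join (orbits (th N) x) (y1 \o emb)) (join z w).
  move=> sol; rewrite /change_vars; apply: Pbound => // l i lt_i.
  exact: etrans (leval_subst_lexp _ _ _ _ _ _) (esym (sol l i lt_i)).
split.
  move=> [y Yy [x Px]]; have [y1 [x1 [Yy1 Ey cx sol]]] := fwd N tcN z w y x Yy Px.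
  by exists y1 => //; exists x1; split=> //; apply/(E x) => //; rewrite Ey.
move=> [y1 Yy1 [x1 [Px cx]]]; have [Yy [x sol]] := bwd N tcN w y1 x1 Yy1 cx.
by exists (y1 \o emb) => //; exists x; apply/(E x x1).
Qed.

End ChangeVars.

Lemma linear_change (I0 A B : finType) s0 s1 (Y0 : pattern L C s0 r)
    (Psi : vpred T F (I0 * nat + 'I_s0) ('I_p + 'I_r))
    (Y1 : pattern L C s1 r) (emb : 'I_s0 -> 'I_s1) (U : I0 -> A + B -> {poly K})
    (g : B -> {poly K}) (pi : B -> 'I_s1) :
  vdef Psi ->
  (forall N : model_theta T F, TC_image_complete C N -> forall z w y x,
     in_pattern Y0 w y -> Psi (reduct_model N) (join (orbits (th N) x) y) (join z w) ->
     exists y1 x1, [/\ in_pattern Y1 w y1, y1 \o emb = y, constraints g pi x1 y1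
       & forall l, x l = \sum_l' pev (U l l') (th N) (x1 l')]) ->
  (forall N : model_theta T F, TC_image_complete C N -> forall w y1,
     in_pattern (N := N) Y1 w y1 -> in_pattern (N := N) Y0 w (y1 \o emb)) ->
  exists2 Psi1 : vpred T F ((A + B) * nat + 'I_s1) ('I_p + 'I_r),
    vdef Psi1 & forall N : model_theta T F, TC_image_complete C N -> forall z w,
      system Y0 Psi z w <-> csystem Y1 Psi1 g pi (N := N) z w.
Proof.
move=> dPsi fwd bwd; have [n0 Hn0] := vd_bound dPsi.
pose coef l i l' := 'X^i * U l l'.
pose off (l : I0) (i : nat) : seq 'I_s1 := [::].
have sol N x x1 y1 : (forall l, x l = \sum_l' pev (U l l') (th N) (x1 l')) ->
    solves (th N) coef off n0 x x1 y1.
  exact: solves_linear.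
exists (change_vars (I1 := (A + B)%type) Psi emb coef off); first exact: vd_change_vars.
apply: (change_vars_system (n0 := n0)) => // [N tcN z w y x Yy Px|N tcN w y1 x1 Yy1 _].
  have [y1 [x1 [Yy1 Ey cx Ex]]] := fwd N tcN z w y x Yy Px.
  by exists y1, x1; split=> //; apply: sol.
split; first exact: bwd.
by exists (fun l => \sum_l' pev (U l l') (th N) (x1 l')); apply: sol.
Qed.

End Systems.

(** * Elimination steps *)

Section Combinations.
Variables (K : fieldType) (V : lmodType K) (theta : {linear V -> V}).

Lemma pev_delta (I : finType) (x : I -> V) l :
  \sum_l' pev (l == l')%:R theta (x l') = x l.
Proof.
rewrite (bigD1 l) //= eqxx pev1 big1 ?addr0 // => l' /negPf l'l.
by rewrite eq_sym l'l pev0.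
Qed.

(** Writes the right-hand side of a new constraint as a combination over all coordinates, the form
    that [pattern_linear] takes. Summing the Kronecker deltas over k allows repeated values of
    [pi]. *)
Lemma pev_delta_comb (I J : finType) (y : I -> V) (a : I) (pi : J -> I)
    (c : {poly K}) (d : J -> {poly K}) :
  \sum_j pev ((j == a)%:R * c - \sum_k (j == pi k)%:R * d k) theta (y j) =
  pev c theta (y a) - \sum_k pev (d k) theta (y (pi k)).
Proof.
have E b q : \sum_j pev ((j == b)%:R * q) theta (y j) = pev q theta (y b).
  rewrite (bigD1 b) //= eqxx mul1r big1 ?addr0 // => j /negPf ->.
  by rewrite mul0r pev0.
under eq_bigr do rewrite pevB pev_sum.
rewrite sumrB E; congr (_ - _); rewrite exchange_big /=.
by apply: eq_bigr => k _; rewrite E.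
Qed.

Definition mact k m (M : 'M[{poly K}]_(k, m)) (x : 'I_m -> V) (a : 'I_k) : V :=
  \sum_b pev (M a b) theta (x b).

Lemma mact_mul k m n (M : 'M[{poly K}]_(k, m)) (M' : 'M[{poly K}]_(m, n)) x a :
  mact (M *m M') x a = mact M (mact M' x) a.
Proof.
rewrite /mact; under eq_bigr do rewrite mxE pev_sum.
rewrite exchange_big; apply: eq_bigr => b _; rewrite linear_sum.
by apply: eq_bigr => c _; rewrite pevM.
Qed.

Lemma mact_unimodular m (U W : 'M[{poly K}]_m) x l :
  U *m W = 1%:M -> x l = \sum_j pev (U l j) theta (mact W x j).
Proof.
move=> UW; rewrite -[RHS]/(mact U (mact W x) l) -mact_mul UW /mact.
by rewrite -[LHS]pev_delta; apply: eq_bigr => j _; rewrite mxE.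
Qed.

Lemma mact_reduced m (lam : 'rV[{poly K}]_m) (U W : 'M[{poly K}]_m) i x :
  U *m W = 1%:M -> (forall j, j != i -> (lam *m U) 0 j = 0) ->
  \sum_l pev (lam 0 l) theta (x l) = pev ((lam *m U) 0 i) theta (mact W x i).
Proof.
move=> UW Hi; rewrite -[LHS]/(mact lam x 0) -[lam in LHS]mulmx1 -UW mulmxA mact_mul.
by rewrite /mact (bigD1 i) //= [X in _ + X]big1 ?addr0 // => j /Hi ->; rewrite pev0.
Qed.

Lemma void_substitution (I : finType) (x : I -> V) l :
  x l = \sum_l1 pev (if l1 is inr l' then (l == l')%:R else 0) theta
                   (join (of_void V) x l1).
Proof.
by rewrite big_sumType /= [X in X + _]big1 ?add0r ?pev_delta // => -[].
Qed.

Section FreeSubstitution.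
Variables (m n : nat) (U W : 'M[{poly K}]_m) (i : 'I_m) (x : 'I_(m + n) -> V).

(** [U] recovers the old free variables from the new ones, W x. The new variable i leaves the free
    block and is indexed by [unit] among the constrained ones. *)
Definition free_coef (l : 'I_(m + n)) (l1 : 'I_m.-1 + (unit + 'I_n)) : {poly K} :=
  match fintype.split l, l1 with
  | inl l', inl j => U l' (lift i j) | inl l', inr (inl _) => U l' i
  | inr k, inr (inr k') => (k == k')%:R | _, _ => 0 end.

Definition free_vars (l1 : 'I_m.-1 + (unit + 'I_n)) : V :=
  match l1 with
  | inl j => mact W (x \o lshift n) (lift i j) | inr (inl _) => mact W (x \o lshift n) i
  | inr (inr k) => x (rshift m k) end.

Lemma free_substitution l : U *m W = 1%:M ->
  x l = \sum_l1 pev (free_coef l l1) theta (free_vars l1).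
Proof.
move=> UW; rewrite !big_sumType (big_pred1 tt) => [|[]] //=.
rewrite /free_coef; case: (split_ordP l) => l' -> /=.
  rewrite [LHS](mact_unimodular (x \o lshift n) l' UW) (bigD1_ord i) //= addrC.
  congr (_ + _); rewrite [X in _ + X]big1 ?addr0 // => k _.
  by rewrite pev0.
rewrite pev0 add0r [X in X + _]big1 ?add0r => [|j _]; last by rewrite pev0.
by rewrite (pev_delta (fun k => x (rshift m k))).
Qed.

(** With G the product of the g_k, the relation is multiplied by G: each term G lambda_k(x_k)
    becomes lambda_k (G / g_k) applied to the parameter g_k(x_k), and only free variables remain on
    the left. *)
Lemma free_constraint (I : finType) (y : I -> V) (a : I) (g : 'I_n -> {poly K})
    (pi : 'I_n -> I) (lam : 'I_(m + n) -> {poly K}) :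
  let lamli : 'rV_m := \row_l lam (lshift n l) in
  U *m W = 1%:M -> (forall j, j != i -> (lamli *m U) 0 j = 0) ->
  (forall k, pev (g k) theta (x (rshift m k)) = y (pi k)) ->
  \sum_l pev (lam l) theta (x l) = y a ->
  pev ((\prod_k g k) * (lamli *m U) 0 i) theta (mact W (x \o lshift n) i) =
  \sum_j pev ((j == a)%:R * (\prod_k g k) -
    \sum_k (j == pi k)%:R * (lam (rshift m k) * \prod_(k' | k' != k) g k')) theta (y j).
Proof.
move=> lamli UW lamU cx dep.
rewrite pevM -(mact_reduced _ UW lamU) pev_delta_comb -dep big_split_ord /= linearD /=.
rewrite -[LHS]addr0 -addrA; congr (_ + _).
  by congr (pev _ _ _); apply: eq_bigr => l _; rewrite mxE.
apply/eqP; rewrite eq_sym subr_eq0; apply/eqP; rewrite linear_sum; apply: eq_bigr => k _ /=.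
by rewrite -cx -!pevM (bigD1 k) //= mulrC mulrA (mulrAC (lam _)).
Qed.

End FreeSubstitution.

Section TorsionSubstitution.
Variables (m n : nat) (e : 'I_n -> {poly K}) (k0 : 'I_n) (x : 'I_(m + n) -> V).

(** The inverse of the substitution replacing x_k0 by the sum of the e_k(x_k); it has polynomial
    entries because e_k0 = 1. *)
Definition torsion_coef (l : 'I_(m + n)) (l1 : 'I_m + 'I_n) : {poly K} :=
  match fintype.split l, l1 with
  | inl j, inl j' => (j == j')%:R
  | inr k, inr k' => if k == k0 then if k' == k0 then 1 else - e k' else (k == k')%:R
  | _, _ => 0 end.

Definition torsion_vars (l1 : 'I_m + 'I_n) : V :=
  match l1 with
  | inl j => x (lshift n j)
  | inr k => if k == k0 then \sum_k' pev (e k') theta (x (rshift m k'))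
             else x (rshift m k) end.

Lemma torsion_substitution l : e k0 = 1 ->
  x l = \sum_l1 pev (torsion_coef l l1) theta (torsion_vars l1).
Proof.
move=> ek0; rewrite big_sumType /= /torsion_coef; case: (split_ordP l) => l' -> /=.
  rewrite (pev_delta (fun l => x (lshift n l))).
  by rewrite [X in _ + X]big1 ?addr0 // => k _; rewrite pev0.
rewrite [X in X + _]big1 ?add0r => [|j _]; last by rewrite pev0.
case: eqVneq => [->|l'k0]; last first.
  rewrite -[LHS](pev_delta (fun k => x (rshift m k))).
  apply: eq_bigr => k _; case: (eqVneq k k0) => // ->.
  by rewrite (negPf l'k0) !pev0.
rewrite (bigD1 k0) //= eqxx pev1 [X in X + _](bigD1 k0) //= ek0 pev1 -addrA -big_split /=.
rewrite [X in _ + X]big1 ?addr0 // => k /negPf ->.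
by rewrite pevN subrr.
Qed.

(** In mu times the relation, the parts d_k g_k(x_k) are parameters; what is left is h applied to
    the new variable. Later h is f_k0 to the power q_k0 - 1. *)
Lemma torsion_constraint (I : finType) (y : I -> V) (a : I) (g d : 'I_n -> {poly K})
    (pi : 'I_n -> I) (lam : 'I_(m + n) -> {poly K}) mu h :
  (forall l, lam (lshift n l) = 0) ->
  (forall k, mu * lam (rshift m k) = h * e k + d k * g k) ->
  (forall k, pev (g k) theta (x (rshift m k)) = y (pi k)) ->
  \sum_l pev (lam l) theta (x l) = y a ->
  pev h theta (\sum_k' pev (e k') theta (x (rshift m k'))) =
  \sum_j pev ((j == a)%:R * mu - \sum_k (j == pi k)%:R * d k) theta (y j).
Proof.
move=> lam0 Eed cx dep.
rewrite pev_delta_comb -dep big_split_ord /=.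
rewrite [X in pev mu _ (X + _)]big1 ?add0r => [|l _]; last by rewrite lam0 pev0.
rewrite !linear_sum /= -big_split; apply: eq_bigr => k' _ /=.
by rewrite -cx -!pevM -pevB Eed addrK.
Qed.

End TorsionSubstitution.

End Combinations.

Section Steps.
Variables (L : language) (K : fieldType) (T : theory L) (F : vs_formulas L K).
Variables (C : kernel_config K) (D : formula_set L) (p r : nat).

Notation th N := (@mt_theta L K T F N).

Lemma csystem_fold (A B : finType) s (Y : pattern L C s r)
    (Psi : vpred T F ((A + B) * nat + 'I_s) ('I_p + 'I_r)) (g : B -> {poly K}) (pi : B -> 'I_s) N z w :
  system Y (fold_constraints Psi g pi) (N := N) z w <-> csystem Y Psi g pi (N := N) z w.
Proof.
split=> [[y Yy [x /fold_constraintsE[Px cx]]]|[y Yy [x [Px cx]]]].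
  by exists y => //; exists x.
by exists y => //; exists x; apply/fold_constraintsE.
Qed.

(** Every vector is killed by MiPo(C)[theta], so all free variables become constrained at once. The
    zero right-hand side is a pattern coordinate obtained by [pattern_linear] with zero
    coefficients. *)
Lemma algebraic_step (A B : finType) s (Y : pattern L C s r)
    (Psi : vpred T F ((A + B) * nat + 'I_s) ('I_p + 'I_r)) (g : B -> {poly K}) (pi : B -> 'I_s) :
  algebraic_kc C -> algebraic_pattern T F Y -> vdef Psi -> (forall b, g b != 0) ->
  (forall (B : finType) s' (Y' : pattern L C s' r)
     (Psi' : vpred T F ((void + B) * nat + 'I_s') ('I_p + 'I_r))
     (g' : B -> {poly K}) (pi' : B -> 'I_s'),
     algebraic_pattern T F Y' -> vdef Psi' -> (forall b, g' b != 0) ->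
     Good C D (csystem Y' Psi' g' pi')) ->
  Good C D (csystem Y Psi g pi).
Proof.
move=> algC algY dPsi g0 IH.
have [s1 [Y1 [emb [out [algY1 Y1_Y Y_Y1]]]]] :=
  pattern_linear (fun _ : unit => fun _ => rc_poly C 0) algY.
pose B1 : finType := (A + B)%type.
pose U (l : A + B) (l1 : void + B1) : {poly K} := if l1 is inr l' then (l == l')%:R else 0.
pose g1 : B1 -> {poly K} := join (fun _ => MiPo C) g.
pose pi1 : B1 -> 'I_s1 := join (fun _ => out tt) (emb \o pi).
have [|||Psi1 dPsi1 E] := linear_change (A := void) (B := B1) (C := C) (Y0 := Y)
  (Psi := fold_constraints Psi g pi) (Y1 := Y1) (emb := emb) (U := U) (g := g1) (pi := pi1).
- exact: vd_fold_constraints.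
- move=> N [kerC imC] z w y x Yy /fold_constraintsE[_ cx].
  have [y1 Yy1 Ey] := Y_Y1 N w y Yy; exists y1, (join (of_void _) x); split=> //.
    have mipo v : pev (MiPo C) (th N) v = 0.
      by move: algC kerC; rewrite /algebraic_kc /kernel_condition; case: (kd C).
    have zero : y1 (out tt) = 0.
      by rewrite ((Y1_Y N w y1 Yy1).2 tt) big1 // => i _; rewrite /= pev0.
    by move=> [a|b]; rewrite /= ?mipo ?zero // cx -Ey.
  by move=> l; exact: (void_substitution (th N) x l).
- by move=> N _ w y1 /Y1_Y[].
apply: (good_ext (Q := csystem Y1 Psi1 g1 pi1)).
  by move=> N tcN z w; rewrite -E // csystem_fold.
by apply: IH => // -[a|b]; rewrite /g1 /= ?MiPo_neq0.
Qed.

Section Dependency.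
Variables (m n s : nat) (Y : pattern L C s r).
Variable Psi : vpred T F ('I_(m + n) * nat + 'I_s) ('I_p + 'I_r).
Variables (g : 'I_n -> {poly K}) (pi : 'I_n -> 'I_s) (a : 'I_s).
Variable lam : 'I_(m + n) -> {poly K}.
Hypotheses (algY : algebraic_pattern T F Y) (dPsi : vdef Psi).
Hypothesis dependency : forall N : model_theta T F, TC_image_complete C N ->
  forall z w y x, in_pattern Y w y ->
  @Psi (reduct_model N) (join (orbits (th N) x) y) (join z w) ->
  (forall k, pev (g k) (th N) (x (rshift m k)) = y (pi k)) /\
  \sum_l pev (lam l) (th N) (x l) = y a.

(** One free variable is lost, while the degrees may grow without control; this forces the
    lexicographic order. *)
Lemma free_step : (forall k, g k != 0) -> (exists l, lam (lshift n l) != 0) ->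
  (forall (A B : finType) s' (Y' : pattern L C s' r)
     (Psi' : vpred T F ((A + B) * nat + 'I_s') ('I_p + 'I_r))
     (g' : B -> {poly K}) (pi' : B -> 'I_s'),
     (#|A| < m)%N -> algebraic_pattern T F Y' -> vdef Psi' -> (forall b, g' b != 0) ->
     Good C D (csystem Y' Psi' g' pi')) ->
  Good C D (system Y Psi).
Proof.
move=> g0 [l0 lam_l0] IH.
pose lamli : 'rV[{poly K}]_m := \row_l lam (lshift n l).
have [|U [W [i [UW lamUi lamU]]]] := @unimodular_reduction _ _ lamli.
  by apply: contraNneq lam_l0 => /rowP/(_ l0); rewrite !mxE => ->.
pose G := \prod_k g k; pose G' k := \prod_(k' | k' != k) g k'.
pose rf (_ : unit) (j : 'I_s) := rc_poly C ((j == a)%:R * G -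
  \sum_k (j == pi k)%:R * (lam (rshift m k) * G' k)).
have [s1 [Y1 [emb [out [algY1 Y1_Y Y_Y1]]]]] := pattern_linear rf algY.
pose A1 : finType := 'I_m.-1; pose B1 : finType := (unit + 'I_n)%type.
pose g1 (b : B1) : {poly K} := if b is inr k then g k else G * (lamli *m U) 0 i.
pose pi1 (b : B1) : 'I_s1 := if b is inr k then emb (pi k) else out tt.
have [||Psi1 dPsi1 E] := linear_change (A := A1) (B := B1) (C := C) (Y0 := Y)
  (Psi := Psi) (Y1 := Y1) (emb := emb) (U := free_coef U i) (g := g1) (pi := pi1) dPsi.
- move=> N tcN z w y x Yy Px.
  have [cx dep] := dependency tcN Yy Px.
  have [y1 Yy1 Ey] := Y_Y1 N w y Yy.
  exists y1, (free_vars (th N) W i x); split=> //.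
    move=> [[]|k] /=; last by rewrite cx -Ey.
    apply: (etrans (free_constraint UW lamUi cx dep)).
    by rewrite ((Y1_Y N w y1 Yy1).2 tt) -Ey.
  by move=> l; exact: free_substitution.
- by move=> N _ w y1 /Y1_Y[].
apply: (good_ext (Q := csystem Y1 Psi1 g1 pi1)).
  by move=> N tcN z w; rewrite -E.
apply: IH => //; first by rewrite card_ord prednK // (leq_trans _ (ltn_ord i)).
move=> [_|k] //=; rewrite mulf_neq0 //.
by apply/prodf_neq0.
Qed.

Lemma torsion_step (f : 'I_n -> {poly K}) (q : 'I_n -> nat) :
  (forall k, Kirr (f k)) -> (forall k, (0 < q k)%N) -> (forall k, g k = f k ^+ q k) ->
  (forall l, lam (lshift n l) = 0) -> (exists k, ~~ (g k %| lam (rshift m k))) ->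
  (forall (A B : finType) s' (Y' : pattern L C s' r)
     (Psi' : vpred T F ((A + B) * nat + 'I_s') ('I_p + 'I_r))
     (g' : B -> {poly K}) (pi' : B -> 'I_s'),
     (#|A| <= m)%N -> (\sum_b (size (g' b)).-1 < \sum_k (size (g k)).-1)%N ->
     algebraic_pattern T F Y' -> vdef Psi' -> (forall b, g' b != 0) ->
     Good C D (csystem Y' Psi' g' pi')) ->
  Good C D (system Y Psi).
Proof.
move=> Kf q0 gE lam0 [k1 ndvd] IH.
have [|k0 [mu [e [d [ek0 Eed]]]]] :=
    @torsion_relation _ _ _ _ Kf q0 (fun k => lam (rshift m k)).
  by exists k1; rewrite -gE.
pose rf (_ : unit) (j : 'I_s) := rc_poly C ((j == a)%:R * mu -
  \sum_k (j == pi k)%:R * d k).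
have [s1 [Y1 [emb [out [algY1 Y1_Y Y_Y1]]]]] := pattern_linear rf algY.
pose A1 : finType := 'I_m; pose B1 : finType := 'I_n.
(* The exponent may reach 0; the constraint is then constant and is resolved without any unknown. *)
pose g1 (k : B1) : {poly K} := if k == k0 then f k0 ^+ (q k0).-1 else g k.
pose pi1 (k : B1) : 'I_s1 := if k == k0 then out tt else emb (pi k).
have [||Psi1 dPsi1 E] := linear_change (A := A1) (B := B1) (C := C) (Y0 := Y)
  (Psi := Psi) (Y1 := Y1) (emb := emb) (U := torsion_coef e k0) (g := g1) (pi := pi1) dPsi.
- move=> N tcN z w y x Yy Px.
  have [cx dep] := dependency tcN Yy Px.
  have [y1 Yy1 Ey] := Y_Y1 N w y Yy.
  exists y1, (torsion_vars (th N) e k0 x); split=> //.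
    move=> k; rewrite /= /g1 /pi1 /=; case: eqVneq => _; last by rewrite cx -Ey.
    have Eed' k' : mu * lam (rshift m k') = f k0 ^+ (q k0).-1 * e k' + d k' * g k'.
      by rewrite gE Eed.
    apply: (etrans (torsion_constraint lam0 Eed' cx dep)).
    by rewrite ((Y1_Y N w y1 Yy1).2 tt) -Ey.
  by move=> l; exact: torsion_substitution.
- by move=> N _ w y1 /Y1_Y[].
apply: (good_ext (Q := csystem Y1 Psi1 g1 pi1)).
  by move=> N tcN z w; rewrite -E.
apply: IH => //; first by rewrite card_ord.
  rewrite (bigD1 k0) //= [X in (_ < X)%N](bigD1 k0) //= /g1 eqxx gE !size_exp -addSn.
  apply: leq_add.
    rewrite ltn_pmul2l ?prednK //.
    by case: (Kf k0) => _ [f1 _]; case: (size _) f1 => [|[]].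
  by apply: leq_sum => k /negPf ->.
move=> k; rewrite /g1; case: ifP => _; last rewrite gE.
  by apply: Kirr_exp_neq0; exact: Kf.
by apply: Kirr_exp_neq0; exact: Kf.
Qed.

End Dependency.
End Steps.

(** * Normal form of a system *)

Section Resolution.
Variables (K : fieldType) (V : lmodType K) (theta : {linear V -> V}) (C : kernel_config K).

Lemma rc_eval_delta (I : finType) (y : I -> V) (a : I) (R : RC C) :
  \sum_i rc_eval theta (if i == a then R else rc_poly C 0) (y i) = rc_eval theta R (y a).
Proof.
rewrite (bigD1 a) //= eqxx big1 ?addr0 // => i /negPf ->.
exact: pev0.
Qed.

Definition rc_sum (I : Type) (s : seq I) (R : I -> RC C) : RC C :=
  foldr (fun i => rc_add (R i)) (rc_poly C 0) s.

Lemma rc_eval_sum (I : Type) (s : seq I) (R : I -> RC C) v :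
  rc_eval theta (rc_sum s R) v = \sum_(i <- s) rc_eval theta (R i) v.
Proof.
by elim: s => [|i s IH] /=; rewrite ?big_nil ?pev0 // big_cons IH.
Qed.

Lemma sum_tagged (B : finType) (J : B -> finType) b (h : forall b, J b -> V) :
  \sum_(bj : {b : B & J b}) (if tag bj == b then h (tag bj) (tagged bj) else 0) =
  \sum_j h b j.
Proof.
rewrite -(sig_big_dep xpredT (fun _ _ => true)
  (fun b' (j : J b') => if b' == b then h b' j else 0)) /=.
rewrite (bigD1 b) //= eqxx [X in _ + X]big1 ?addr0 // => b' /negPf ->.
by rewrite big1.
Qed.

Variables (A B : finType) (J : B -> finType) (G u : forall b, J b -> {poly K}).
Variables (e : B -> RC C) (c : forall b, J b -> RC C).
Hypothesis G0 : forall b j, @G b j != 0.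

(** Division with remainder: X^i u_j acts on x'_j as its remainder modulo G_j, plus its quotient
    applied to the parameter c_j(y). The remainders stand here; the quotients are collected in
    [resolution_offset]. *)
Definition resolution_coef (l : A + B) (i : nat) (l1 : A + {b : B & J b}) : {poly K} :=
  match l, l1 with
  | inl a, inl a' => 'X^i * (a == a')%:R
  | inr b, inr bj => if tag bj == b then ('X^i * u (tagged bj)) %% G (tagged bj) else 0
  | _, _ => 0 end.

Definition resolution_offset (b : B) (i : nat) : RC C :=
  rc_add (rc_comp (rc_poly C 'X^i) (e b))
    (rc_sum (enum (J b)) (fun j =>
       rc_comp (rc_poly C (('X^i * u j) %/ G j)) (c j))).

Lemma resolution_coef_size l i bj i' :
  (i' < size (resolution_coef l i (inr bj)))%N -> (i' < (size (G (tagged bj))).-1)%N.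
Proof.
case: l => [a|b] /=; first by rewrite size_poly0.
case: eqP => _; last by rewrite size_poly0.
move=> Hi; rewrite -ltnS prednK ?size_poly_gt0 // -ltnS.
apply: leq_ltn_trans (Hi) _; exact: ltn_modpN0.
Qed.

Lemma resolution_solves (n0 s1 : nat) (x : A + B -> V) (y : B -> V)
    (x1 : A + {b : B & J b} -> V) (y1 : 'I_s1 -> V) (off : A + B -> nat -> seq 'I_s1) :
  (forall a, x (inl a) = x1 (inl a)) ->
  (forall b, x (inr b) = rc_eval theta (e b) (y b) +
     \sum_(j : J b) pev (u j) theta (x1 (inr (Tagged J j)))) ->
  (forall b (j : J b), pev (G j) theta (x1 (inr (Tagged J j))) = rc_eval theta (c j) (y b)) ->
  (forall a i, off (inl a) i = [::]) ->
  (forall b i, (i < n0)%N ->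
     \sum_(j <- off (inr b) i) y1 j = rc_eval theta (resolution_offset b i) (y b)) ->
  solves theta (I1 := (A + {b : B & J b})%type) resolution_coef off n0 x x1 y1.
Proof.
move=> xl xr Gx offl offr [a|b] i lt_i; rewrite big_sumType /= -pevXn.
  rewrite offl big_nil addr0 [X in _ + X]big1 ?addr0 => [|bj _]; last by rewrite pev0.
  rewrite xl -[LHS](congr1 (pev 'X^i theta) (pev_delta theta (x1 \o inl) a)) linear_sum /=.
  by apply: eq_bigr => a' _; rewrite -pevM.
rewrite offr // [X in X + _ + _]big1 ?add0r => [|a _]; last by rewrite pev0.
transitivity (\sum_(j : J b) pev (('X^i * u j) %% G j) theta (x1 (inr (Tagged J j))) +
              rc_eval theta (resolution_offset b i) (y b)).
  rewrite /resolution_offset /= rc_eval_sum big_enum /= xr linearD /= linear_sum /=.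
  rewrite addrCA; congr (_ + _); rewrite -big_split; apply: eq_bigr => j _ /=.
  rewrite -Gx -!pevM -pevD addrC; congr (pev _ _ _).
  exact: divp_eq.
congr (_ + _).
rewrite -(sum_tagged b (fun b (j : J b) => pev (('X^i * u j) %% G j) theta (x1 (inr (Tagged J j))))).
by apply: eq_bigr => -[b' j] _ /=; case: eqP => // _; rewrite pev0.
Qed.

End Resolution.

(** A relation may be independent of a variable that still occurs in its formula, whereas
    [bounded_by] speaks of occurrences. So all unwanted variables are replaced by one quantified
    element, taken in V because independence is known for vectors only. *)
Lemma clean_formula (L : language) (K : fieldType) (F : vs_formulas L K) (X : Type)
    (bad : X -> bool) (psi : formula L X) :
  exists psi' : formula L X, (forall v, occurs v psi' -> ~~ bad v) /\
    forall (M : structure L) (v : X -> M), sat v psi' <->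
      exists2 c, inV F c & sat (fun x => if bad x then c else v x) psi.
Proof.
exists (Ex (And (rename_form (fun _ : 'I_1 => None) (fV F))
  (rename_form (fun x => if bad x then None else Some x) psi))); split=> [v|M v] /=.
  by case=> Ho; have [x Ex _] := occurs_rename Ho; move: Ex => //;
    case: ifP => // /negbT Hx [->].
suff E c : sat (oapp v c) (rename_form (fun _ : 'I_1 => None) (fV F)) /\
    sat (oapp v c) (rename_form (fun x => if bad x then None else Some x) psi) <->
    inV F c /\ sat (fun x => if bad x then c else v x) psi.
  by split=> [[c /E[]]|[c H1 H2]]; exists c => //; apply/E.
rewrite !sat_rename /inV.
rewrite (_ : _ \o (fun x => if bad x then None else Some x) =
  fun x => if bad x then c else v x) //.
by apply/funext => x /=; case: ifP.
Qed.

Section NormalForm.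
Variables (L : language) (K : fieldType) (T : theory L) (F : vs_formulas L K).
Variables (C : kernel_config K) (p r : nat).

Notation th N := (@mt_theta L K T F N).

Lemma sat_psi_theta (N : model_theta T F) n q (psi : pform L n p q)
    (x : 'I_n -> mt_vs N) z w :
  sat (join (join (fun k => toN (x k)) z) w) (psi_theta psi) <->
  psat (M := reduct_model N) psi (fun l i => iter i (th N) (x l)) z w.
Proof.
rewrite /psi_theta sat_subst /psat.
set v := (fun _ => _); set v' := passign _ _ _; suff -> : v = v' by [].
apply/funext => -[[[l i]|j]|j] //; rewrite /v /v' /=.
elim: i => [|i IH] //=.
rewrite -[toM _](mt_thetaV (iter i (th N) (x l))) /theta_of; congr fint.
by apply/funext => _; exact: IH.
Qed.

Section Normalize.
Variables (A B : finType) (s : nat) (Y : pattern L C s r).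
Variable Psi : vpred T F ((A + B) * nat + 'I_s) ('I_p + 'I_r).
Variables (g : B -> {poly K}) (pi : B -> 'I_s).
Hypotheses (algY : algebraic_pattern T F Y) (dPsi : vdef Psi).
Variables (J : B -> finType) (f : forall b, J b -> {poly K}) (q : forall b, J b -> nat).
Variables (u : forall b, J b -> {poly K}) (e : B -> RC C) (c : forall b, J b -> RC C).
Hypothesis Hfq : forall b (j : J b),
  [/\ Kirr (f j), C (f j) <> Some 0%N, (1 <= q j)%N & le_inf (q j) (C (f j))].
Hypothesis Hres : forall b (V : lmodType K) (theta : {linear V -> V}),
  kernel_condition C theta -> image_complete C theta ->
  forall x, exists x' : J b -> V,
    x = rc_eval theta (e b) (pev (g b) theta x) + \sum_j pev (u j) theta (x' j) /\
    forall j, pev (f j ^+ q j) theta (x' j) = rc_eval theta (c j) (pev (g b) theta x) /\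
      (isSome (C (f j)) ->
       Ker (f j ^+ (cfin C (f j) - q j)) theta (rc_eval theta (c j) (pev (g b) theta x))).

Let B1 : finType := {b : B & J b}.
Let G b (j : J b) := f j ^+ q j.

Definition residue b (j : J b) : RC C :=
  if isSome (C (f j)) then rc_comp (rc_poly C (f j ^+ (cfin C (f j) - q j))) (c j)
  else rc_poly C 0.

Lemma G_neq0 b (j : J b) : G j != 0.
Proof. by have [Kf _ _ _] := Hfq j; exact: Kirr_exp_neq0. Qed.

(* [pattern_compatible] has to hold on the whole pattern: the right-hand side of
   the constraint b is a copy of c_b that exists only where its residue vanishes. *)
Lemma resolved_system :
  exists s2 (Y2 : pattern L C s2 r) (pi2 : B1 -> 'I_s2)
    (Psi2 : vpred T F ((A + B1) * nat + 'I_s2) ('I_p + 'I_r)),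
  [/\ [/\ algebraic_pattern T F Y2, injective pi2 & vdef Psi2],
      forall (M : model T F) v v' z,
        (forall a i, v (inl (inl a, i)) = v' (inl (inl a, i))) ->
        (forall (b : B1) i, (i < (size (G (tagged b))).-1)%N ->
           v (inl (inr b, i)) = v' (inl (inr b, i))) ->
        (forall j, v (inr j) = v' (inr j)) -> Psi2 M v z <-> Psi2 M v' z,
      forall (N : model_theta T F) (w : 'I_r -> N) (y : 'I_s2 -> mt_vs N), in_pattern Y2 w y ->
        forall b : B1, isSome (C (f (tagged b))) ->
        Ker (f (tagged b) ^+ (cfin C (f (tagged b)) - q (tagged b))) (th N) (y (pi2 b))
    & forall N : model_theta T F, TC_image_complete C N -> forall z w,
        csystem Y Psi g pi (N := N) z w <->
        csystem Y2 Psi2 (fun b => G (tagged b)) pi2 (N := N) z w].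
Proof.
have dPsi0 := vd_fold_constraints g pi dPsi.
have [n0 Hn0] := vd_bound dPsi0.
(* Three kinds of stored values: the offsets of theta^i(x_b) for i < n0, the right-hand sides
   c_j(y), and the residues that test their compatibility. *)
pose J0 : finType := (B * 'I_n0 + (B1 + B1))%type.
pose rf (o : J0) (j : 'I_s) : RC C := match o with
  | inl bi => if j == pi bi.1 then resolution_offset (@G) u e c bi.1 bi.2 else rc_poly C 0
  | inr (inl b) => if j == pi (tag b) then c (tagged b) else rc_poly C 0
  | inr (inr b) => if j == pi (tag b) then residue (tagged b) else rc_poly C 0 end.
have [s1 [Y1 [emb [out [algY1 Y1_Y Y_Y1]]]]] := pattern_linear rf algY.
have outE (N : model_theta T F) (w : 'I_r -> N) y : in_pattern Y1 w y ->
    [/\ forall b (i : 'I_n0), y (out (inl (b, i))) =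
          rc_eval (th N) (resolution_offset (@G) u e c b i) (y (emb (pi b))),
        forall b (j : J b), y (out (inr (inl (Tagged J j)))) =
          rc_eval (th N) (c j) (y (emb (pi b)))
      & forall b (j : J b), y (out (inr (inr (Tagged J j)))) =
          rc_eval (th N) (residue j) (y (emb (pi b)))].
  move=> /Y1_Y[_ H]; split=> [b i|b j|b j]; rewrite H /rf;
  exact: (rc_eval_delta (th N) (y \o emb)).
pose P2 (k : 'I_#|B1|) : vpred T F (option 'I_s1) 'I_r := fun M v _ =>
  v (Some (out (inr (inr (enum_val k))))) = 0 /\
  v (Some (out (inr (inl (enum_val k))))) = v None.
have [||Y2 [algY2 HY2]] := pattern_fun (fun _ : 'I_#|B1| => rc_poly C 1) (P := P2) algY1.
- move=> k; apply: vd_and; first exact: vd_zero.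
  apply: vd_ext (vd_lin _ _ _ [:: (1, Some (out (inr (inl (enum_val k)))))] None).
  by move=> M v z; rewrite /leval big_seq1 scale1r.
- move=> k M v v' z [_ E] [_ E'] Ev; rewrite -E -E'.
  exact: (congr1 (fun h => h (out (inr (inl (enum_val k))))) Ev).
pose s2 := (s1 + #|B1|)%N.
(* A fresh coordinate for each constraint makes the projection injective, even if [pi] was not. *)
pose pi2 (b : B1) : 'I_s2 := rshift s1 (enum_rank b).
pose emb2 := lshift #|B1| \o emb.
pose off (l : A + B) (i : nat) : seq 'I_s2 := match l with
  | inl _ => [::]
  | inr b => if insub i is Some i' then [:: lshift _ (out (inl (b, i')))] else [::] end.
have pi2E (N : model_theta T F) (w : 'I_r -> N) (y : 'I_s2 -> mt_vs N) :
    in_pattern Y2 w y -> forall b : B1,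
    y (lshift _ (out (inr (inr b)))) = 0 /\ y (pi2 b) = y (lshift _ (out (inr (inl b)))).
  move=> /HY2[_ H] b; have [x [Ex [E1 E2]]] := H (enum_rank b).
  rewrite !enum_rankK /= in E1 E2.
  by split; [exact: E1|rewrite [LHS]Ex [RHS]E2; exact: pev1].
pose Psi2 := change_vars (I1 := (A + B1)%type) (fold_constraints Psi g pi) emb2
  (resolution_coef (A := A) (@G) u) off.
exists s2, Y2, pi2, Psi2; split.
- split=> //; first by move=> b b' /rshift_inj/enum_rank_inj.
  exact: vd_change_vars.
- move=> M v v' z E1 E2 E3; apply: change_vars_indep => // l i [a|b] i' Hi; first exact: E1.
  exact/E2/(resolution_coef_size G_neq0 Hi).
- move=> N w y Yy [b j] Cf; have [E1 ->] := pi2E N w y Yy (Tagged J j).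
  have [/outE[_ /(_ b j) Ec /(_ b j) Er] _] := (HY2 N w y).1 Yy.
  move: E1; rewrite -[y _]/((y \o lshift _) _) Er /residue Cf => E1.
  by rewrite -[y _]/((y \o lshift _) _) Ec; exact: E1.
move=> N tcN z w; rewrite -csystem_fold.
apply: (change_vars_system (n0 := n0)) => // {z w} {}N {}tcN.
  move=> z w y x Yy /fold_constraintsE[_ cx].
  have [kerC imC] := tcN.
  pose x' b := sval (cid (Hres b kerC imC (x (inr b)))).
  have Hx' b := svalP (cid (Hres b kerC imC (x (inr b)))).
  have [y1 Yy1 Ey] := Y_Y1 N w y Yy.
  pose y2 := Defs.cat_tuple y1 (fun k : 'I_#|B1| => y1 (out (inr (inl (enum_val k))))).
  have y2l : y2 \o lshift _ = y1 by exact: cat_tuple_lshift.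
  have y2r k : y2 (rshift s1 k) = y1 (out (inr (inl (enum_val k)))).
    by rewrite -[LHS]/((y2 \o @rshift _ _) k) cat_tuple_rshift.
  have [y1o y1c y1r] := outE N w y1 Yy1.
  have Eyb b : y1 (emb (pi b)) = pev (g b) (th N) (x (inr b)).
    by rewrite cx -Ey.
  (* The right-hand sides come from an actual solution of the old constraints, so the residues
     vanish and the restricted copies exist. *)
  have Yy2 : in_pattern Y2 w y2.
    apply/HY2; rewrite y2l; split=> // k; exists (y1 (out (inr (inl (enum_val k))))).
    split; first by rewrite y2r /= pev1.
    split=> //=; case: (enum_val k) => b j; rewrite y1r Eyb /residue.
    by case: ifP => [Cf|_]; [exact: ((Hx' b).2 j).2|exact: (pev0 (th N))].
  exists y2, (fun l => match l with inl a => x (inl a) | inr bj => x' (tag bj) (tagged bj) end).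
  split=> //.
  - by rewrite /emb2 compA y2l.
  - move=> [b j]; rewrite /pi2 y2r enum_rankK y1c Eyb.
    exact: ((Hx' b).2 j).1.
  apply: (resolution_solves (e := e) (c := c) (y := fun b => y1 (emb (pi b)))) => //.
  - by move=> b; rewrite Eyb; exact: (Hx' b).1.
  - by move=> b j; rewrite Eyb; exact: ((Hx' b).2 j).1.
  move=> b i lt_i; rewrite /off insubT big_seq1.
  by rewrite -[y2 _]/((y2 \o lshift _) _) y2l y1o.
move=> w y2 x1 Yy2 cx1.
have [Yy1 _] := (HY2 N w y2).1 Yy2; have [y1o y1c y1r] := outE N w _ Yy1.
split; first exact: (Y1_Y N w _ Yy1).1.
exists (fun l => match l with inl a => x1 (inl a)
  | inr b => rc_eval (th N) (e b) (y2 (emb2 (pi b))) +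
             \sum_(j : J b) pev (u j) (th N) (x1 (inr (Tagged J j))) end).
apply: (resolution_solves (e := e) (c := c) (y := fun b => y2 (emb2 (pi b)))) => //.
- move=> b j; rewrite (cx1 (Tagged J j)) (pi2E N w y2 Yy2 _).2.
  exact: y1c.
- move=> b i lt_i; rewrite /off insubT big_seq1.
  exact: (y1o b (Ordinal lt_i)).
Qed.

End Normalize.
End NormalForm.

Lemma dep_choice (B : Type) (X : B -> Type) (P : forall b, X b -> Prop) :
  (forall b, exists x, P b x) -> exists h : forall b, X b, forall b, P b (h b).
Proof.
by move=> H; exists (fun b => sval (cid (H b))) => b; exact: svalP (cid (H b)).
Qed.

(** * From resolved systems to disjuncts *)

Section Disjuncts.
Variables (L : language) (K : fieldType) (T : theory L) (F : vs_formulas L K).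
Variables (C : kernel_config K) (p r : nat).

Notation th N := (@mt_theta L K T F N).

Section OfSystem.
Variables (A B : finType) (f : B -> {poly K}) (q : B -> nat) (s : nat).
Variables (Y : pattern L C s r) (pi : B -> 'I_s).
Variable Psi : vpred T F ((A + B) * nat + 'I_s) ('I_p + 'I_r).
Hypotheses (A0 : algebraic_kc C -> #|A| = 0%N) (dPsi : vdef Psi).
Hypothesis Hfq : forall b,
  [/\ Kirr (f b), C (f b) <> Some 0%N, (1 <= q b)%N & le_inf (q b) (C (f b))].
Hypothesis Psi_bounded : forall (M : model T F) v v' z,
  (forall a i, v (inl (inl a, i)) = v' (inl (inl a, i))) ->
  (forall b i, (i < (size (f b ^+ q b)).-1)%N -> v (inl (inr b, i)) = v' (inl (inr b, i))) ->
  (forall j, v (inr j) = v' (inr j)) -> @Psi M v z <-> @Psi M v' z.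

Definition system_seqsys : seqsys C :=
  @SeqSys K C #|A| #|B| (fun k => f (enum_val k)) (fun k => q (enum_val k)) A0
    (fun k => let: And4 H _ _ _ := Hfq (enum_val k) in H)
    (fun k => let: And4 _ H _ _ := Hfq (enum_val k) in H)
    (fun k => let: And4 _ _ H _ := Hfq (enum_val k) in H)
    (fun k => let: And4 _ _ _ H := Hfq (enum_val k) in H).

Let m := #|A|.
Let n := #|B|.

Definition rank_var (l : A + B) : 'I_(m + n) :=
  match l with inl a => lshift n (enum_rank a) | inr b => rshift m (enum_rank b) end.

Definition unrank_var (k : 'I_(m + n)) : A + B :=
  match fintype.split k with inl i => inl (enum_val i) | inr i => inr (enum_val i) end.

Lemma rank_varK : cancel rank_var unrank_var.
Proof.
by case=> l; rewrite /unrank_var /rank_var ?(unsplitK (inl _)) ?(unsplitK (inr _)) enum_rankK.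
Qed.

Definition out_of_bounds (v : 'I_(m + n) * nat + 'I_p + 'I_(s + r)) : bool :=
  if v is inl (inl (l, i)) then
    if fintype.split l is inr k then
      ((size (f (enum_val k) ^+ q (enum_val k))).-1 <= i)%N else false
  else false.

Lemma bounded_pform : exists psi : pform L (m + n) p (s + r),
  bounded_by (S := system_seqsys) psi /\
  forall (M : model T F) x y z w,
    psat (M := M) psi x z (Defs.cat_tuple (fun j => toM (y j)) w) <->
    Psi (M := M) (join (fun li => x (rank_var li.1) li.2) y) (join z w).
Proof.
have [P HP] := dPsi.
pose t (v : (A + B) * nat + 'I_s + ('I_p + 'I_r)) :
    'I_(m + n) * nat + 'I_p + 'I_(s + r) := match v with
  | inl (inl li) => inl (inl (rank_var li.1, li.2)) | inl (inr j) => inr (lshift r j)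
  | inr (inl j) => inl (inr j) | inr (inr j) => inr (rshift s j) end.
have [psi [psi_occ psi_sat]] := clean_formula F out_of_bounds (rename_form t P).
exists psi; split=> [k i le_i /psi_occ|M x y z w].
  by rewrite /= (unsplitK (inr k)) le_i.
rewrite /psat psi_sat.
pose x' (c : VS M) l i := if out_of_bounds (inl (inl (l, i))) then c else x l i.
have E (c : VS M) :
    sat (fun v => if out_of_bounds v then toM c else
      passign (fun l i => toM (x l i)) z (Defs.cat_tuple (fun j => toM (y j)) w) v)
      (rename_form t P) <->
    Psi (M := M) (join (fun li => x (rank_var li.1) li.2) y) (join z w).
  rewrite sat_rename.
  rewrite (_ : _ \o t = join (fun v => toM (join (fun li => x' c (rank_var li.1) li.2) y v)) (join z w)); last first.
    apply/funext => -[[[l i]|j]|[j|j]] //=.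
    - by rewrite /x' /=; case: ifP.
    - by rewrite /Defs.cat_tuple (unsplitK (inl j)).
    - by rewrite /Defs.cat_tuple (unsplitK (inr j)).
  rewrite HP; apply: Psi_bounded => //= [a i|b i lt_i].
    by rewrite /x' /= (unsplitK (inl _)).
  by rewrite /x' /= (unsplitK (inr _)) enum_rankK leqNgt lt_i.
split=> [[c /(inV_toM (M := M))[c' <-] /E]|H] //.
by exists (toM (0 : VS M)); [exact: toM_inV|apply/E].
Qed.

Lemma disjunct_of_system : algebraic_pattern T F Y -> injective pi ->
  (forall N : model_theta T F, TC_image_complete C N ->
     forall (w : 'I_r -> N) (y : 'I_s -> mt_vs N), in_pattern Y w y ->
     forall b, isSome (C (f b)) -> Ker (f b ^+ (cfin C (f b) - q b)) (th N) (y (pi b))) ->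
  exists E : disjunct L C p r,
  [/\ ss_m (dj_S E) = #|A|,
      (\sum_k (size (@ss_f _ _ (dj_S E) k ^+ ss_q k)).-1 =
         \sum_b (size (f b ^+ q b)).-1)%N,
      bounded_by (dj_psi E),
      [/\ algebraic_pattern T F (dj_Y E), injective (@dj_pi _ _ _ _ _ E)
      & pattern_compatible T F (dj_Y E) (@dj_pi _ _ _ _ _ E)]
    & forall N : model_theta T F, TC_image_complete C N -> forall z w,
        csystem Y Psi (fun b => f b ^+ q b) pi (N := N) z w <-> disjunct_holds E z w].
Proof.
move=> algY pi_inj compat; have [psi [psi_bounded Hpsi]] := bounded_pform.
pose pi' (k : 'I_n) := pi (enum_val k).
exists (@Disjunct L K C p r system_seqsys s Y pi' psi); split=> //=.
- by rewrite [RHS](big_enum_val (A := B)).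
- split=> //; first by move=> i j /pi_inj/enum_val_inj.
  by move=> N tcN w y Yy k Cf; exact: compat.
move=> N tcN z w; split=> [[y Yy [x [Px cx]]]|[y Yy [x [Px cx]]]]; exists y => //=.
  exists (x \o unrank_var); split; last first.
    by move=> k; rewrite /= /unrank_var (unsplitK (inr k)) cx.
  apply/sat_psi_theta/(Hpsi (reduct_model N)); move: Px.
  rewrite (_ : join _ _ = join
    (fun li => iter li.2 (th N) ((x \o unrank_var) (rank_var li.1))) y) //.
  by apply/funext => -[[l i]|j] //=; rewrite rank_varK.
exists (x \o rank_var); split.
  by move: Px => /sat_psi_theta/(Hpsi (reduct_model N)).
by move=> b /=; have := cx (enum_rank b); rewrite /= /pi' enum_rankK.
Qed.

End OfSystem.

(** Everything required of a disjunct is reached here except membership of its formula in D. The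
    first two clauses say that the induction measure has not grown. *)
Lemma normal_form (A B : finType) s (Y : pattern L C s r)
    (Psi : vpred T F ((A + B) * nat + 'I_s) ('I_p + 'I_r))
    (g : B -> {poly K}) (pi : B -> 'I_s) :
  (algebraic_kc C -> #|A| = 0%N) -> algebraic_pattern T F Y -> vdef Psi ->
  (forall b, g b != 0) ->
  exists E : disjunct L C p r,
  [/\ ss_m (dj_S E) = #|A|,
      (\sum_k (size (@ss_f _ _ (dj_S E) k ^+ ss_q k)).-1 <= \sum_b (size (g b)).-1)%N,
      bounded_by (dj_psi E),
      [/\ algebraic_pattern T F (dj_Y E), injective (@dj_pi _ _ _ _ _ E)
      & pattern_compatible T F (dj_Y E) (@dj_pi _ _ _ _ _ E)]
    & forall N : model_theta T F, TC_image_complete C N -> forall z w,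
        csystem Y Psi g pi (N := N) z w <-> disjunct_holds E z w].
Proof.
move=> A0 algY dPsi g0.
have [J R1] := dep_choice (fun b => resolvable_neq0 C (g0 b)).
have [f R2] := dep_choice R1; have [q R3] := dep_choice R2.
have [u R4] := dep_choice R3; have [e R5] := dep_choice R4.
have [c R] := dep_choice R5.
have Hfq b (j : J b) : [/\ Kirr (f b j), C (f b j) <> Some 0%N, (1 <= q b j)%N
    & le_inf (q b j) (C (f b j))].
  by case: (R b).
have Hsize b : (\sum_(j : J b) (size (f b j ^+ q b j)).-1 <= (size (g b)).-1)%N.
  by case: (R b).
have Hsys :=
  resolved_system (g := g) pi algY dPsi (f := f) (q := q) (u := u) (e := e) (c := c) Hfq.
have {}Hsys := Hsys (fun b => let: And3 _ _ H := R b in H).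
case: Hsys => s2 [Y2 Hsys]; case: Hsys => pi2 [Psi2 Hsys].
have [[algY2 pi2_inj dPsi2] bnd compat E] := Hsys.
have [E' [Em Es Eb Ea Eh]] := disjunct_of_system A0 dPsi2
  (f := fun b : {b : B & J b} => f (tag b) (tagged b))
  (q := fun b => q (tag b) (tagged b)) (fun b => Hfq _ _) bnd algY2 pi2_inj
  (fun N _ => compat N).
exists E'; split=> //; last by move=> N tcN z w; rewrite -Eh // E.
rewrite Es -(sig_big_dep xpredT (fun _ _ => true)
  (fun b (j : J b) => (size (f b j ^+ q b j)).-1)).
exact: leq_sum.
Qed.

End Disjuncts.

(** * Splitting and the induction on systems *)

Section LinearForms.
Variables (K : fieldType) (V : lmodType K) (n : nat) (lam : 'rV[{poly K}]_n).

Lemma lin_formD (x x' : 'I_n -> nat -> V) :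
  lin_form lam (fun l i => x l i + x' l i) = lin_form lam x + lin_form lam x'.
Proof.
rewrite /lin_form -big_split; apply: eq_bigr => l _ /=.
by rewrite -big_split; apply: eq_bigr => i _; rewrite scalerDr.
Qed.

Lemma lin_form_delta l i (d : V) :
  lin_form lam (fun l' i' => if (l' == l) && (i' == i) then d else 0) = (lam 0 l)`_i *: d.
Proof.
rewrite /lin_form (bigD1 l) //= [X in _ + X]big1 ?addr0 => [|l' /negPf l'l]; last first.
  by rewrite big1 // => i' _; rewrite l'l scaler0.
have [lt_i|le_i] := ltnP i (size (lam 0 l)).
  rewrite (bigD1 (Ordinal lt_i)) //= !eqxx [X in _ + X]big1 ?addr0 // => i' i'i.
  by rewrite -val_eqE in i'i; rewrite (negPf i'i) scaler0.
rewrite nth_default // scale0r big1 // => i' _.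
by rewrite eqxx ltn_eqF ?scaler0 // (leq_trans _ le_i).
Qed.

Lemma lin_form_onto l i (x : 'I_n -> nat -> V) t : (lam 0 l)`_i != 0 ->
  exists x', lin_form lam x' = t /\
    forall l' i', ~~ ((l' == l) && (i' == i)) -> x' l' i' = x l' i'.
Proof.
move=> c0.
exists (fun l' i' => x l' i' + (if (l' == l) && (i' == i) then
  ((lam 0 l)`_i)^-1 *: (t - lin_form lam x) else 0)); split=> [|l' i' /negPf ->].
  by rewrite lin_formD lin_form_delta scalerA divff // scale1r addrC subrK.
by rewrite addr0.
Qed.

End LinearForms.

Section Splitting.
Variables (L : language) (K : fieldType) (T : theory L) (F : vs_formulas L K).
Variables (C : kernel_config K) (D : formula_set L) (p r : nat).
Hypothesis T_vspace : forall M : structure L, models M T ->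
  infinite_set [set x : M | inV F x].
Hypothesis D_splitting : splitting_strategy T F D.

Notation th N := (@mt_theta L K T F N).

Lemma unused_dependency n q (psi : pform L n p q) (phi : formula L ('I_1 + 'I_q))
    (lam : 'rV[{poly K}]_n) l i :
  (lam 0 l)`_i != 0 -> ~ occurs (inl (inl (l, i))) psi ->
  (forall (M : model T F) (d : 'I_q -> M),
     finite_set [set y : M | sat (join (args1 y) d) phi]) ->
  (forall (M : model T F) x (z : 'I_p -> M) w, psat psi x z w ->
     sat (join (args1 (toM (lin_form lam x))) w) phi) ->
  forall (M : model T F) x (z : 'I_p -> M) w, ~ psat psi x z w.
Proof.
move=> c0 nocc fin imp M x z w Px.
apply: (T_vspace (md_T M)); apply: sub_finite_set (fin M w) => _ /inV_toM[t <-] /=.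
have [x' [<- Ex]] := lin_form_onto x t c0; apply: (imp _ _ z).
suff E : psat psi x z w <-> psat psi x' z w by apply/E.
apply: sat_occurs => -[[[l' i']|j]|j] //= occ; congr toM; rewrite Ex //.
by apply/negP => /andP[/eqP El /eqP Ei]; apply: nocc; rewrite -El -Ei.
Qed.

Section OneDisjunct.
Variable E : disjunct L C p r.
Hypotheses (psi_bounded : bounded_by (dj_psi E)) (algY : algebraic_pattern T F (dj_Y E)).
Hypotheses (pi_inj : injective (@dj_pi _ _ _ _ _ E))
  (compat : pattern_compatible T F (dj_Y E) (@dj_pi _ _ _ _ _ E)).

Let S := dj_S E.
Let m := ss_m S.
Let n := ss_n S.
Let s := dj_s E.
Let g k := ss_f (s := S) k ^+ ss_q k.

Hypothesis IHm : forall (A B : finType) s' (Y' : pattern L C s' r)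
  (Psi' : vpred T F ((A + B) * nat + 'I_s') ('I_p + 'I_r))
  (g' : B -> {poly K}) (pi' : B -> 'I_s'),
  (#|A| < m)%N -> algebraic_pattern T F Y' -> vdef Psi' -> (forall b, g' b != 0) ->
  Good C D (csystem Y' Psi' g' pi').
Hypothesis IHd : forall (A B : finType) s' (Y' : pattern L C s' r)
  (Psi' : vpred T F ((A + B) * nat + 'I_s') ('I_p + 'I_r))
  (g' : B -> {poly K}) (pi' : B -> 'I_s'),
  (#|A| <= m)%N -> (\sum_b (size (g' b)).-1 < \sum_k (size (g k)).-1)%N ->
  algebraic_pattern T F Y' -> vdef Psi' -> (forall b, g' b != 0) ->
  Good C D (csystem Y' Psi' g' pi').

Definition with_psi (psi : pform L (m + n) p (s + r)) : disjunct L C p r :=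
  @Disjunct L K C p r S s (dj_Y E) (@dj_pi _ _ _ _ _ E) psi.

Section Dependent.
Variables (psi : pform L (m + n) p (s + r)) (phi : formula L ('I_1 + 'I_(s + r))).
Variable lam : 'rV[{poly K}]_(m + n).
Hypothesis psi_occ : forall v, occurs v psi -> occurs v (dj_psi E).
Hypothesis phi_fin : forall (M : model T F) (d : 'I_(s + r) -> M),
  finite_set [set y : M | sat (join (args1 y) d) phi].
Hypothesis lam0 : lam != 0.
Hypothesis psi_phi : forall (M : model T F) x (z : 'I_p -> M) w, psat psi x z w ->
  sat (join (args1 (toM (lin_form lam x))) w) phi.

(** The additional pattern coordinate holds the value of the linear form. Constraints and dependency
    are both part of the relation, as [free_step] and [torsion_step] expect. *)
Definition dependent_pred : vpred T F ('I_(m + n) * nat + 'I_(s + 1)) ('I_p + 'I_r) :=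
  fun M v u =>
  psat psi (fun l i => v (inl (l, i))) (u \o inl)
    (Defs.cat_tuple (fun j => toM (v (inr (lshift 1 j)))) (u \o inr)) /\
  (forall k, leval v (poly_lexp 'I_(s + 1) (g k) (rshift m k)) =
             v (inr (lshift 1 (dj_pi k)))) /\
  leval v (flatten [seq poly_lexp 'I_(s + 1) (lam 0 l) l | l <- enum 'I_(m + n)]) =
    v (inr (rshift s ord0)).

Lemma vd_dependent_pred : vdef dependent_pred.
Proof.
apply: vd_and; last apply: vd_and.
- pose t (v : 'I_(m + n) * nat + 'I_p + 'I_(s + r)) :
      'I_(m + n) * nat + 'I_(s + 1) + ('I_p + 'I_r) := match v with
    | inl (inl li) => inl (inl li) | inl (inr j) => inr (inl j)
    | inr k => match fintype.split k with
      | inl j => inl (inr (lshift 1 j)) | inr j => inr (inr j) end end.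
  exists (rename_form t psi) => M v u; rewrite sat_rename /psat.
  set a := _ \o _; set b := passign _ _ _; suff -> : a = b by [].
  apply/funext => -[[[l i]|j]|k] //; rewrite /a /b /= /Defs.cat_tuple.
  by case: (fintype.split k).
- by apply: vd_all_fin => k; exact: vd_lin.
- exact: vd_lin.
Qed.

Lemma dependent_predE (N : model_theta T F) (x : 'I_(m + n) -> mt_vs N)
    (y : 'I_(s + 1) -> mt_vs N) (z : 'I_p -> N) (w : 'I_r -> N) :
  dependent_pred (M := reduct_model N) (join (orbits (th N) x) y) (join z w) <->
  [/\ psat (M := reduct_model N) psi (fun l i => iter i (th N) (x l)) z
        (Defs.cat_tuple (fun j => toN (y (lshift 1 j))) w),
      forall k, pev (g k) (th N) (x (rshift m k)) = y (lshift 1 (dj_pi k))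
    & \sum_l pev (lam 0 l) (th N) (x l) = y (rshift s ord0)].
Proof.
have Elam : leval (join (orbits (th N) x) y)
    (flatten [seq poly_lexp 'I_(s + 1) (lam 0 l) l | l <- enum 'I_(m + n)]) =
    \sum_l pev (lam 0 l) (th N) (x l).
  rewrite leval_flatten big_enum; apply: eq_bigr => l _; exact: leval_poly.
split=> [[H1 [H2 H3]]|[H1 H2 H3]]; split=> //.
- by move=> k; rewrite -(leval_poly (th N) (g k) (rshift m k) x y); exact: H2.
- by rewrite -Elam; exact: H3.
split=> [k|]; first by rewrite leval_poly; exact: H2.
by rewrite Elam; exact: H3.
Qed.

(** The parameters of [phi] are y w, that is, the earlier coordinates and w, so [phi] is a
    legitimate formula for one more coordinate of the pattern. *)
Lemma dependent_system :
  exists2 Y' : pattern L C (s + 1) r, algebraic_pattern T F Y' &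
    forall N : model_theta T F, TC_image_complete C N -> forall z w,
      system Y' dependent_pred (N := N) z w <-> disjunct_holds (with_psi psi) z w.
Proof.
pose t (v : 'I_1 + 'I_(s + r)) : 'I_1 + 'I_s + 'I_r := match v with
  | inl i => inl (inl i) | inr k => match fintype.split k with
    | inl j => inl (inr j) | inr j => inr j end end.
have Ht (M : structure L) x (y : 'I_s -> M) w :
    sat (join (join (args1 x) y) w) (rename_form t phi) <->
    sat (join (args1 x) (Defs.cat_tuple y w)) phi.
  rewrite sat_rename.
  set a := _ \o _; set b := join _ _; suff -> : a = b by [].
  apply/funext => -[j|k] //; rewrite /a /b /= /Defs.cat_tuple.
  by case: (fintype.split k).
have [|Y' [algY' HY']] := pattern_ext (fun _ : 'I_1 => rc_poly C 1)
    (Phi := fun _ => rename_form t phi) algY.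
  move=> _ M y w; apply: sub_finite_set (phi_fin (Defs.cat_tuple y w)) => x /=.
  by rewrite Ht.
exists Y' => // N tcN z w; split.
  move=> [y /HY'[Yy _] [x /dependent_predE[Px cx _]]].
  exists (y \o lshift 1) => //; exists x; split; last by move=> k; exact: cx.
  exact/sat_psi_theta.
move=> [y Yy [x [/sat_psi_theta Px cx]]].
pose a := \sum_l pev (lam 0 l) (th N) (x l).
pose y' := Defs.cat_tuple y (fun _ : 'I_1 => a).
have y'l : y' \o lshift 1 = y by exact: cat_tuple_lshift.
have y'r k : y' (rshift s k) = a.
  by rewrite -[LHS]/((y' \o @rshift _ _) k) cat_tuple_rshift.
have y'j j : y' (lshift 1 j) = y j by rewrite -[LHS]/((y' \o lshift 1) j) y'l.
exists y'.
  apply/HY'; rewrite y'l; split=> // k; exists a; split; first by rewrite y'r [RHS]pev1.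
  apply/Ht; have := psi_phi Px.
  by congr (sat (join _ (Defs.cat_tuple _ _)) _); apply/funext => j; rewrite y'j.
exists x; apply/dependent_predE; split=> [|k|].
- by move: Px; congr (psat _ _ _ (Defs.cat_tuple _ _)); apply/funext => j; rewrite y'j.
- by rewrite y'j; exact: cx.
- by rewrite y'r.
Qed.

(** Three cases. A coefficient of lambda_k at an exponent excluded by boundedness makes [psi]
    inconsistent. A free variable in the relation leads to [free_step]. Otherwise every lambda_k has
    smaller degree than g_k and some lambda_k is nonzero, so g_k does not divide it and
    [torsion_step] applies. *)
Lemma good_dependent : Good C D (fun (N : model_theta T F) z w => disjunct_holds (with_psi psi) z w).
Proof.
have g0 k : g k != 0 by apply: Kirr_exp_neq0; exact: ss_irr.
have [[k [i [le_i c0]]]|bnd] := pselect (exists k i,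
    ((size (g k)).-1 <= i)%N /\ (lam 0 (rshift m k))`_i != 0).
  apply: good_ext (good_false T F C D p r) => N tcN z w; split=> // -[y _ [x [/sat_psi_theta Px _]]].
  apply: (unused_dependency c0 _ phi_fin psi_phi Px) => /psi_occ.
  exact: psi_bounded.
have [Y' algY' EY'] := dependent_system.
apply: (good_ext (Q := system Y' dependent_pred)) => [N tcN z w|]; first exact: EY'.
have dep (N : model_theta T F) : TC_image_complete C N -> forall z w y x,
    in_pattern Y' w y ->
    dependent_pred (M := reduct_model N) (join (orbits (th N) x) y) (join z w) ->
    (forall k, pev (g k) (th N) (x (rshift m k)) = y (lshift 1 (dj_pi k))) /\
    \sum_l pev (lam 0 l) (th N) (x l) = y (rshift s ord0).
  by move=> _ z w y x _ /dependent_predE[].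
have [free|nofree] := pselect (exists l, lam 0 (lshift n l) != 0).
  exact: (free_step algY' vd_dependent_pred dep g0 free IHm).
have lam_li l : lam 0 (lshift n l) = 0.
  by apply: contrapT => /eqP ll; apply: nofree; exists l.
apply: (torsion_step algY' vd_dependent_pred dep (f := @ss_f _ _ S) (q := @ss_q _ _ S)) => //.
- exact: ss_irr.
- exact: ss_q_gt0.
apply: contrapT => H; move/eqP: lam0; apply; apply/rowP => l; rewrite mxE.
case: (split_ordP l) => k -> //; apply: contrapT => /eqP lk; apply: H; exists k.
apply/negP => /dvdp_leq -/(_ lk); apply/negP; rewrite -ltnNge.
rewrite -[X in (_ < X)%N](prednK (n := size _)) ?size_poly_gt0 // ltnS.
apply/leq_sizeP => i le_i; apply: contrapT => /eqP c0; apply: bnd.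
by exists k, i.
Qed.

End Dependent.

Lemma good_split : Good C D (fun (N : model_theta T F) z w => disjunct_holds E z w).
Proof.
have [n' [psis [occ psisE cases]]] := D_splitting (dj_psi E).
apply: (good_ext (Q := fun (N : model_theta T F) z w => exists j, disjunct_holds (with_psi (psis j)) z w)).
  move=> N tcN z w; split=> [[j [y Yy [x [/sat_psi_theta Px cx]]]]|[y Yy [x [/sat_psi_theta Px cx]]]].
    by exists y => //; exists x; split=> //; apply/sat_psi_theta/psisE; exists j.
  have [j Pj] := (psisE _ _ _ _).1 Px; exists j.
  by exists y => //; exists x; split=> //; apply/sat_psi_theta.
apply: good_exists => j; have [Dj|[phi [lam [phi_fin lam0 imp]]]] := cases j.
  apply: good_disjunct; split=> // k i le_i /occ; exact: psi_bounded.
apply: (good_dependent (phi := phi) _ _ lam0 imp) => [v|M d]; first exact: occ.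
by have [] := phi_fin M d.
Qed.

End OneDisjunct.

(** The outer induction on m is for all d, because steps that remove free variables give no bound on
    the new degrees. *)
Lemma good_csystem m d (A B : finType) s (Y : pattern L C s r)
    (Psi : vpred T F ((A + B) * nat + 'I_s) ('I_p + 'I_r))
    (g : B -> {poly K}) (pi : B -> 'I_s) :
  (#|A| < m)%N -> (\sum_b (size (g b)).-1 < d)%N ->
  algebraic_pattern T F Y -> vdef Psi -> (forall b, g b != 0) ->
  Good C D (csystem Y Psi g pi).
Proof.
elim: m d A B s Y Psi g pi => // m IHm; elim=> // d IHd A B s Y Psi g pi.
rewrite !ltnS => Am gd algY dPsi g0.
have [[algC A0]|notalg] := pselect (algebraic_kc C /\ (0 < #|A|)%N).
  apply: algebraic_step => // B' s' Y' Psi' g' pi' algY' dPsi' g'0.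
  (* No free variable is left, so the outer induction applies, whatever the degrees have become. *)
  by apply: (IHm (\sum_b (size (g' b)).-1).+1) => //; rewrite card_void (leq_trans A0).
have A0 : algebraic_kc C -> #|A| = 0%N.
  move=> algC; apply/eqP; rewrite -leqn0 leqNgt; apply/negP => A0.
  by apply: notalg.
have [E [Em Es bnd [algYE pi_inj compat] HE]] := normal_form pi A0 algY dPsi g0.
apply: (good_ext (Q := fun (N : model_theta T F) z w => disjunct_holds E z w)) => [N tcN z w|].
  by rewrite HE.
apply: good_split => // A' B' s' Y' Psi' g' pi'; rewrite Em => A'A.
  by apply: (IHm (\sum_b (size (g' b)).-1).+1) => //; exact: leq_trans A'A Am.
move=> g'E; apply: IHd; first by rewrite ltnS (leq_trans A'A).
exact: leq_trans g'E (leq_trans Es gd).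
Qed.

End Splitting.

(** * Unnesting existential formulas *)

Section Unnesting.
Variables (L : language) (K : fieldType) (T : theory L) (F : vs_formulas L K).

Notation th N := (@mt_theta L K T F N).

(* P is expressed by Theta once the auxiliary vectors x, standing for the
   arguments of theta, satisfy Delta.  Delta is always solvable, whence
   "exists x, Delta /\ Theta" and "forall x, Delta -> Theta" agree and negations pose no
   problem. *)
Definition unnested (X X' : Type) (i : X -> X')
    (P : forall N : model_theta T F, (X' -> N) -> Prop) : Prop :=
  exists (J : finType) (Delta : vpred T F (J * nat) X) (Theta : vpred T F (J * nat) X'),
  [/\ vdef Delta, vdef Theta,
      forall (N : model_theta T F) (v : X -> N), exists x, Delta (reduct_model N) (orbits (th N) x) v
    & forall (N : model_theta T F) x (v : X' -> N),
        Delta (reduct_model N) (orbits (th N) x) (v \o i) ->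
        Theta (reduct_model N) (orbits (th N) x) v <-> P N v].

Definition graph (X : Type) (t : term (Ltheta L) X) (N : model_theta T F)
    (v : option X -> N) : Prop :=
  v None = eval (v \o Some) t.

Lemma unnest_family (X : Type) k (t : 'I_k -> term (Ltheta L) X) :
  (forall i, unnested Some (graph (t i))) ->
  unnested inr (fun N (v : 'I_k + X -> N) => forall i, v (inl i) = eval (v \o inr) (t i)).
Proof.
move=> /dep_choice[J R1]; have [Delta R2] := dep_choice R1.
have [Theta R] := dep_choice R2.
pose J' : finType := {i : 'I_k & J i}.
pose inj i (jn : J i * nat) : J' * nat := (Tagged J jn.1, jn.2).
pose wit i (x : option X) : 'I_k + X := if x is Some x then inr x else inl i.
exists J', (fun (M : model T F) v u => forall i, Delta i M (v \o @inj i) u).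
exists (fun (M : model T F) v u => forall i, Theta i M (v \o @inj i) (u \o wit i)); split.
- by apply: vd_all_fin => i; have [dD _ _ _] := R i; exact: (vd_sub (@inj i) id dD).
- by apply: vd_all_fin => i; have [_ dT _ _] := R i; exact: vd_sub.
- move=> N v.
  have Hx i : exists x, Delta i (reduct_model N) (orbits (th N) x) v.
    by have [_ _ ex _] := R i; exact: ex.
  have [x Hx'] := dep_choice Hx.
  by exists (fun j : J' => x (tag j) (tagged j)) => i; exact: Hx'.
move=> N x v Hx.
have E i : Theta i (reduct_model N) (orbits (th N) x \o @inj i) (v \o wit i) <->
    v (inl i) = eval (M := N) (v \o inr) (t i).
  have [_ _ _ uq] := R i.
  exact: (uq N (fun j => x (Tagged J j)) (v \o wit i) (Hx i)).
by split=> H i; apply/E.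
Qed.

Lemma unnest_term (X : Type) (t : term (Ltheta L) X) : unnested Some (graph t).
Proof.
elim: t => [x0|[f|] a IH].
- exists void, (fun _ _ _ => True), (fun (M : model T F) v u => u None = u (Some x0)); split.
  + exact: vd_true.
  + exact: (vd_eqM T F (inr None) (inr (Some x0))).
  + by move=> N _; exists (of_void _).
  + by [].
- have [J [Delta [Theta [dD dT ex uq]]]] := unnest_family IH.
  exists J, Delta, (fun (M : model T F) v u => exists d : 'I_(far f) -> M,
    Theta M v (join d (u \o Some)) /\ u None = fint M f d); split=> //.
    pose wit (x : 'I_(far f) + X) : 'I_(far f) + option X :=
      match x with inl i => inl i | inr x => inr (Some x) end.
    have dG : vdef (fun (M : model T F) (v : J * nat -> VS M)
        (u : 'I_(far f) + option X -> M) => u (inr None) = fint M f (u \o inl)).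
      by exists (Eq (Var (inr (inr None))) (App f (fun i => Var (inr (inl i))))).
    apply: vd_ext (vd_exfinM (vd_and (vd_sub id wit dT) dG)) => M v u.
    have E (d : 'I_(far f) -> M) : join d u \o wit = join d (u \o Some).
      by apply/funext => -[].
    by split=> -[d]; rewrite ?E => -[H1 H2]; exists d; rewrite ?E.
  move=> N x v Hx; rewrite /graph /=; split.
    move=> [d [/(uq N x (join d (v \o Some)) Hx) Ed ->]].
    by congr fint; apply/funext => i; exact: Ed.
  move=> ->; exists (fun i => eval (v \o Some) (a i)); split=> //.
  exact/(uq N x (join _ (v \o Some)) Hx).
have [J [Delta [Theta [dD dT ex uq]]]] := IH ord0.
pose J' : finType := (unit + J)%type.
pose inj (jn : J * nat) : J' * nat := (inr jn.1, jn.2).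
(* The new vector is the argument of theta if that lies in V, and 0 otherwise. As theta vanishes
   outside V and is linear on V, theta of this vector is the value of the term in both cases. *)
exists J', (fun (M : model T F) v u => Delta M (v \o inj) u /\ exists c : M,
  Theta M (v \o inj) (oapp u c) /\
  (toM (v (inl tt, 0%N)) = c \/ (inV F c -> False) /\ v (inl tt, 0%N) = 0)).
exists (fun (M : model T F) v u => u None = toM (v (inl tt, 1%N))); split.
- apply: vd_and; first exact: (vd_sub inj id dD).
  apply: (vd_exM (P := fun (M : model T F) v (u : option X -> M) => Theta M (v \o inj) u /\
    (toM (v (inl tt, 0%N)) = u None \/ (inV F (u None) -> False) /\ v (inl tt, 0%N) = 0))).
  apply: vd_and; first exact: (vd_sub inj id dT).
  apply: vd_or; first exact: (vd_eqM T F (inl (inl tt, 0%N)) (inr None)).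
  apply: vd_and; last exact: vd_zero.
  by apply: vd_imp; [exact: vd_inV|exact: vd_false].
- exact: (vd_eqM T F (inr None) (inl (inl tt, 1%N))).
- move=> N v; have [x Hx] := ex N v.
  have [x0 Hx0] : exists x0 : mt_vs N, toM (M := reduct_model N) x0 = eval v (a ord0) \/
      (inV F (M := reduct N) (eval v (a ord0)) -> False) /\ x0 = 0.
    have [/(inV_toM (M := reduct_model N))[x0 Hx0]|Hn] :=
      pselect (inV F (M := reduct N) (eval v (a ord0))); first by exists x0; left.
    by exists 0; right.
  exists (fun j => match j with inl _ => x0 | inr j => x j end); split=> //.
  by exists (eval v (a ord0)); split=> //; exact/(uq N x (oapp v _) Hx).
move=> N x v [Hx [c [/(uq N (x \o inr) (oapp (v \o Some) c) Hx) Ec Hc]]].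
have Et : eval (M := N) (v \o Some) (@App (Ltheta L) X None a) = @theta_of L N c.
  rewrite /graph /= in Ec; rewrite Ec /= /theta_of; congr fint.
  by apply/funext => i; rewrite (ord1 i).
suff E : toM (M := reduct_model N) (th N (x (inl tt))) = @theta_of L N c.
  by rewrite /graph Et /= -E.
case: Hc => [<-|[nV x0]]; first by rewrite -[LHS](mt_thetaV (x (inl tt))).
have {}x0 : x (inl tt) = 0 by exact: x0.
by rewrite x0 linear0 (mt_theta0 nV).
Qed.

Lemma unnest_atom (X : Type) k (t : 'I_k -> term (Ltheta L) X) (q : formula L ('I_k + X)) :
  unnested id (fun N v => sat (M := reduct N) (join (fun i => eval v (t i)) v) q).
Proof.
have [J [Delta [Theta [dD dT ex uq]]]] := unnest_family (fun i => unnest_term (t i)).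
exists J, Delta, (fun (M : model T F) v u => exists d : 'I_k -> M, Theta M v (join d u) /\ sat (join d u) q).
split=> //.
  apply: (vd_exfinM (P := fun (M : model T F) v (u : 'I_k + X -> M) => Theta M v u /\ sat u q)).
  apply: vd_and => //; exists (rename_form inr q) => M v u.
  by rewrite sat_rename.
move=> N x v Hx; split.
  move=> [d [/(uq N x (join d v) Hx) Ed]].
  by rewrite (_ : d = fun i => eval v (t i)) //; apply/funext => i; exact: Ed.
move=> Hq; exists (fun i => eval v (t i)); split=> //.
exact/(uq N x (join _ v) Hx).
Qed.

Lemma unnest_binary (X : Type) (op : Prop -> Prop -> Prop)
    (P Q : forall N : model_theta T F, (X -> N) -> Prop) :
  (forall P1 P2 Q1 Q2, (P1 <-> Q1) -> (P2 <-> Q2) -> (op P1 P2 <-> op Q1 Q2)) ->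
  (forall Xv (P1 P2 : vpred T F Xv X), vdef P1 -> vdef P2 ->
    vdef (fun (M : model T F) v u => op (P1 M v u) (P2 M v u))) ->
  unnested id P -> unnested id Q -> unnested id (fun N v => op (P N v) (Q N v)).
Proof.
move=> opE opD [J1 [D1 [P1 [dD1 dP1 ex1 uq1]]]] [J2 [D2 [P2 [dD2 dP2 ex2 uq2]]]].
pose l (jn : J1 * nat) : (J1 + J2) * nat := (inl jn.1, jn.2).
pose r (jn : J2 * nat) : (J1 + J2) * nat := (inr jn.1, jn.2).
exists (J1 + J2)%type, (fun (M : model T F) v u => D1 M (v \o l) u /\ D2 M (v \o r) u).
exists (fun (M : model T F) v u => op (P1 M (v \o l) u) (P2 M (v \o r) u)); split.
- by apply: vd_and; [exact: (vd_sub l id dD1)|exact: (vd_sub r id dD2)].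
- by apply: opD; [exact: (vd_sub l id dP1)|exact: (vd_sub r id dP2)].
- move=> N v; have [x1 Hx1] := ex1 N v; have [x2 Hx2] := ex2 N v.
  by exists (join x1 x2).
move=> N x v [/(uq1 N (x \o inl) v) ? /(uq2 N (x \o inr) v) ?]; exact: opE.
Qed.

Lemma unnest_qf (X : Type) (phi : formula (Ltheta L) X) : quantifier_free phi ->
  unnested id (fun N v => sat v phi).
Proof.
elim: X / phi => [X|X t u|X s a|X p IHp q IHq|X p IHp q IHq|X p IHp q IHq
    |X p IHp|X p IHp] //=.
- move=> _; exists void, (fun _ _ _ => True), (fun _ _ _ => False); split.
  + exact: vd_true.
  + exact: vd_false.
  + by move=> N _; exists (of_void _).
  + by [].
- move=> _; pose i1 : 'I_2 := lift ord0 ord0.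
  exact: (unnest_atom (fun i : 'I_2 => if i == ord0 then t else u)
    (Eq (Var (inl ord0)) (Var (inl i1)))).
- by move=> _; exact: (unnest_atom a (@Rel L _ s (fun i => Var (inl i)))).
- move=> [/IHp {}IHp /IHq {}IHq]; apply: (unnest_binary (op := fun P Q => P -> Q)) => //.
    by move=> P1 P2 Q1 Q2 -> ->.
  by move=> Xv P1 P2; exact: vd_imp.
- move=> [/IHp {}IHp /IHq {}IHq]; apply: unnest_binary => //.
    by move=> P1 P2 Q1 Q2 -> ->.
  by move=> Xv P1 P2; exact: vd_and.
- move=> [/IHp {}IHp /IHq {}IHq]; apply: unnest_binary => //.
    by move=> P1 P2 Q1 Q2 -> ->.
  by move=> Xv P1 P2; exact: vd_or.
Qed.

Lemma unnest_existential (X : Type) (phi : formula (Ltheta L) X) : existential phi ->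
  exists (J : finType) (Psi : vpred T F (J * nat) X), vdef Psi /\
    forall (N : model_theta T F) (v : X -> N),
      sat v phi <-> exists x, Psi (reduct_model N) (orbits (th N) x) v.
Proof.
have qf Y (q : formula (Ltheta L) Y) : quantifier_free q ->
    exists (J : finType) (Psi : vpred T F (J * nat) Y), vdef Psi /\
    forall (N : model_theta T F) (v : Y -> N),
      sat v q <-> exists x, Psi (reduct_model N) (orbits (th N) x) v.
  move=> /unnest_qf[J [Delta [Psi [dD dP ex uq]]]].
  exists J, (fun (M : model T F) v u => Delta M v u /\ Psi M v u); split; first exact: vd_and.
  move=> N v; have [x Hx] := ex N v.
  split=> [Hq|[x' [Hx' /(uq N x' v Hx')]]] //.
  by exists x; split=> //; exact/(uq N x v Hx).
elim: X / phi => [X|X t u|X s a|X p _ q _|X p _ q _|X p _ q _|X p _|X p IH] Hp;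
  try exact: qf.
have [J [Psi [dP H]]] := IH Hp.
(* Quantifiers over elements are absorbed into the L-relation; only vectors to which theta is
   applied stay outside. *)
exists J, (fun (M : model T F) v u => exists c : M, Psi M v (oapp u c)); split; first exact: vd_exM.
by move=> N v /=; split=> [[c /H[x Hx]]|[x [c Hx]]]; [exists x, c|exists c; apply/H; exists x].
Qed.

End Unnesting.

Theorem theorem3p5 (L : language) (K : fieldType) (T : theory L)
    (F : vs_formulas L K) (C : kernel_config K) (D : formula_set L)
    (T_model_complete : model_complete T)
    (T_vspace : forall M : structure L, models M T ->
       inhabited (vspace_in F M) /\ infinite_set [set x : M | inV F x])
    (T_H4 : hypH4 T F)
    (D_suitable : suitable T F D)
    (D_splitting : splitting_strategy T F D)
    (p r : nat) (phi : formula (Ltheta L) ('I_p + 'I_r)%type)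
    (phi_ex : existential phi) :
  exists (n : nat) (E : 'I_n -> disjunct L C p r),
    (forall j, admissible T F D (E j)) /\
    (forall N : model_theta T F, TC_image_complete C N ->
       forall (z : 'I_p -> N) (w : 'I_r -> N),
         sat (join z w) phi <-> exists j, disjunct_holds (E j) z w).
Proof.
have [J [Psi [dPsi HPsi]]] := unnest_existential T F phi_ex.
(* The induction starts with the empty pattern and no constraints: all vectors from unnesting are
   free. *)
pose Y : pattern L C 0 r := Pattern (fun _ => rc_poly C 0) (fun _ => Bot).
have algY : algebraic_pattern T F Y by case.
pose inj (jn : J * nat) : (J + void) * nat + 'I_0 := inl (inl jn.1, jn.2).
pose Psi1 : vpred T F ((J + void) * nat + 'I_0) ('I_p + 'I_r) :=
  fun M v u => Psi M (v \o inj) u.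
pose g (b : void) : {poly K} := 1%R; pose pi := of_void 'I_0.
have inf (M : structure L) (HM : models M T) := (T_vspace M HM).2.
have [//|||n [E [admE HE]]] :=
  good_csystem (C := C) inf D_splitting (Y := Y) (Psi := Psi1) (g := g) pi (leqnn _) (leqnn _).
- exact: (vd_sub inj id dPsi).
- by case.
exists n, E; split=> // N tcN z w; rewrite -HE // HPsi.
split=> [[x Hx]|[y _ [x [Hx _]]]]; last by exists (x \o inl).
exists (fun i : 'I_0 => False_rect _ (notF (ltn_ord i))); first by case.
by exists (join x (of_void _)); split=> // -[].
Qed.
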